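(* Let $H:\mathbb R_+\to(0,1)$ be continuous and satisfy: (H1) there are constants $0<h_1<h_2<1$ with $h_1\le H_t\le h_2$ for all $t\ge0$; (H2) there are constants $D>0$, $\kappa\in(0,1]$ with $|H_t-H_s|\le D|t-s|^\kappa$ for all $t\ge s>0$. Let $Y$ be the multifractional Brownian motion with Hurst function $H$, let $\theta\in\mathbb R$ be unknown, and let $X_t=\theta t+Y_t$, $t\ge0$. Define $\hat\theta_T=X_T/T$. Then: 1) $\hat\theta_T\to\theta$ almost surely as $T\to\infty$; 2) for every $T>0$, $\frac{T^{1-H_T}}{C(H_T)}(\hat\theta_T-\theta)$ has the standard normal distribution $N(0,1)$, where $C(H)=\left(\frac{\pi}{H\Gamma(2H)\sin(\pi H)}\right)^{1/2}$. Consequently, for $\alpha\in(0,1)$, the interval $\hat\theta_T\pm\frac{C(H_T)}{T^{1-H_T}}z_{1-\alpha/2}$ is a confidence interval of level $1-\alpha$ for $\theta$, where $z_p$ is the $p$-quantile of the standard normal distribution.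
   Context: The (harmonizable) multifractional Brownian motion with continuous functional parameter $H$ is $Y(t)=\int_{\mathbb R}\frac{e^{itu}-1}{|u|^{H_t+1/2}}\widetilde W(du)$, $t\ge0$, where $\widetilde W$ is the Fourier transform of real Gaussian white noise $W$, i.e. the unique complex-valued random measure with $\int_{\mathbb R}f(u)W(du)=\int_{\mathbb R}\widehat f(u)\widetilde W(du)$ a.s. for all $f\in L^2(\mathbb R)$.
   Formalization: Y is taken to be a version of the multifractional Brownian motion with almost surely continuous paths on [0,∞); since Y(t) is defined only almost surely for each t, the almost sure convergence in 1) fails for arbitrary versions. *)

(* Defs.v *)
From HB Require Import structures.
From mathcomp Require Import all_boot all_order all_algebra.
From mathcomp Require Import all_classical all_reals all_analysis.
Set Implicit Arguments.
Unset Strict Implicit.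
Unset Printing Implicit Defensive.
Import Order.TTheory GRing.Theory Num.Theory.
Import numFieldNormedType.Exports.
Local Open Scope classical_set_scope.
Local Open Scope ring_scope.

Section mbm_defs.
Context {R : realType}.
Notation leb := (@lebesgue_measure R).

Definition L2fun (f : R -> R) : Prop :=
  measurable_fun setT f /\ leb.-integrable setT (fun x => ((f x) ^+ 2)%:E).

Definition L1fun (f : R -> R) : Prop :=
  measurable_fun setT f /\ leb.-integrable setT (fun x => (f x)%:E).

(** Unitary Fourier transform of an integrable real function phi,
    phi^(x) = (2 pi)^(-1/2) \int phi(u) e^{-i u x} du,
    split into its real part and its imaginary part. *)
Definition FT_re (phi : R -> R) (x : R) : R :=
  (Num.sqrt (pi *+ 2))^-1 * Rintegral leb setT (fun u => phi u * cos (u * x)).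
Definition FT_im (phi : R -> R) (x : R) : R :=
  - ((Num.sqrt (pi *+ 2))^-1 * Rintegral leb setT (fun u => phi u * sin (u * x))).

(** [plancherel_FT f gr gi]: the (Fourier--Plancherel, L^2) Fourier transform
    of the real L^2 function f is the complex L^2 function gr + i gi.
    It is characterised (uniquely up to a.e. equality) by the multiplication
    formula  \int g phi = \int f phi^  for every real phi in L^1 /\ L^2. *)
Definition plancherel_FT (f gr gi : R -> R) : Prop :=
  L2fun gr /\ L2fun gi /\
  forall phi, L1fun phi -> L2fun phi ->
    Rintegral leb setT (fun u => gr u * phi u)
      = Rintegral leb setT (fun x => f x * FT_re phi x) /\
    Rintegral leb setT (fun u => gi u * phi u)
      = Rintegral leb setT (fun x => f x * FT_im phi x).

(** Real Gaussian white noise on R (isonormal process on L^2(R)):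
    W f = \int f(u) W(du).  Every finite linear combination
    \sum a_i W f_i is a centred Gaussian variable with variance
    \int (\sum a_i f_i)^2 (stated through its characteristic function,
    which also covers the degenerate case of variance 0). *)
Definition gaussian_white_noise d (T : measurableType d)
    (P : probability T R) (W : (R -> R) -> T -> R) : Prop :=
  (forall f, L2fun f -> measurable_fun setT (W f)) /\
  forall (n : nat) (fs : 'I_n -> R -> R) (a : 'I_n -> R),
    (forall i, L2fun (fs i)) ->
    let Z := fun w => \sum_(i < n) a i * W (fs i) w in
    let v := Rintegral leb setT (fun x => (\sum_(i < n) a i * fs i x) ^+ 2) in
    forall s : R,
      ('E_P[fun w => cos (s * Z w)] = (expR (- (s ^+ 2 * v / 2)))%:E)%E /\
      ('E_P[fun w => sin (s * Z w)] = 0)%E.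

(** Real and imaginary parts of the harmonizable kernel
    u |-> (e^{itu} - 1) / |u|^{h + 1/2}. *)
Definition mbm_kernel_re (h t u : R) : R :=
  (cos (t * u) - 1) / (`|u| `^ (h + 2^-1)).
Definition mbm_kernel_im (h t u : R) : R :=
  sin (t * u) / (`|u| `^ (h + 2^-1)).

(** Y is a (harmonizable) multifractional Brownian motion with functional
    parameter H, driven by the white noise W:
    Y(t) = \int (e^{itu}-1)/|u|^{H_t+1/2} W~(du) a.s., where W~ is the Fourier
    transform of W, i.e.  \int g W~(du) = \int f W(du) when f^ = g. *)
Definition is_mBm d (T : measurableType d) (P : probability T R)
    (W : (R -> R) -> T -> R) (H : R -> R) (Y : R -> T -> R) : Prop :=
  forall t, 0 <= t ->
    exists f, L2fun f /\
      plancherel_FT f (mbm_kernel_re (H t) t) (mbm_kernel_im (H t) t) /\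
      {ae P, forall w, Y t w = W f w}.

Definition Gamma (x : R) : R :=
  Rintegral leb `]0, +oo[ (fun s => s `^ (x - 1) * expR (- s)).

Definition Cst (h : R) : R :=
  Num.sqrt (pi / (h * Gamma (h *+ 2) * sin (pi * h))).

End mbm_defs.

(* Main.v *)
(** The Plancherel identity turns the variance of Y_t into the integral of
    2(1 - cos(tu))/|u|^(2h+1), h = H_t, which is t^(2h) C(h)^2: writing |u|^(-2h-1) as a
    Gamma integral of exponentials reduces it to the integral of s^(2h-1)/(1+s^2)
    over the half-line, i.e. to Euler's reflection formula, which follows from the
    partial fractions of the cotangent (Herglotz' trick).  The white noise is only
    known through its characteristic functions, so the law of Y_t is identified by
    the uniqueness of characteristic functions, proved with the Fejer kernel, whose
    Fourier transform is a tent.  This gives the normal law of the estimator, and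
    the confidence interval by symmetry of the normal law.

    For the strong consistency it suffices that Y_t/t -> 0.  Comparing the kernels
    at (s, H_s) and (t, H_t) bounds the variance of Y_t - Y_s, for
    1 <= s < t <= s + 1, by K s^(2b) (t-s)^(2g) for some b < 1 and g > 0; Gaussian
    tails, Borel-Cantelli and dyadic chaining on every interval [n, n+1] then give
    almost surely |Y_t| <= L t^(b') eventually, for some b' < 1. *)
Require Import Defs.
From HB Require Import structures.
From mathcomp Require Import all_boot all_order all_algebra.
From mathcomp Require Import all_classical all_reals all_analysis.
From mathcomp Require Import measurable_realfun ring lra.
Set Implicit Arguments.
Unset Strict Implicit.
Unset Printing Implicit Defensive.
Import Order.TTheory GRing.Theory Num.Theory.
Import numFieldNormedType.Exports.
Local Open Scope classical_set_scope.
Local Open Scope ring_scope.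

(** * Integrals over the line and the Gamma function *)

(** [plancherel_FT] gives the transform only through the multiplication formula, with no inversion
    at the start. Plancherel's identity is obtained by testing with Fejer-damped functions, whose
    transforms are explicit tents, and then letting the damping disappear. The Fejer integral is
    itself the case h = 1/2 of the integral that produces C(h), so one computation feeds the
    variance of Y_t, Plancherel's identity and the uniqueness of characteristic functions.

    For the consistency, the obstacle is that time and Hurst index move together. Comparing two
    powers of |u| costs a logarithm, unbounded both at 0 and at infinity. Enlarging [h1, h2] by a
    margin e to [a, b] inside ]0, 1[ absorbs this logarithm into the two extreme powers, so that all
    variances are compared with those at the fixed indices a and b. The tail bounds can stay crude:
    the exponential is only traded for a power high enough to beat the 2^k increments of each dyadic
    level and to be summable in n. *)

Section change_of_variable.
Context {R : realType}.
Notation leb := (@lebesgue_measure R).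
Local Open Scope ereal_scope.

Lemma measurable_affine (c d : R) :
  measurable_fun setT (fun x : measurableTypeR R => (c * x + d)%R : measurableTypeR R).
Proof. by apply: measurable_funD => //; apply: measurable_funM. Qed.

Let affine_image (c d : R) : {measure set (measurableTypeR R) -> \bar R} :=
  measure_function_pushforward__canonical__measure_function_Measure
    leb (measurable_affine c d).

(** Uniqueness of Lebesgue measure: the image measure scaled by [c] is a measure that agrees with it
    on half-open intervals, whose preimages are intervals [c] times shorter. *)
Lemma lebesgue_measure_affine (c d : R) (c0 : (0 < c)%R) (A : set R) :
  measurable A ->
  c%:E * leb ((fun x => c * x + d)%R @^-1` A) = leb A.
Proof.
move=> mA.
pose k : {nonneg R} := NngNum (ltW c0).
pose m : {measure set (measurableTypeR R) -> \bar R} := mscale k (affine_image c d).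
apply/esym; suff -> : leb A = m A by [].
apply: lebesgue_measure_unique => //= _ [[a b]] _ <-.
rewrite /m /mscale/= /pushforward/=.
have -> : (fun x => c * x + d)%R @^-1` [set` `]a, b]] =
    [set` `]((a - d) / c)%R, ((b - d) / c)%R]].
  apply/seteqP; split => x /=; rewrite !in_itv/= ltr_pdivrMr// ler_pdivlMr//;
  by rewrite ltrBlDr lerBrDr [(x * c)%R]mulrC.
rewrite !lebesgue_measure_itv/= !lte_fin ltr_pM2r ?invr_gt0// ltrD2r.
case: ifP => _; last by rewrite mule0.
rewrite -EFinB -EFinB -EFinM; congr EFin; field; exact: lt0r_neq0.
Qed.

Lemma ge0_integral_affine (c d : R) (c0 : (0 < c)%R) (f : R -> \bar R) (D : set R) :
  measurable D -> measurable_fun D f -> (forall x, D x -> 0 <= f x) ->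
  c%:E * \int[leb]_(x in (fun x => c * x + d)%R @^-1` D) f (c * x + d)%R
  = \int[leb]_(x in D) f x.
Proof.
move=> mD mf f0.
pose k : {nonneg R} := NngNum (ltW c0).
transitivity (\int[mscale k (affine_image c d)]_(x in D) f x).
  rewrite ge0_integral_mscale//; congr (_ * _).
  rewrite (@ge0_integral_pushforward _ _ _ _ _ _ (measurable_affine c d) leb D f)//.
  by move=> x /set_mem; exact: f0.
by apply: eq_measure_integral => A mA _; exact: lebesgue_measure_affine.
Qed.

Lemma ge0_integral_scale0y (c : R) (c0 : (0 < c)%R) (f : R -> \bar R) :
  measurable_fun (`]0%R, +oo[ : set R) f -> (forall x : R, (0 < x)%R -> 0 <= f x) ->
  c%:E * \int[leb]_(x in `]0%R, +oo[) f (c * x)%R = \int[leb]_(x in `]0%R, +oo[) f x.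
Proof.
move=> mf f0.
rewrite -(@ge0_integral_affine c 0%R c0 f)//; last first.
  by move=> x /=; rewrite in_itv/= andbT; exact: f0.
congr (_ * _).
have -> : ((fun x => c * x + 0)%R @^-1` `]0%R, +oo[%classic = `]0%R, +oo[%classic :> set R).
  by apply/seteqP; split => x /=; rewrite !in_itv/= !andbT addr0 pmulr_rgt0.
by apply: eq_integral => x _; rewrite addr0.
Qed.

Lemma ge0_integral_affineT (c d : R) (c0 : (0 < c)%R) (f : R -> \bar R) :
  measurable_fun setT f -> (forall x, 0 <= f x) ->
  c%:E * \int[leb]_x f (c * x + d)%R = \int[leb]_x f x.
Proof. by move=> mf f0; rewrite -(@ge0_integral_affine c d c0 f). Qed.

Lemma ge0_integral_oppT (f : R -> \bar R) :
  measurable_fun setT f -> (forall x, 0 <= f x) ->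
  \int[leb]_x f (- x)%R = \int[leb]_x f x.
Proof.
move=> mf f0.
have mN : measurable_fun setT (-%R : measurableTypeR R -> measurableTypeR R) by [].
rewrite -[LHS](@ge0_integral_pushforward _ _ _ _ _ _ mN leb setT f)//.
apply: eq_measure_integral => A mA _; exact: lebesgue_measureN.
Qed.

Lemma ge0_integral_evenT (f : R -> \bar R) :
  measurable_fun setT f -> (forall x, 0 <= f x) -> (forall x, f (- x)%R = f x) ->
  \int[leb]_x f x = 2%:E * \int[leb]_(x in `]0%R, +oo[) f x.
Proof.
move=> mf f0 fe.
rewrite -(setUv (`]0%R, +oo[%classic : set R)) ge0_integral_setU//=; last 3 first.
- exact: measurableC.
- by rewrite setUv.
- exact/disj_setPCl.
rewrite mule_natl mule2n; congr (_ + _).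
rewrite setCitvr/= integral_itv_obnd_cbnd; last exact: measurable_funTS.
rewrite ge0_integration_by_substitution0//.
by apply: eq_integral => x _; rewrite fe.
Qed.

End change_of_variable.

Section ftc_halfline.
Context {R : realType}.
Notation leb := (@lebesgue_measure R).
Variables f F : R -> R.
Hypothesis dF : forall x : R, 0 < x -> is_derive x 1 F (f x).
Hypothesis cf : forall x : R, 0 < x -> {for x, continuous f}.
Hypothesis f0 : forall x : R, 0 < x -> 0 <= f x.

Let cF (x : R) : 0 < x -> {for x, continuous F}.
Proof.
by move=> x0; apply: differentiable_continuous; apply/derivable1_diffP; have [] := dF x0.
Qed.

Let F'E (x : R) : 0 < x -> derive1 F x = f x.
Proof. by move=> x0; rewrite derive1E; have [_ ->] := dF x0. Qed.

Lemma FTC_itvcc (s t : R) : 0 < s -> s < t ->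
  (\int[leb]_(x in `[s, t]) (f x)%:E = (F t - F s)%:E)%E.
Proof.
move=> s0 st; rewrite EFinB; apply: continuous_FTC2 => //.
- apply: continuous_in_subspaceT => x /set_mem/=; rewrite in_itv/= => /andP[sx _].
  by apply: cf; exact: lt_le_trans sx.
- split.
  + by move=> x; rewrite in_itv/= => /andP[sx _]; have [] := dF (lt_trans s0 sx).
  + by apply: cvg_at_right_filter; exact: cF.
  + by apply: cvg_at_left_filter; apply: cF; exact: lt_trans st.
- by move=> x; rewrite in_itv/= => /andP[sx _]; rewrite F'E// (lt_trans s0).
Qed.

Lemma FTC_itvcy (t l : R) : 0 < t -> F x @[x --> +oo] --> l ->
  (\int[leb]_(x in `[t, +oo[) (f x)%:E = (l - F t)%:E)%E.
Proof.
move=> t0 Fl; rewrite EFinB; apply: ge0_continuous_FTC2y => //.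
- by move=> x tx; apply: f0; exact: lt_le_trans tx.
- apply: continuous_in_subspaceT => x /set_mem/=; rewrite in_itv/= andbT => sx.
  by apply: cf; exact: lt_le_trans sx.
- by move=> x tx; have [] := dF (lt_trans t0 tx).
- by apply: cvg_at_right_filter; exact: cF.
- by move=> x; rewrite in_itv/= andbT => sx; rewrite F'E// (lt_trans t0).
Qed.

Let mf : measurable_fun (`]0, +oo[ : set R) f.
Proof.
apply: open_continuous_measurable_fun => // x /set_mem/=.
by rewrite in_itv/= andbT; exact: cf.
Qed.

(** [f] may blow up at 0, as [x ^ (p - 1)] does for p < 1, so the compact intervals that exhaust
    []0, t]] are treated first and monotone convergence does the rest. *)
Lemma FTC_itv0c (t l : R) : 0 < t -> F x @[x --> 0^'+] --> l ->
  (\int[leb]_(x in `]0%R, t]) (f x)%:E = (F t - l)%:E)%E.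
Proof.
move=> t0 Fl.
(* Starting at [n.+2] keeps the left end strictly below [t] already for n = 0, as [FTC_itvcc]
   requires. *)
pose A n := `[t / n.+2%:R, t]%classic : set R.
have tn n : 0 < t / n.+2%:R by rewrite divr_gt0.
have -> : `]0%R, t]%classic = \bigcup_n A n.
  apply/seteqP; split => x /=.
    rewrite in_itv/= => /andP[x0 xt]; have [n tnx] : exists n : nat, t / x < n%:R.
      by exists (Num.trunc (t / x)).+1; exact: truncnS_gt.
    exists n => //; rewrite /A/= in_itv/= xt andbT.
    rewrite ler_pdivrMr// mulrC -ler_pdivrMr// (le_trans (ltW tnx))// ler_nat.
    by rewrite -addn2 leq_addr.
  move=> [n _]; rewrite /A/= !in_itv/= => /andP[nx ->]; rewrite andbT.
  exact: lt_le_trans nx.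
have H : (\int[leb]_(x in A n) (f x)%:E @[n --> \oo] -->
    \int[leb]_(x in \bigcup_n A n) (f x)%:E)%E.
  apply: ge0_nondecreasing_set_cvg_integral.
  - move=> m n mn; rewrite subsetEset => x; rewrite /A/= !in_itv/= => /andP[mx ->].
    rewrite andbT (le_trans _ mx)// ler_pM2l// lef_pV2 ?posrE//.
    by rewrite ler_nat !ltnS.
  - by move=> n; exact: measurable_itv.
  - move=> n; apply/measurable_EFinP; apply: measurable_funS mf => //.
    by move=> x; rewrite /A/= !in_itv/= andbT => /andP[nx _]; exact: lt_le_trans nx.
  - move=> n x; rewrite /A/= in_itv/= => /andP[nx _]; rewrite lee_fin f0//.
    exact: lt_le_trans nx.
apply: (cvg_unique _ H) => //.
have -> : (fun n => \int[leb]_(x in A n) (f x)%:E)%E =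
    (fun n => (F t - F (t / n.+2%:R))%:E).
  apply/funext => n; rewrite FTC_itvcc//.
  by rewrite ltr_pdivrMr// ltr_pMr// ltr1n.
apply: cvg_EFin; first exact: nearW.
apply: cvgB; first exact: cvg_cst.
move/cvg_at_rightP : Fl; apply; split => //.
rewrite -(mulr0 t); apply: cvgMr.
by have := @cvg_harmonic R; rewrite -cvg_shiftS.
Qed.

Lemma FTC_itv0y (l0 l : R) : F x @[x --> 0^'+] --> l0 -> F x @[x --> +oo] --> l ->
  (\int[leb]_(x in `]0%R, +oo[) (f x)%:E = (l - l0)%:E)%E.
Proof.
move=> F0 Fl.
have E : `]0%R, +oo[%classic = `]0, 1] `|` `]1, +oo[ :> set R.
  by rewrite -itv_bndbnd_setU ?bnd_simp.
rewrite E ge0_integral_setU//=.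
- rewrite (@FTC_itv0c 1 l0)// integral_itv_obnd_cbnd.
    by rewrite (@FTC_itvcy 1 l)// -EFinD; congr EFin; ring.
  apply/measurable_EFinP; apply: measurable_funS mf => // x /=.
  by rewrite !in_itv/= !andbT; exact: lt_trans.
- by rewrite -E; exact: (measurableT_comp _ mf).
- move=> x; rewrite /= !in_itv/= => -[/andP[x0 _]|/andP[x1 _]]; rewrite lee_fin f0//.
  exact: lt_trans x1.
- apply/disj_setPS => x /=; rewrite !in_itv/= andbT => -[/andP[_ x1]].
  by rewrite ltNge x1.
Qed.

End ftc_halfline.
Lemma cvg_to_eq {T : Type} {U : topologicalType} (F : set_system T) (f : T -> U) (a b : U) :
  a = b -> f @ F --> a -> f @ F --> b.
Proof. by move=> <-. Qed.

Section gamma_integral.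
Context {R : realType}.
Notation leb := (@lebesgue_measure R).
Implicit Types (a p s t u : R).

Lemma continuous_powR p x : 0 < x -> {for x, continuous (fun y : R => y `^ p)}.
Proof.
move=> x0; apply: differentiable_continuous; apply/derivable1_diffP.
by apply: derivable_powR; rewrite in_itv/= andbT.
Qed.

Lemma powRN_cvgy p : 0 < p -> x `^ (- p) @[x --> +oo] --> (0 : R).
Proof.
move=> p0; apply/cvgrPdist_lt => e e0; near=> x.
have x0 : 0 < x by near: x; exact: nbhs_pinfty_gt.
rewrite sub0r normrN ger0_norm ?powR_ge0// powRN.
have : e^-1 < x `^ p; last by move=> H; rewrite invf_plt ?posrE ?powR_gt0.
rewrite -[ltLHS]powRr1 ?invr_ge0 ?ltW// -[X in _ `^ X < _](@mulVf _ p) ?gt_eqF//.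
rewrite powRrM; apply: gt0_ltr_powR => //; rewrite ?nnegrE ?powR_ge0 ?ltW//.
Unshelve. all: end_near. Qed.

Lemma integral_powR_0c p t : 0 < p -> 0 < t ->
  (\int[leb]_(x in `]0%R, t]) (x `^ (p - 1))%:E = (t `^ p / p)%:E)%E.
Proof.
move=> p0 t0; rewrite (@FTC_itv0c _ _ (fun x => x `^ p / p) _ _ _ t 0)//.
- by rewrite subr0.
- move=> x x0; have ? := is_derive1_powR p x0; apply: is_derive_eq.
  by rewrite scaler0 add0r /GRing.scale/= mulrA mulVf ?mul1r// gt_eqF.
- by move=> x x0; exact: continuous_powR.
- by move=> x _; exact: powR_ge0.
- by apply: (@cvg_to_eq _ _ _ _ (0 * p^-1)); [exact: mul0r|apply: cvgMl; exact: powR_cvg0].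
Qed.

Lemma integral_powR_1y p : 0 < p ->
  (\int[leb]_(x in `[1%R, +oo[) (x `^ (- p - 1))%:E = (p^-1)%:E)%E.
Proof.
move=> p0; rewrite (@FTC_itvcy _ _ (fun x => - (x `^ (- p) / p)) _ _ _ 1 0)//.
- by rewrite sub0r opprK powR1 mul1r.
- move=> x x0; have ? := is_derive1_powR (- p) x0; apply: is_derive_eq.
  rewrite scaler0 add0r /GRing.scale/= mulrA mulrN mulVf ?gt_eqF//.
  by rewrite mulN1r opprK.
- by move=> x x0; exact: continuous_powR.
- by move=> x _; exact: powR_ge0.
- apply: (@cvg_to_eq _ _ _ _ (- (0 * p^-1))); first by rewrite mul0r oppr0.
  by apply: cvgN; apply: cvgMl; exact: powRN_cvgy.
Qed.

Lemma is_derive_expNM s (x : R) :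
  is_derive x 1 (fun x : R => expR (- (s * x))) (- s * expR (- (s * x))).
Proof.
have H : is_derive x 1 (fun y : R => - (s * y)) (- s).
  by apply: is_derive_eq; rewrite /GRing.scale/= mulr1.
by have := @is_derive1_comp _ expR (fun y : R => - (s * y)) x _ _ (is_derive_expR _) H; rewrite mulrC.
Qed.

Lemma expNM_cvgy s : 0 < s -> expR (- (s * x)) @[x --> +oo] --> (0 : R).
Proof.
move=> s0; apply: (@cvg_comp _ _ _ (fun x => s * x) (fun y => expR (- y)) _ +oo).
  exact: gt0_cvgMry.
exact: cvgr_expR.
Qed.

Lemma continuous_expNM s : continuous (fun x : R => expR (- (s * x))).
Proof.
move=> x; apply: differentiable_continuous; apply/derivable1_diffP.
by have [] := is_derive_expNM s x.
Qed.

Let prim s (x : R) : s != 0 ->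
  is_derive x 1 (fun x : R => - (s^-1 * expR (- (s * x)))) (expR (- (s * x))).
Proof.
move=> s0; have ? := is_derive_expNM s x; apply: is_derive_eq.
by rewrite /GRing.scale/= mulrA mulrN mulVf// mulN1r opprK.
Qed.

Lemma integral_expNM_cy s t : 0 < s -> 0 < t ->
  (\int[leb]_(x in `[t, +oo[) (expR (- (s * x)))%:E = (s^-1 * expR (- (s * t)))%:E)%E.
Proof.
move=> s0 t0.
rewrite (@FTC_itvcy _ _ (fun x => - (s^-1 * expR (- (s * x)))) _ _ _ t 0)//.
- by rewrite sub0r opprK.
- by move=> x x0; apply: prim; rewrite gt_eqF.
- by move=> x x0; exact: continuous_expNM.
- apply: (@cvg_to_eq _ _ _ _ (- (s^-1 * 0))); first by rewrite mulr0 oppr0.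
  by apply: cvgN; apply: cvgMr; exact: expNM_cvgy.
Qed.

Lemma integral_expNM_0y s : 0 < s ->
  (\int[leb]_(x in `]0%R, +oo[) (expR (- (s * x)))%:E = (s^-1)%:E)%E.
Proof.
move=> s0.
rewrite (@FTC_itv0y _ _ (fun x => - (s^-1 * expR (- (s * x)))) _ _ _ (- s^-1) 0)//.
- by rewrite sub0r opprK.
- by move=> x x0; apply: prim; rewrite gt_eqF.
- by move=> x x0; exact: continuous_expNM.
- apply: cvg_at_right_filter; apply: (@cvg_to_eq _ _ _ _ (- (s^-1 * expR (- (s * 0))))).
    by rewrite mulr0 oppr0 expR0 mulr1.
  by apply: cvgN; apply: cvgMr; exact: continuous_expNM.
- apply: (@cvg_to_eq _ _ _ _ (- (s^-1 * 0))); first by rewrite mulr0 oppr0.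
  by apply: cvgN; apply: cvgMr; exact: expNM_cvgy.
Qed.

Lemma laplace_oneBcos s : 0 < s ->
  (\int[leb]_(u in `]0%R, +oo[) ((1 - cos u) * expR (- (s * u)))%:E =
   ((s * (s ^+ 2 + 1))^-1)%:E)%E.
Proof.
move=> s0; have s21 : s ^+ 2 + 1 != 0 by rewrite gt_eqF// ltr_pwDr// sqr_ge0.
have sn0 : s != 0 by rewrite gt_eqF.
(* Chosen to solve B' - s B = 1 - cos, so that [B x * expR (- (s * x))] is a primitive; it is
   bounded, hence only its value at 0 contributes. *)
pose B x := (s * cos x - sin x) / (s ^+ 2 + 1) - s^-1.
have dB (x : R) : is_derive x 1 B ((- s * sin x - cos x) / (s ^+ 2 + 1)).
  rewrite /B; apply: is_derive_eq.
  by rewrite !scaler0 /GRing.scale/= !add0r; ring.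
rewrite (@FTC_itv0y _ _ (fun x => B x * expR (- (s * x))) _ _ _ (B 0) 0)//.
- congr EFin; rewrite /B cos0 sin0; field; exact/andP.
- move=> x x0; apply: is_derive_eq.
  by rewrite /GRing.scale/= /B; field; exact/andP.
- move=> x x0; apply: cvgM; last exact: continuous_expNM.
  by apply: cvgB; [exact: cvg_cst|exact: continuous_cos].
- apply: cvg_at_right_filter; apply: (@cvg_to_eq _ _ _ _ (B 0 * expR (- (s * 0)))).
    by rewrite mulr0 oppr0 expR0 mulr1.
  apply: cvgM; last exact: continuous_expNM.
  apply: differentiable_continuous; apply/derivable1_diffP.
  by have [] := dB 0.
- pose M := (s + 1) / (s ^+ 2 + 1) + s^-1.
  have BM x : `|B x| <= M.
    rewrite /B /M (le_trans (ler_normB _ _))// lerD//.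
      rewrite normrM [X in _ * X]ger0_norm ?invr_ge0 ?addr_ge0 ?sqr_ge0//.
      rewrite ler_wpM2r ?invr_ge0 ?addr_ge0 ?sqr_ge0//.
      rewrite (le_trans (ler_normB _ _))// lerD ?sin_max//.
      by rewrite normrM (gtr0_norm s0) ler_piMr ?cos_max ?(ltW s0).
    by rewrite ger0_norm ?invr_ge0 ?(ltW s0).
  apply/norm_cvg0P; apply: (@squeeze_cvgr _ _ _ _ (cst 0) (fun x => M * expR (- (s * x)))).
  + near=> x; rewrite normr_ge0/= normrM ler_pM// ger0_norm ?expR_ge0//.
  + exact: cvg_cst.
  + by apply: (@cvg_to_eq _ _ _ _ (M * 0)); [exact: mulr0|apply: cvgMr; exact: expNM_cvgy].
Unshelve. all: end_near. Qed.

End gamma_integral.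

Section tonelli_rectangle.
Context {R : realType}.
Notation leb := (@lebesgue_measure R).
Local Open Scope ereal_scope.

(** Multiplying the kernel by the indicators of [D1] and [D2] turns both iterated integrals into
    integrals over the whole line, where Tonelli applies. *)
Lemma tonelli_rectangle (D1 D2 : set R) (k : R * R -> \bar R) :
  measurable D1 -> measurable D2 -> measurable_fun setT k -> (forall z, 0 <= k z) ->
  \int[leb]_(x in D1) \int[leb]_(y in D2) k (x, y) =
  \int[leb]_(y in D2) \int[leb]_(x in D1) k (x, y).
Proof.
move=> mD1 mD2 mk k0.
pose k' (z : R * R) := k z * ((\1_D1 z.1)%:E * (\1_D2 z.2)%:E).
have mk' : measurable_fun setT k'.
  apply: emeasurable_funM => //; apply: emeasurable_funM; apply/measurable_EFinP.
    exact: measurableT_comp (measurable_indic mD1) measurable_fst.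
  exact: measurableT_comp (measurable_indic mD2) measurable_snd.
have k'0 z : 0 <= k' z.
  by rewrite /k' mule_ge0// mule_ge0// lee_fin indicE.
have := @fubini_tonelli _ _ _ _ _ leb leb k' mk' k'0.
have -> : \int[leb]_x \int[leb]_y k' (x, y) =
    \int[leb]_(x in D1) \int[leb]_(y in D2) k (x, y).
  rewrite [RHS]integral_mkcond; apply: eq_integral => x _; rewrite patchE.
  case: ifPn => xD.
    rewrite [RHS]integral_mkcond; apply: eq_integral => y _; rewrite patchE /k'/=.
    by rewrite !indicE xD; case: ifPn => yD; rewrite ?mul1e ?mule1 ?mule0.
  apply: integral0_eq => y _.
  by rewrite /k' !indicE/= (negbTE xD) mul0e mule0.
move=> ->; rewrite [RHS]integral_mkcond; apply: eq_integral => y _; rewrite patchE.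
case: ifPn => xD.
  rewrite [RHS]integral_mkcond; apply: eq_integral => x _; rewrite patchE /k'/=.
  by rewrite !indicE xD; case: ifPn => yD; rewrite ?mul1e ?mule1 ?mule0.
apply: integral0_eq => x _.
by rewrite /k' !indicE/= (negbTE xD) mule0 mule0.
Qed.

End tonelli_rectangle.

Section gamma_function.
Context {R : realType}.
Notation leb := (@lebesgue_measure R).
Implicit Types (a p s t u : R).

(** Kept in the extended reals, so that scaling, the functional equation and positivity can be
    proved before finiteness. The real [Gamma] is its finite part, which carries information only
    once [gamma_integral_lty] is known. *)
Definition gamma_integral a :=
  (\int[leb]_(s in `]0%R, +oo[) (s `^ (a - 1) * expR (- s))%:E)%E.

Lemma measurable_powRE (p : R) : measurable_fun setT (fun x : R => x `^ p).
Proof. exact: measurable_powR. Qed.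

Lemma measurable_expNM s : measurable_fun setT (fun x : R => expR (- (s * x))).
Proof. by apply: continuous_measurable_fun; exact: continuous_expNM. Qed.

Lemma measurable_expN : measurable_fun setT (fun x : R => expR (- x)).
Proof. by apply: measurableT_comp. Qed.

Lemma gamma_integral_scale a u : 0 < u ->
  (\int[leb]_(s in `]0%R, +oo[) (s `^ (a - 1) * expR (- (u * s)))%:E
   = (u `^ (- a))%:E * gamma_integral a)%E.
Proof.
move=> u0; rewrite /gamma_integral -(@ge0_integral_scale0y _ u u0
  (fun s => (s `^ (a - 1) * expR (- s))%:E)); last 2 first.
- apply: measurable_funTS; apply/measurable_EFinP; apply: measurable_funM.
    exact: measurable_powRE.
  exact: measurable_expN.
- by move=> x _; rewrite lee_fin mulr_ge0 ?powR_ge0 ?expR_ge0.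
rewrite muleA -ge0_integralZl//; last 3 first.
- apply: measurable_funTS; apply/measurable_EFinP; apply: measurable_funM.
    by apply: measurableT_comp (measurable_powRE _) _; apply: measurable_funM.
  exact: measurable_expNM.
- by move=> x _; rewrite lee_fin mulr_ge0 ?powR_ge0 ?expR_ge0.
- by rewrite lee_fin mulr_ge0 ?powR_ge0// ltW.
apply: eq_integral => s /set_mem/=; rewrite in_itv/= andbT => s0.
rewrite -EFinM; congr EFin.
rewrite powRM ?ltW//.
rewrite !mulrA; suff -> : u `^ (- a) * u * u `^ (a - 1) = 1 by rewrite mul1r.
rewrite -{2}(powRr1 (ltW u0)) -!powRD ?(gt_eqF u0) ?implybT//.
by rewrite (_ : - a + 1 + (a - 1) = 0) ?powRr0//; ring.
Qed.

(** Tonelli on the triangle s <= r takes the place of integration by parts: the integral of a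
    s^(a-1) e^(-r) over s gives r^a e^(-r), and over r it gives a s^(a-1) e^(-s). *)
Lemma gamma_integralS a : 0 < a ->
  (gamma_integral (a + 1) = a%:E * gamma_integral a)%E.
Proof.
move=> a0.
pose k (z : R * R) := ((a * z.2 `^ (a - 1) * expR (- z.1)) * (z.2 <= z.1)%R%:R)%:E.
have mk : measurable_fun setT k.
  apply/measurable_EFinP; apply: measurable_funM.
    apply: measurable_funM.
      apply: measurable_funM => //.
      exact: measurableT_comp (measurable_powRE _) measurable_snd.
    exact: measurableT_comp measurable_expN measurable_fst.
  rewrite (_ : (fun _ => _) = (fun z : R * R => if z.2 <= z.1 then 1 else 0)); last first.
    by apply/funext => z; case: ifP.
  by apply: measurable_fun_ifT => //; apply: measurable_fun_ler.
have k0 z : (0 <= k z)%E.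
  by rewrite lee_fin mulr_ge0// mulr_ge0 ?expR_ge0// mulr_ge0 ?powR_ge0// ltW.
have := @tonelli_rectangle R `]0%R, +oo[ `]0%R, +oo[ k
  (measurable_itv _) (measurable_itv _) mk k0.
have restr (D A : set R) (f : R -> R) : measurable A -> A `<=` D ->
    measurable_fun setT f -> (forall x, 0 <= f x) ->
    (\int[leb]_(x in D) (f x * (x \in A)%:R)%:E = \int[leb]_(x in A) (f x)%:E)%E.
  move=> mA AD mf f0; rewrite [RHS]integral_mkcond [LHS]integral_mkcond.
  apply: eq_integral => x _; rewrite !patchE; case: ifPn => xD; case: ifPn => xA;
    rewrite ?mulr1 ?mulr0//.
  by move: xD; rewrite notin_setE => /(_ (AD _ (set_mem xA))).
rewrite /gamma_integral -ge0_integralZl//; last 3 first.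
- apply: measurable_funTS; apply/measurable_EFinP; apply: measurable_funM.
    exact: measurable_powRE.
  exact: measurable_expN.
- by move=> x _; rewrite lee_fin mulr_ge0 ?powR_ge0 ?expR_ge0.
- by rewrite lee_fin ltW.
move=> H; transitivity (\int[leb]_(x in `]0%R, +oo[) \int[leb]_(y in `]0%R, +oo[) k (x, y))%E; last rewrite H.
  apply: eq_integral => r /set_mem/=; rewrite in_itv/= andbT => r0.
  have c0 : 0 <= a * expR (- r) by rewrite mulr_ge0 ?expR_ge0 ?(ltW a0).
  transitivity (\int[leb]_(y in `]0%R, +oo[) ((a * expR (- r) * y `^ (a - 1)) * (y \in `]0, r]%classic)%:R)%:E)%E.
    rewrite restr.
    - under eq_integral do rewrite EFinM.
      rewrite ge0_integralZl.
      + rewrite integral_powR_0c// -EFinM; congr EFin.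
        by rewrite addrK; field; rewrite gt_eqF.
      + exact: measurable_itv.
      + by apply: measurable_funTS; apply/measurable_EFinP; exact: measurable_powRE.
      + by move=> x _; rewrite lee_fin powR_ge0.
      + by rewrite lee_fin.
    - exact: measurable_itv.
    - by move=> x/=; rewrite !in_itv/= andbT => /andP[].
    - apply: measurable_funM => //; exact: measurable_powRE.
    - by move=> x; rewrite (mulr_ge0 c0) ?powR_ge0.
  apply: eq_integral => y /set_mem/=; rewrite in_itv/= andbT => y0.
  rewrite /k/=; congr EFin; rewrite [in RHS](mulrAC a); congr (_ * _%:R).
  by rewrite mem_setE in_itv/= y0.
apply: eq_integral => s /set_mem/=; rewrite in_itv/= andbT => s0.
have c0 : 0 <= a * s `^ (a - 1) by rewrite mulr_ge0 ?powR_ge0 ?(ltW a0).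
transitivity (\int[leb]_(y in `]0%R, +oo[) ((a * s `^ (a - 1) * expR (- y)) * (y \in `[s, +oo[%classic)%:R)%:E)%E.
  apply: eq_integral => y /set_mem/=; rewrite in_itv/= andbT => y0.
  rewrite /k/=; congr EFin; congr (_ * _%:R).
  by rewrite mem_setE in_itv/= andbT.
rewrite restr.
- under eq_integral do rewrite EFinM -[X in expR (- X)]mul1r.
  rewrite ge0_integralZl.
  + by rewrite integral_expNM_cy// invr1 !mul1r -EFinM -EFinM mulrA.
  + exact: measurable_itv.
  + by apply: measurable_funTS; apply/measurable_EFinP; exact: measurable_expNM.
  + by move=> x _; rewrite lee_fin expR_ge0.
  + by rewrite lee_fin.
- exact: measurable_itv.
- move=> x/=; rewrite !in_itv/= !andbT; exact: lt_le_trans.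
- by apply: measurable_funM => //; exact: measurable_expN.
- by move=> x; rewrite (mulr_ge0 c0) ?expR_ge0.
Qed.

Lemma gamma_integral1 : gamma_integral 1 = 1%E.
Proof.
rewrite /gamma_integral -[RHS]/((1:R)%:E) -[X in X%:E]invr1 -integral_expNM_0y//.
by apply: eq_integral => x _; rewrite subrr powRr0 !mul1r.
Qed.

Lemma ge0_integral_split1 (f : R -> \bar R) :
  measurable_fun setT f -> (forall x, (0 <= f x)%E) ->
  (\int[leb]_(x in `]0%R, +oo[) f x =
   \int[leb]_(x in `]0%R, 1%R]) f x + \int[leb]_(x in `[1%R, +oo[) f x)%E.
Proof.
move=> mf f0.
have E : `]0%R, +oo[%classic = `]0, 1] `|` `]1, +oo[ :> set R.
  by rewrite -itv_bndbnd_setU ?bnd_simp.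
rewrite E ge0_integral_setU//=.
- by rewrite [X in (_ + X)%E = _]integral_itv_obnd_cbnd//; exact: measurable_funTS.
- by rewrite -E; exact: measurable_funTS.
- apply/disj_setPS => x /=; rewrite !in_itv/= andbT => -[/andP[_ x1]].
  by rewrite ltNge x1.
Qed.

Let mG a : measurable_fun setT (fun s : R => (s `^ (a - 1) * expR (- s))%:E).
Proof.
apply/measurable_EFinP; apply: measurable_funM.
  exact: measurable_powRE.
exact: measurable_expN.
Qed.

Let G0 a s : (0 <= (s `^ (a - 1) * expR (- s))%:E)%E.
Proof. by rewrite lee_fin mulr_ge0 ?powR_ge0 ?expR_ge0. Qed.

Lemma gamma_integral_gt0 a : 0 < a -> (0 < gamma_integral a)%E.
Proof.
move=> a0; rewrite /gamma_integral ge0_integral_split1//.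
apply: (@lt_le_trans _ _ (\int[leb]_(x in `]0%R, 1%R]) (expR (- 1) * (x `^ (a - 1)))%:E)%E).
  under eq_integral do rewrite EFinM.
  rewrite ge0_integralZl//.
  - by rewrite integral_powR_0c// powR1 -EFinM lte_fin mulr_gt0 ?expR_gt0// divr_gt0.
  - by apply: measurable_funTS; apply/measurable_EFinP; exact: measurable_powRE.
  - by move=> x _; rewrite lee_fin powR_ge0.
rewrite -[leLHS]adde0; apply: leeD; last by apply: integral_ge0.
apply: ge0_le_integral => //.
- by move=> x _; rewrite lee_fin mulr_ge0 ?powR_ge0 ?expR_ge0.
- apply: measurable_funTS; apply/measurable_EFinP; apply: measurable_funM => //.
- by apply: measurable_funTS; exact: mG.
- move=> x/=; rewrite in_itv/= => /andP[x0 x1].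
  by rewrite lee_fin mulrC ler_wpM2l ?powR_ge0// ler_expR lerN2.
Qed.

Let gamma_integral_lty_le1 a : 0 < a -> a <= 1 -> (gamma_integral a < +oo)%E.
Proof.
move=> a0 a1; rewrite /gamma_integral ge0_integral_split1// lte_add_pinfty//.
  apply: (@le_lt_trans _ _ (\int[leb]_(x in `]0%R, 1%R]) (x `^ (a - 1))%:E)%E).
    apply: ge0_le_integral => //.
    - by apply: measurable_funTS; exact: mG.
    - by apply: measurable_funTS; apply/measurable_EFinP; exact: measurable_powRE.
    - move=> x/=; rewrite in_itv/= => /andP[x0 x1].
      by rewrite lee_fin ler_piMr ?powR_ge0// -expR0 ler_expR oppr_le0 ltW.
  by rewrite integral_powR_0c// ltry.
apply: (@le_lt_trans _ _ (\int[leb]_(x in `[1%R, +oo[) (expR (- (1 * x)))%:E)%E).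
  apply: ge0_le_integral => //.
  - by apply: measurable_funTS; exact: mG.
  - by apply: measurable_funTS; apply/measurable_EFinP; exact: measurable_expNM.
  - move=> x/=; rewrite in_itv/= andbT => x1.
    rewrite lee_fin mul1r ler_piMl ?expR_ge0//.
    rewrite -[leRHS](powRr0 x); apply: ler_powR => //; lra.
by rewrite integral_expNM_cy// ltry.
Qed.

(** For a <= 1 the power is integrable near 0 and at most 1 beyond 1; the functional equation then
    reaches a <= 2. This range contains the arguments 2h with h < 1. *)
Lemma gamma_integral_lty a : 0 < a -> a <= 2 -> (gamma_integral a < +oo)%E.
Proof.
move=> a0 a2; have [a1|a1] := leP a 1; first exact: gamma_integral_lty_le1.
have b0 : 0 < a - 1 by lra.
rewrite -[a](subrK 1) gamma_integralS// lte_mul_pinfty ?lee_fin ?(ltW b0)//.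
by apply: gamma_integral_lty_le1 => //; lra.
Qed.

Lemma Gamma_gt0 a : 0 < a -> a <= 2 -> 0 < Gamma a.
Proof.
by move=> a0 a2; apply: fine_gt0; rewrite gamma_integral_gt0//= gamma_integral_lty.
Qed.

Lemma gamma_integralE a : 0 < a -> a <= 2 -> gamma_integral a = (Gamma a)%:E.
Proof.
move=> a0 a2; rewrite /Gamma /Rintegral fineK// ge0_fin_numE ?gamma_integral_lty//.
exact: integral_ge0.
Qed.

End gamma_function.

(** * Partial fractions of the cotangent and the constant C(H) *)

Section herglotz.
Context {R : realType}.
Implicit Types (h x y : R) (k n N : nat).

Let a_ h k : R := (k%:R + h)^-1 - (k%:R + 1 - h)^-1.
Let S_ h N : R := \sum_(k < N) a_ h k.

(* [S_ h N] tends to [pi * cot (pi * h)]; the duplication formula below is also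
   satisfied by the cotangent, so that the difference of the two, extended by 0 to
   the end points, vanishes by the maximum principle. *)
Let dup_term h N :
  a_ (h / 2) N + a_ ((1 + h) / 2) N = 2 * (a_ h (2 * N) + a_ h (2 * N).+1).
Proof.
have E1 : (2 * N)%:R = 2 * N%:R :> R by rewrite natrM.
have E2 : (2 * N).+1%:R = 2 * N%:R + 1 :> R by rewrite -[LHS]natr1 E1.
rewrite /a_ E2 E1; have half x : (x / 2)^-1 = 2 * x^-1 by rewrite invfM invrK mulrC.
have -> : N%:R + h / 2 = (2 * N%:R + h) / 2 by field.
have -> : N%:R + 1 - h / 2 = (2 * N%:R + 1 + 1 - h) / 2 by field.
have -> : N%:R + (1 + h) / 2 = (2 * N%:R + 1 + h) / 2 by field.
have -> : N%:R + 1 - (1 + h) / 2 = (2 * N%:R + 1 - h) / 2 by field.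
by rewrite !half; ring.
Qed.

(** Sorting the terms by parity makes the duplication formula exact for finite sums; the limit is
    taken only afterwards. *)
Let dup h N : S_ (h / 2) N + S_ ((1 + h) / 2) N = 2 * S_ h (2 * N).
Proof.
elim: N => [|N IH]; first by rewrite /S_ muln0 !big_ord0 mulr0 addr0.
rewrite mulnS add2n /S_ !big_ord_recr/=; move: IH (dup_term h N); rewrite /S_; lra.
Qed.

(** This is [a_ h k.+1]. Only the first term of the cotangent series has poles at 0 and 1; the
    others are regular on the closed interval. *)
Let b_ h k : R := (k%:R + 1 + h)^-1 - (k%:R + 2 - h)^-1.

Let SbE h N : S_ h N.+1 = h^-1 - (1 - h)^-1 + \sum_(k < N) b_ h k.
Proof.
rewrite /S_ big_ord_recl/= /a_ add0r; congr (_ + _).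
  by rewrite add0r.
apply: eq_bigr => k _; rewrite /b_ /= /bump/= add1n -natr1; congr (_^-1 - _^-1).
by rewrite -!addrA (addrA 1 1).
Qed.

(** Equal to 2/((k+1)(k+2)): a telescoping majorant of 1/(k+1)^2, with partial sums at most 2. *)
Let w k : R := 2 * (k.+1%:R^-1 - k.+2%:R^-1).

Let w_ge k : (k.+1%:R ^+ 2)^-1 <= w k.
Proof.
rewrite /w; set x : R := k.+1%:R; have x1 : 1 <= x by rewrite /x ler1n.
rewrite (_ : k.+2%:R = x + 1 :> R); last by rewrite /x natr1.
have -> : 2 * (x^-1 - (x + 1)^-1) = 2 / (x * (x + 1)).
  by field; apply/andP; split; rewrite gt_eqF//; lra.
rewrite ler_pdivlMr; last by apply: mulr_gt0; lra.
rewrite mulrC ler_pdivrMr; last by apply: exprn_gt0; lra.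
nra.
Qed.

Let w_ge0 k : 0 <= w k.
Proof. by apply: le_trans (w_ge k); rewrite invr_ge0 exprn_ge0. Qed.

Let w_sum N : \sum_(k < N) w k <= 2.
Proof.
rewrite -mulr_sumr -[leRHS]mulr1 ler_pM2l//.
rewrite (_ : \sum_(k < N) _ = 1 - N.+1%:R^-1); last first.
  elim: N => [|N IH]; first by rewrite big_ord0 invr1 subrr.
  by rewrite big_ord_recr/= IH; ring.
by rewrite lerBlDr lerDl invr_ge0.
Qed.

Let b_lip x y k : 0 <= x <= 1 -> 0 <= y <= 1 ->
  `|b_ x k - b_ y k| <= 2 * `|x - y| * w k.
Proof.
move=> /andP[x0 x1] /andP[y0 y1].
have k0 : (0:R) <= k%:R by [].
have k1E : k.+1%:R = k%:R + 1 :> R by rewrite natr1.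
have k1 : 0 < k%:R + 1 :> R by lra.
have H (u v : R) : k%:R + 1 <= u -> k%:R + 1 <= v -> `|u^-1 - v^-1| <= `|u - v| * w k.
  move=> ku kv; have u0 : 0 < u by lra.
  have v0 : 0 < v by lra.
  have -> : u^-1 - v^-1 = (v - u) / (u * v) by field; rewrite !gt_eqF.
  rewrite normrM distrC ler_wpM2l// gtr0_norm ?invr_gt0 ?mulr_gt0//.
  apply: le_trans (w_ge k); rewrite lef_pV2 ?posrE ?mulr_gt0 ?exprn_gt0//.
  by rewrite k1E expr2 ler_pM// ltW.
have -> : b_ x k - b_ y k = ((k%:R + 1 + x)^-1 - (k%:R + 1 + y)^-1) -
   ((k%:R + 2 - x)^-1 - (k%:R + 2 - y)^-1) by rewrite /b_; ring.
apply: (le_trans (ler_normB _ _)).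
have -> : 2 * `|x - y| * w k = `|x - y| * w k + `|x - y| * w k by ring.
apply: lerD.
  have -> : x - y = (k%:R + 1 + x) - (k%:R + 1 + y) by ring.
  apply: H; lra.
have -> : `|x - y| = `|(k%:R + 2 - x) - (k%:R + 2 - y)|.
  by rewrite distrC; congr `|_|; ring.
apply: H; lra.
Qed.

Let b_half k : b_ 2^-1 k = 0.
Proof. by rewrite /b_; apply/eqP; rewrite subr_eq0; apply/eqP; congr _^-1; field. Qed.

(** [b_] vanishes at 1/2, and every point of [0, 1] is within 1/2 of it, so the Lipschitz bound is
    also a size bound. *)
Let b_le x k : 0 <= x <= 1 -> `|b_ x k| <= w k.
Proof.
move=> x01; have h01 : 0 <= (2^-1 : R) <= 1 by apply/andP; split; lra.
have := b_lip k x01 h01; rewrite b_half subr0 => /le_trans; apply.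
rewrite ler_piMl//.
  move/andP: x01 => [x0 x1].
  have : `|x - 2^-1| <= 2^-1 by rewrite ler_norml; apply/andP; split; lra.
  lra.
Qed.

(** The part of the cotangent series that is Lipschitz up to the end points; [SL] adds the first
    term, with the poles. *)
Let G_ x : R := limn (fun N => \sum_(k < N) b_ x k).

Let is_cvg_G x : 0 <= x <= 1 -> cvgn (fun N => \sum_(k < N) b_ x k).
Proof.
move=> x01.
have -> : (fun N => \sum_(k < N) b_ x k) = series (b_ x).
  by apply/funext => N; rewrite /series/= big_mkord.
apply: normed_cvg; apply: (@series_le_cvg _ _ w) => //.
- by move=> k /=.
- by move=> k; exact: b_le.
- apply: nondecreasing_is_cvgn.
    by apply: nondecreasing_series.
  by exists 2 => _ [N _ <-]; rewrite /series/= big_mkord; exact: w_sum.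
Qed.

Let G_lip x y : 0 <= x <= 1 -> 0 <= y <= 1 -> `|G_ x - G_ y| <= 4 * `|x - y|.
Proof.
move=> x01 y01.
have cx := is_cvg_G x01; have cy := is_cvg_G y01.
have H : `|\sum_(k < N) b_ x k - \sum_(k < N) b_ y k| @[N --> \oo] --> `|G_ x - G_ y|.
  by apply: cvg_norm; exact: cvgB.
rewrite -(cvg_lim _ H)//; apply: limr_le; first by apply/cvg_ex; eexists; exact: H.
apply: nearW => N; rewrite -sumrB.
apply: (le_trans (ler_norm_sum _ _ _)).
apply: (@le_trans _ _ (\sum_(k < N) (2 * `|x - y| * w k))).
  by apply: ler_sum => k _; exact: b_lip.
rewrite -mulr_sumr (_ : 4 * `|x - y| = (2 * `|x - y|) * 2); last by ring.
by rewrite ler_wpM2l// mulr_ge0.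
Qed.

Let SL h := h^-1 - (1 - h)^-1 + G_ h.

Let cvg_S h : 0 <= h <= 1 -> S_ h N @[N --> \oo] --> SL h.
Proof.
move=> h01; rewrite -(cvg_shiftS (S_ h)).
have -> : (fun N => S_ h N.+1) = (fun N => h^-1 - (1 - h)^-1 + \sum_(k < N) b_ h k).
  by apply/funext => N; exact: SbE.
by apply: cvgD; [exact: cvg_cst|exact: is_cvg_G].
Qed.

Let SL_dup h : 0 < h < 1 -> SL (h / 2) + SL ((1 + h) / 2) = 2 * SL h.
Proof.
move=> /andP[h0 h1].
have H1 : S_ (h / 2) N + S_ ((1 + h) / 2) N @[N --> \oo] --> SL (h / 2) + SL ((1 + h) / 2).
  by apply: cvgD; apply: cvg_S; apply/andP; split; lra.
have H2 : 2 * S_ h (2 * N) @[N --> \oo] --> 2 * SL h.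
  apply: cvgMr; apply: (@cvg_comp _ _ _ (fun N => (2 * N)%N) (S_ h) _ \oo).
    move=> A [n _ nA]; exists n => // m /= nm; apply: nA => /=.
    by rewrite (leq_trans nm)// leq_pmull.
  by apply: cvg_S; apply/andP; split; lra.
apply: (@cvg_unique _ _ (fmap (fun N => 2 * S_ h (2 * N)) \oo)) => //.
by rewrite (_ : (fun N => _) = (fun N => S_ (h / 2) N + S_ ((1 + h) / 2) N))//; apply/funext => N; rewrite dup.
Qed.

Let G_sym h : 0 <= h <= 1 -> G_ (1 - h) = - G_ h.
Proof.
move=> h01; apply/cvg_lim => //.
rewrite (_ : (fun N => _) = (fun N => - \sum_(k < N) b_ h k)); last first.
  apply/funext => N; rewrite -sumrN; apply: eq_bigr => k _; rewrite /b_ [RHS]opprB.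
  by congr (_^-1 - _^-1); ring.
by apply: cvgN; exact: is_cvg_G.
Qed.

(** At 0 the series telescopes. The value 1 offsets the limit -1 of [- (1 - h)^-1], so that
    [SL h - h^-1] tends to 0 with h. *)
Let G0 : G_ 0 = 1.
Proof.
apply/cvg_lim => //.
rewrite (_ : (fun N => _) = (fun N : nat => 1 - N.+1%:R^-1)); last first.
  apply/funext => N; elim: N => [|N IH]; first by rewrite big_ord0 invr1 subrr.
  rewrite big_ord_recr/= IH /b_ addr0 subr0.
  rewrite (_ : N%:R + 1 = N.+1%:R); last by rewrite natr1.
  have -> : N.+2%:R = N%:R + 2 :> R by rewrite -addn2 natrD.
  by rewrite addrA subrK.
apply: (@cvg_to_eq _ _ _ _ (1 - 0 : R)); first by rewrite subr0.
by apply: cvgB; [exact: cvg_cst|exact: cvg_harmonic].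
Qed.

Let sin_gt h : 0 < h < 1 -> 0 < sin (pi * h).
Proof.
move=> /andP[h0 h1]; apply: sin_gt0_pi; rewrite mulr_gt0 ?pi_gt0//=.
by rewrite gtr_pMr ?pi_gt0.
Qed.

(** This is cot x - tan x = 2 cot 2x at x = pi h / 2, since cot (x + pi/2) = - tan x. *)
Let cot_dup h : 0 < h < 1 ->
  cos (pi * (h / 2)) / sin (pi * (h / 2)) + cos (pi * ((1 + h) / 2)) / sin (pi * ((1 + h) / 2))
  = 2 * (cos (pi * h) / sin (pi * h)).
Proof.
move=> /andP[h0 h1].
have -> : pi * ((1 + h) / 2) = pi * (h / 2) + pi / 2 :> R by field.
rewrite cosDpihalf sinDpihalf.
have s0 : 0 < sin (pi * (h / 2)) by apply: sin_gt; apply/andP; split; lra.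
have c0 : 0 < cos (pi * (h / 2)).
  apply: cos_gt0_pihalf; have := @pi_gt0 R => ?; apply/andP; split; first by nra.
  by rewrite mulrA ltr_pM2r// gtr_pMr.
have -> : pi * h = (pi * (h / 2)) *+ 2 :> R by rewrite -mulrnAr; congr (_ * _); field.
rewrite sin_mulr2n cos_mulr2n.
have -> : cos (pi * (h / 2)) ^+ 2 *+ 2 - 1 = cos (pi * (h / 2)) ^+ 2 - sin (pi * (h / 2)) ^+ 2 :> R.
  by rewrite sin2cos2; ring.
by field; rewrite !gt_eqF.
Qed.

Let kappa h := h^-1 - pi * (cos (pi * h) / sin (pi * h)).

Let kappa_le h : 0 < h -> h <= 2^-1 -> `|kappa h| <= pi ^+ 2 * h.
Proof.
move=> h0 h1; have p0 := @pi_gt0 R; rewrite /kappa; set x := pi * h.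
have x0 : 0 < x by rewrite mulr_gt0.
have xp : x <= pi / 2 by rewrite ler_pM2l.
have s0 : 0 < sin x by apply: sin_gt; apply/andP; split; lra.
have c0 : 0 <= cos x by apply: cos_ge0_pihalf; apply/andP; split => //; lra.
(* The mean value theorem writes sin x = x cos c with cos x <= cos c <= 1, which gives x cos x <=
   sin x and sin x <= x at once. *)
have [c] : exists2 c, c \in `]0, x[%R & sin x - sin 0 = cos c * (x - 0).
  apply: MVT => //; last by apply: continuous_subspaceT => ?; exact: continuous_sin.
rewrite in_itv/= sin0 !subr0 => /andP[c00 cx] sE.
have cc : cos x <= cos c.
  rewrite leNgt ltr_cos ?in_itv/= -?leNgt; [exact: ltW| |]; apply/andP; split; lra.
have c1 := cos_le1 c.
have E : h^-1 - pi * (cos x / sin x) = pi * (sin x - x * cos x) / (x * sin x).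
  have -> : h^-1 = pi / x by rewrite /x invfM mulrA divff ?mul1r// gt_eqF.
  by field; rewrite (gt_eqF s0) (gt_eqF x0).
rewrite E ger0_norm; last first.
  apply: divr_ge0; last by apply: ltW; apply: mulr_gt0.
  apply: mulr_ge0; first exact: ltW.
  rewrite sE; nra.
rewrite ler_pdivrMr ?mulr_gt0//.
have -> : pi ^+ 2 * h = pi * x by rewrite /x; ring.
rewrite -[leRHS]mulrA ler_pM2l//.
have sx : sin x <= x by rewrite sE; nra.
(* sin x - x cos x <= x (1 - cos x) <= x sin^2 x <= x (x sin x) *)
have s2 := sin2cos2 x.
apply: (@le_trans _ _ (x * (1 - cos x))); first by nra.
rewrite ler_pM2l//; apply: (@le_trans _ _ (sin x ^+ 2)); first by rewrite s2; nra.
by rewrite expr2 ler_pM2r.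
Qed.

Let D h := if 0 < h < 1 then SL h - pi * (cos (pi * h) / sin (pi * h)) else 0.

Let DE h : 0 < h < 1 -> D h = SL h - pi * (cos (pi * h) / sin (pi * h)).
Proof. by rewrite /D => ->. Qed.

Let D_sym h : 0 < h < 1 -> D (1 - h) = - D h.
Proof.
move=> h01; have h01' : 0 < 1 - h < 1 by move/andP: h01 => [? ?]; apply/andP; split; lra.
rewrite !DE// /SL G_sym; last by move/andP: h01 => [? ?]; apply/andP; split; lra.
rewrite (_ : pi * (1 - h) = - (pi * h) + pi); last by ring.
rewrite cosDpi sinDpi cosN sinN opprK subKr mulNr.
by ring.
Qed.

Let D_dup h : 0 < h < 1 -> D (h / 2) + D ((1 + h) / 2) = 2 * D h.
Proof.
move=> h01; have := SL_dup h01; have := cot_dup h01; move/andP: (h01) => [h0 h1].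
rewrite !DE//; [|by apply/andP; split; lra|by apply/andP; split; lra].
set u := _ / _; set v := _ / _; set z := _ / _ => e1 e2.
rewrite mulrBr -e2 (mulrCA 2 pi) -e1; ring.
Qed.

(** The poles at 0 cancel and three terms of order h remain: [kappa] (constant pi^2), 1 - (1-h)^(-1)
    (constant 2) and the variation of [G_] (constant 4). This makes the extension of [D] by 0
    continuous at 0 and, by symmetry, at 1. *)
Let D_near0 h : 0 < h -> h <= 2^-1 -> `|D h| <= (pi ^+ 2 + 6) * h.
Proof.
move=> h0 h1; rewrite DE; last by apply/andP; split; lra.
have -> : SL h - pi * (cos (pi * h) / sin (pi * h)) =
    kappa h + ((1 - (1 - h)^-1) + (G_ h - G_ 0)) by rewrite G0 /SL /kappa; ring.
rewrite (le_trans (ler_normD _ _))// [leRHS]mulrDl lerD ?kappa_le//.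
rewrite (le_trans (ler_normD _ _))// (_ : 6 * h = 2 * h + 4 * h); last by ring.
apply: lerD.
  have -> : 1 - (1 - h)^-1 = - (h / (1 - h)) by field; rewrite gt_eqF//; lra.
  rewrite normrN ger0_norm; last by apply: divr_ge0; lra.
  rewrite ler_pdivrMr; last lra.
  nra.
have := @G_lip h 0; rewrite subr0 (gtr0_norm h0); apply; apply/andP; split; lra.
Qed.

Let D_le0 h : 0 < h < 1 -> D h <= 0.
Proof.
have K0 : 0 < pi ^+ 2 + 6 :> R by rewrite ltr_wpDl// sqr_ge0.
have cD0 : D x @[x --> (0:R)^'+] --> D 0.
  have -> : D 0 = 0 by rewrite /D ltxx.
  apply/cvgr0Pnorm_le => e e0; near=> x.
  have x0 : 0 < x by near: x; exact: nbhs_right_gt.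
  apply: (le_trans (D_near0 x0 _)).
    by apply: ltW; near: x; apply: nbhs_right_lt.
  rewrite mulrC -ler_pdivlMr//; apply: ltW; near: x; apply: nbhs_right_lt.
  by rewrite divr_gt0.
have cD1 : D x @[x --> (1:R)^'-] --> D 1.
  have -> : D 1 = 0 by rewrite /D ltxx andbF.
  apply/cvgr0Pnorm_le => e e0; near=> x.
  have x1 : x < 1 by near: x; exact: nbhs_left_lt.
  have x12 : 2^-1 < x by near: x; apply: nbhs_left_gt; lra.
  have -> : `|D x| = `|D (1 - x)|.
    by rewrite D_sym ?normrN//; apply/andP; split; lra.
  apply: (le_trans (D_near0 _ _)); [lra|lra|].
  rewrite mulrC -ler_pdivlMr// lerBlDr -lerBlDl; apply: ltW; near: x; apply: nbhs_left_gt.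
  by rewrite ltrBlDr ltrDl divr_gt0.
have cD : {within `[0, 1], continuous D}.
  apply/continuous_within_itvP => //; split => // x.
  rewrite in_itv/= => x01.
  have nx : \forall y \near x, SL y - pi * (cos (pi * y) / sin (pi * y)) = D y.
    near=> y; rewrite DE//; near: y; move/andP: (x01) => [x0 x1].
    by apply: near_in_itvoo; rewrite in_itv/= x0.
  rewrite /continuous_at DE//; apply/(cvg_trans (near_eq_cvg nx)).
  move/andP: (x01) => [x0 x1].
  have cpi f : continuous f -> {for x, continuous (fun y : R => f (pi * y) : R)}.
    move=> cf; apply: (@continuous_comp _ _ _ (fun y => pi * y) f); last exact: cf.
    by apply: cvgMr; exact: cvg_id.
  apply: cvgB; last first.
    apply: cvgMr; apply: cvgM; first exact: (cpi _ (@continuous_cos _)).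
    apply: cvgV; last exact: (cpi _ (@continuous_sin _)).
    by rewrite gt_eqF// sin_gt.
  apply: cvgD.
    apply: cvgB; first by apply: cvgV; [rewrite gt_eqF|exact: cvg_id].
    apply: cvgV; first by rewrite gt_eqF// subr_gt0.
    by apply: cvgB; [exact: cvg_cst|exact: cvg_id].
  apply/cvgrPdist_le => e e0; near=> y.
  have y01 : 0 < y < 1.
    near: y; apply: near_in_itvoo; rewrite in_itv/= x0 x1//.
  move/andP: y01 => [y0 y1].
  apply: (le_trans (G_lip _ _)); [by apply/andP; split; exact: ltW|by apply/andP; split; exact: ltW|].
  rewrite mulrC -ler_pdivlMr//; near: y; apply: cvgr_dist_le => //; last exact: divr_gt0.
have [c c01 cmax] := EVT_max ler01 cD.
suff Dc : D c <= 0.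
  move=> /andP[h0 h1]; apply: le_trans Dc; apply: cmax.
  by rewrite in_itv/= !ltW.
rewrite leNgt; apply/negP => Dc.
have cio : 0 < c < 1 by move: Dc; rewrite /D; case: ifP => //; rewrite ltxx.
(* The duplication formula makes [D c] the mean of two values that do not exceed the maximum, so
   both are maximal. Iterating the left one, the maximum is attained along [c / 2 ^+ n], which tends
   to 0, where [D] is 0 and continuous. *)
have Dn n : D (c / 2 ^+ n) = D c /\ 0 < c / 2 ^+ n < 1.
  elim: n => [|n [IH n01]]; first by rewrite expr0 divr1.
  have -> : c / 2 ^+ n.+1 = c / 2 ^+ n / 2 by rewrite exprS; field; rewrite expf_neq0.
  set x := c / 2 ^+ n in IH n01 *; move/andP: (n01) => [x0 x1].
  split; last by apply/andP; split; lra.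
  have := D_dup n01; rewrite IH.
  have : D (x / 2) <= D c by apply: cmax; rewrite in_itv/=; apply/andP; split; lra.
  have : D ((1 + x) / 2) <= D c by apply: cmax; rewrite in_itv/=; apply/andP; split; lra.
  lra.
have c2 : c / 2 ^+ n @[n --> \oo] --> (0 : R).
  have := @cvg_geometric R c 2^-1; rewrite /geometric/=.
  under eq_fun do rewrite exprVn; apply.
  by rewrite ger0_norm// invf_lt1// ltr1n.
have : D (c / 2 ^+ n) @[n --> \oo] --> D 0.
  move/cvg_at_rightP : cD0; apply; split => // n.
  by have [_ /andP[]] := Dn n.
under eq_fun do rewrite (Dn _).1.
move=> /cvg_lim -/(_ (@Rhausdorff R)).
rewrite lim_cst// {2}/D ltxx => Dc0.
by move: Dc; rewrite Dc0 ltxx.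
Unshelve. all: end_near. Qed.

(** [D] is odd about 1/2, so the one-sided bound [D_le0] at h and at 1 - h gives equality. *)
Let SLE h : 0 < h < 1 -> SL h = pi * (cos (pi * h) / sin (pi * h)).
Proof.
move=> h01; apply/eqP; rewrite -subr_eq0 -DE// eq_le D_le0//= -oppr_le0 -D_sym// D_le0//.
by move/andP: h01 => [? ?]; apply/andP; split; lra.
Qed.

(** With x = pi h / 2, pi / sin (2x) = (pi/2)(cot x + tan x) is half the difference of the cotangent
    series at h/2 and (1+h)/2. The terms are grouped as they will come out of the integral of
    s^(2h-1)/(1+s^2). *)
Lemma cvg_csc_series h : 0 < h < 1 ->
  \sum_(k < N) ((2 * k%:R + h)^-1 - (2 * k%:R + 1 + h)^-1
     + ((2 * k%:R + 1 - h)^-1 - (2 * k%:R + 2 - h)^-1)) @[N --> \oo]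
  --> pi / sin (pi * h).
Proof.
move=> h01; move/andP: (h01) => [h0 h1].
have -> : (fun N => \sum_(k < N) ((2 * k%:R + h)^-1 - (2 * k%:R + 1 + h)^-1
     + ((2 * k%:R + 1 - h)^-1 - (2 * k%:R + 2 - h)^-1))) =
    (fun N => 2^-1 * (S_ (h / 2) N - S_ ((1 + h) / 2) N)).
  apply/funext => N; rewrite -sumrB mulr_sumr; apply: eq_bigr => k _.
  have half x : x^-1 = 2^-1 * (x / 2)^-1 by rewrite invfM invrK mulrCA mulVf ?mulr1.
  rewrite (half (2 * k%:R + h)) (half (2 * k%:R + 1 + h)).
  rewrite (half (2 * k%:R + 1 - h)) (half (2 * k%:R + 2 - h)).
  have -> : (2 * k%:R + h) / 2 = k%:R + h / 2 by field.
  have -> : (2 * k%:R + 1 + h) / 2 = k%:R + (1 + h) / 2 by field.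
  have -> : (2 * k%:R + 1 - h) / 2 = k%:R + 1 - (1 + h) / 2 by field.
  have -> : (2 * k%:R + 2 - h) / 2 = k%:R + 1 - h / 2 by field.
  by rewrite /a_; ring.
have h2 : 0 < h / 2 < 1 by apply/andP; split; lra.
have h3 : 0 < (1 + h) / 2 < 1 by apply/andP; split; lra.
apply: (@cvg_to_eq _ _ _ _ (2^-1 * (SL (h / 2) - SL ((1 + h) / 2)))); last first.
  by apply: cvgMr; apply: cvgB; apply: cvg_S; apply/andP; split; lra.
rewrite !SLE//.
have -> : pi * ((1 + h) / 2) = pi * (h / 2) + pi / 2 :> R by field.
rewrite cosDpihalf sinDpihalf.
have s0 : 0 < sin (pi * (h / 2)) by apply: sin_gt.
have c0 : 0 < cos (pi * (h / 2)).
  apply: cos_gt0_pihalf; have := @pi_gt0 R => ?; apply/andP; split; first by nra.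
  by rewrite mulrA ltr_pM2r// gtr_pMr.
have -> : pi * h = (pi * (h / 2)) *+ 2 :> R by rewrite -mulrnAr; congr (_ * _); field.
rewrite sin_mulr2n.
have := cos2Dsin2 (pi * (h / 2)).
move: s0 c0; set u := sin _; set v := cos _ => s0 c0 cs.
transitivity (pi * (v ^+ 2 + u ^+ 2) / ((v * u) *+ 2)); last by rewrite cs mulr1.
by field; rewrite (gt_eqF s0) (gt_eqF c0).
Qed.

End herglotz.

Section euler_reflection.
Context {R : realType}.
Notation leb := (@lebesgue_measure R).
Implicit Types (p h s t : R).

(** Iterates A q = 1/q - A (q + 2). Two iterations per step let the remainder keep a plus sign. *)
Let alternating (A : R -> R) p N : 0 < p ->
  (forall q, 0 < q -> A q + A (q + 2) = q^-1) ->
  A p = \sum_(k < N) ((p + 4 * k%:R)^-1 - (p + 4 * k%:R + 2)^-1) + A (p + 4 * N%:R).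
Proof.
move=> p0 H; elim: N => [|N IH]; first by rewrite big_ord0 mulr0 addr0 add0r.
have N0 : (0:R) <= N%:R by [].
have H1 := H (p + 4 * N%:R); have H2 := H (p + 4 * N%:R + 2).
rewrite big_ord_recr/= IH.
have -> : p + 4 * N.+1%:R = p + 4 * N%:R + 2 + 2 by rewrite -natr1; ring.
have -> : A (p + 4 * N%:R) = (p + 4 * N%:R)^-1 - A (p + 4 * N%:R + 2).
  by rewrite -H1 ?addrK//; lra.
have -> : A (p + 4 * N%:R + 2) = (p + 4 * N%:R + 2)^-1 - A (p + 4 * N%:R + 2 + 2).
  by rewrite -H2 ?addrK//; lra.
by ring.
Qed.

Let oneDsqr_gt0 s : 0 < 1 + s ^+ 2.
Proof. by rewrite ltr_pwDl// sqr_ge0. Qed.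

Let mrat q : measurable_fun setT (fun s : R => (s `^ q / (1 + s ^+ 2))%:E).
Proof.
apply/measurable_EFinP; apply: measurable_funM; first exact: measurable_powRE.
apply: continuous_measurable_fun => x; exact: continuous_oneDsqrV.
Qed.

Let rat_ge0 q s : (0 <= (s `^ q / (1 + s ^+ 2))%:E)%E.
Proof. by rewrite lee_fin divr_ge0 ?powR_ge0 ?(ltW (oneDsqr_gt0 _)). Qed.

Let Aint p := (\int[leb]_(s in `]0%R, 1%R]) (s `^ (p - 1) / (1 + s ^+ 2))%:E)%E.
(** The form that [Aint p] takes under s -> 1/s; with this choice of exponent both halves of the
    integral obey the same recurrence. *)
Let Bint p := (\int[leb]_(s in `[1%R, +oo[) (s `^ (1 - p) / (1 + s ^+ 2))%:E)%E.

Let AintD p : 0 < p -> (Aint p + Aint (p + 2) = (p^-1)%:E)%E.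
Proof.
move=> p0; rewrite /Aint -ge0_integralD//; last 2 first.
- by apply: measurable_funTS; exact: mrat.
- by apply: measurable_funTS; exact: mrat.
have -> : p^-1 = 1 `^ p / p by rewrite powR1 div1r.
rewrite -integral_powR_0c//; apply: eq_integral => s /set_mem/=.
rewrite in_itv/= => /andP[s0 _]; rewrite -EFinD; congr EFin.
have -> : p + 2 - 1 = (p - 1) + 2%:R by ring.
rewrite (@powRD _ s (p - 1) 2%:R) ?(gt_eqF s0) ?implybT// powR_mulrn ?ltW//.
by field; rewrite gt_eqF.
Qed.

Let BintD p : 0 < p -> (Bint p + Bint (p + 2) = (p^-1)%:E)%E.
Proof.
move=> p0; rewrite /Bint -ge0_integralD//; last 2 first.
- by apply: measurable_funTS; exact: mrat.
- by apply: measurable_funTS; exact: mrat.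
rewrite -integral_powR_1y//; apply: eq_integral => s /set_mem/=.
rewrite in_itv/= andbT => s1; rewrite -EFinD; congr EFin.
have s0 : 0 < s by exact: lt_le_trans s1.
have -> : 1 - p = (- p - 1) + 2%:R by ring.
have -> : 1 - (p + 2) = - p - 1 by ring.
rewrite (@powRD _ s (- p - 1) 2%:R) ?(gt_eqF s0) ?implybT// powR_mulrn ?ltW//.
by field; rewrite gt_eqF.
Qed.

Lemma integral_powR_oneDsqr h : 0 < h < 1 ->
  (\int[leb]_(s in `]0%R, +oo[) (s `^ (2 * h - 1) / (1 + s ^+ 2))%:E
   = (pi / (2 * sin (pi * h)))%:E)%E.
Proof.
move=> h01; move/andP: (h01) => [h0 h1].
have A0 p : (0 <= Aint p)%E by apply: integral_ge0.
have B0 p : (0 <= Bint p)%E by apply: integral_ge0.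
(* Nonnegativity and F p + F (p + 2) = 1/p already yield finiteness and F p <= 1/p; hence the
   remainders of the alternating expansions vanish at infinity. *)
have fin (F : R -> \bar R) : (forall p, (0 <= F p)%E) ->
    (forall p, 0 < p -> (F p + F (p + 2)%R = (p^-1)%:E)%E) ->
    [/\ forall p, 0 < p -> F p = (fine (F p))%:E,
     forall p, 0 <= fine (F p),
     forall p, 0 < p -> fine (F p) + fine (F (p + 2)) = p^-1 &
     forall p, 0 < p -> fine (F p) <= p^-1].
  move=> F0 FD.
  have Ff p : 0 < p -> F p = (fine (F p))%:E.
    move=> p0; rewrite fineK// ge0_fin_numE//.
    by rewrite (@le_lt_trans _ _ (p^-1)%:E) ?ltry// -FD// leeDl.
  have F0' p : 0 <= fine (F p) by exact: fine_ge0.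
  have FD' p : 0 < p -> fine (F p) + fine (F (p + 2)) = p^-1.
    move=> p0; apply: EFin_inj; rewrite EFinD -!Ff ?FD//; lra.
  by split => // p p0; rewrite -FD'// lerDl.
have [Af Ag0 AD Ale] := fin _ A0 AintD.
have [Bf Bg0 BD Ble] := fin _ B0 BintD.
rewrite ge0_integral_split1//.
have -> : (\int[leb]_(x in `]0%R, 1%R]) (x `^ (2 * h - 1) / (1 + x ^+ 2))%:E = Aint (2 * h))%E by [].
have -> : (\int[leb]_(x in `[1%R, +oo[) (x `^ (2 * h - 1) / (1 + x ^+ 2))%:E = Bint (2 - 2 * h))%E.
  by rewrite /Bint (_ : 1 - (2 - 2 * h) = 2 * h - 1)//; ring.
have p0 : 0 < 2 * h by lra.
have q0 : 0 < 2 - 2 * h by lra.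
rewrite Af// Bf// -EFinD; congr EFin.
pose r N := fine (Aint (2 * h + 4 * N%:R)) + fine (Bint (2 - 2 * h + 4 * N%:R)).
have r0 : r N @[N --> \oo] --> (0 : R).
  apply: (@squeeze_cvgr _ _ _ _ (cst 0) (fun N : nat => 2 * N.+1%:R^-1 + 2 * N.+1%:R^-1)).
  - near=> N.
    have N1 : (1:R) <= N%:R by rewrite ler1n; near: N; exact: nbhs_infty_gt.
    have step (x : R) : 0 < x -> N.+1%:R <= 2 * x -> x^-1 <= 2 / N.+1%:R.
      by move=> x0 Nx; rewrite ler_pdivlMr// mulrC ler_pdivrMr.
    rewrite /r addr_ge0//= lerD//.
      by apply: (le_trans (Ale _ _)); [lra|apply: step; rewrite -?natr1; lra].
    by apply: (le_trans (Ble _ _)); [lra|apply: step; rewrite -?natr1; lra].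
  - exact: cvg_cst.
  - apply: (@cvg_to_eq _ _ _ _ (2 * 0 + 2 * 0 : R)); first by rewrite mulr0 addr0.
    by apply: cvgD; apply: cvgMr; exact: cvg_harmonic.
have H : (fun N => fine (Aint (2 * h)) + fine (Bint (2 - 2 * h)) - r N) @ \oo -->
    fine (Aint (2 * h)) + fine (Bint (2 - 2 * h)) - 0.
  by apply: cvgB => //; exact: cvg_cst.
rewrite subr0 in H; apply: (cvg_unique _ H) => //.
apply: (@cvg_to_eq _ _ _ _ (2^-1 * (pi / sin (pi * h)))).
  by rewrite (invfM 2); ring.
have -> : (fun N => fine (Aint (2 * h)) + fine (Bint (2 - 2 * h)) - r N) = (fun N =>
    2^-1 * \sum_(k < N) ((2 * k%:R + h)^-1 - (2 * k%:R + 1 + h)^-1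
     + ((2 * k%:R + 1 - h)^-1 - (2 * k%:R + 2 - h)^-1))).
  apply/funext => N; rewrite (alternating N p0 AD) (alternating N q0 BD) /r.
  rewrite addrACA addrK mulr_sumr -big_split/=; apply: eq_bigr => k _.
  (* The denominators of the two expansions are exactly twice those of the cosecant series, whence
     the factor [2^-1]. *)
  have half (x : R) : x^-1 = 2 * (2 * x)^-1 by rewrite invfM mulrA mulfV// mul1r.
  rewrite (half (2 * k%:R + h)) (half (2 * k%:R + 1 + h)).
  rewrite (half (2 * k%:R + 1 - h)) (half (2 * k%:R + 2 - h)).
  rewrite -!mulrBr -mulrDr mulrA mulVf// mul1r.
  by congr (_^-1 - _^-1 + (_^-1 - _^-1)); ring.
by apply: cvgMr; exact: cvg_csc_series.
Unshelve. all: end_near. Qed.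

End euler_reflection.

Section kernel_norm.
Context {R : realType}.
Notation leb := (@lebesgue_measure R).
Implicit Types (h t u : R).

(** The factor [4^-1] is that of a half-line and of |e^(iu) - 1|^2 = 2 (1 - cos u): over the whole
    line the squared kernel at time 1 integrates to exactly [Cst h ^+ 2]. *)
Lemma integral_oneBcos_powR h : 0 < h < 1 ->
  (\int[leb]_(u in `]0%R, +oo[) ((1 - cos u) * u `^ (- (2 * h + 1)))%:E
   = (4^-1 * Cst h ^+ 2)%:E)%E.
Proof.
move=> h01; move/andP: (h01) => [h0 h1].
have G2 : 0 < Gamma (2 * h) by apply: Gamma_gt0; lra.
have Gfin : gamma_integral (2 * h + 1) = (2 * h * Gamma (2 * h))%:E.
  by rewrite gamma_integralS ?gamma_integralE -?EFinM//; lra.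
have c0 : 0 < 2 * h * Gamma (2 * h) by apply: mulr_gt0 => //; lra.
have s0 : 0 < sin (pi * h).
  by apply: sin_gt0_pi; rewrite mulr_gt0 ?pi_gt0//= gtr_pMr ?pi_gt0.
have mcos : measurable_fun setT (fun u : R => 1 - cos u).
  by apply: measurable_funB => //; apply: continuous_measurable_fun; exact: continuous_cos.
have cos0 u : 0 <= 1 - cos u by rewrite subr_ge0 cos_le1.
pose k (z : R * R) := ((1 - cos z.1) * (z.2 `^ (2 * h) * expR (- (z.1 * z.2))))%:E.
have mk : measurable_fun setT k.
  apply/measurable_EFinP; apply: measurable_funM.
    exact: measurableT_comp mcos measurable_fst.
  apply: measurable_funM.
    exact: measurableT_comp (measurable_powRE _) measurable_snd.
  apply: (measurableT_comp measurable_expN).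
  by apply: measurable_funM; [exact: measurable_fst|exact: measurable_snd].
have k0 z : (0 <= k z)%E.
  by rewrite lee_fin mulr_ge0// mulr_ge0 ?powR_ge0 ?expR_ge0.
have := @tonelli_rectangle R `]0%R, +oo[ `]0%R, +oo[ k
  (measurable_itv _) (measurable_itv _) mk k0.
have -> : (\int[leb]_(x in `]0%R, +oo[) \int[leb]_(y in `]0%R, +oo[) k (x, y) =
    (2 * h * Gamma (2 * h))%:E *
     \int[leb]_(u in `]0%R, +oo[) ((1 - cos u) * u `^ (- (2 * h + 1)))%:E)%E.
  rewrite -ge0_integralZl; last 4 first.
  - exact: measurable_itv.
  - apply: measurable_funTS; apply/measurable_EFinP; apply: measurable_funM => //.
  - by move=> u _; rewrite lee_fin mulr_ge0 ?powR_ge0.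
  - by rewrite lee_fin ltW.
  apply: eq_integral => u /set_mem/=; rewrite in_itv/= andbT => u0.
  rewrite /k/=; under eq_integral do rewrite EFinM.
  rewrite ge0_integralZl; last 4 first.
  - exact: measurable_itv.
  - apply: measurable_funTS; apply/measurable_EFinP; apply: measurable_funM => //.
    exact: measurable_expNM.
  - by move=> s _; rewrite lee_fin mulr_ge0 ?powR_ge0 ?expR_ge0.
  - by rewrite lee_fin.
  rewrite [X in (_ * X)%E](_ : _ =
    (\int[leb]_(s in `]0%R, +oo[) (s `^ (2 * h + 1 - 1) * expR (- (u * s)))%:E)%E); last first.
    by apply: eq_integral => s _; rewrite addrK.
  by rewrite gamma_integral_scale// Gfin -!EFinM; congr EFin; ring.
have -> : (\int[leb]_(y in `]0%R, +oo[) \int[leb]_(x in `]0%R, +oo[) k (x, y) =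
    (pi / (2 * sin (pi * h)))%:E)%E.
  rewrite -integral_powR_oneDsqr//; apply: eq_integral => s /set_mem/=.
  rewrite in_itv/= andbT => s1.
  transitivity (\int[leb]_(u in `]0%R, +oo[) ((s `^ (2 * h))%:E * ((1 - cos u) * expR (- (s * u)))%:E))%E.
    by apply: eq_integral => u _; rewrite /k/= -EFinM; congr EFin; rewrite mulrCA (mulrC u).
  rewrite ge0_integralZl; last 4 first.
  - exact: measurable_itv.
  - apply: measurable_funTS; apply/measurable_EFinP; apply: measurable_funM => //.
    exact: measurable_expNM.
  - by move=> u _; rewrite lee_fin mulr_ge0 ?expR_ge0.
  - by rewrite lee_fin powR_ge0.
  rewrite laplace_oneBcos// -EFinM; congr EFin.
  rewrite powRB ?(gt_eqF s1) ?implybT// powRr1 ?ltW//.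
  by rewrite invfM mulrA (addrC 1).
move=> E.
have -> : (4^-1 * Cst h ^+ 2)%:E = (((2 * h * Gamma (2 * h))^-1)%:E * (pi / (2 * sin (pi * h)))%:E)%E.
  rewrite -EFinM; congr EFin; rewrite /Cst sqr_sqrtr; last first.
    apply: divr_ge0; first exact: pi_ge0.
    have G2' : 0 < Gamma (h *+ 2) by rewrite -mulr_natl.
    exact: mulr_ge0 (mulr_ge0 (ltW h0) (ltW G2')) (ltW s0).
  rewrite -[h *+ 2]mulr_natl.
  by field; rewrite (gt_eqF s0) (gt_eqF G2) (gt_eqF h0).
by rewrite -E muleA -EFinM mulVf ?gt_eqF// mul1e.
Qed.

Lemma integral_oneBcosM h t : 0 < h < 1 -> 0 < t ->
  (\int[leb]_u ((1 - cos (t * u)) * `|u| `^ (- (2 * h + 1)))%:E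
   = (2^-1 * t `^ (2 * h) * Cst h ^+ 2)%:E)%E.
Proof.
move=> h01 t0.
have mcos s : measurable_fun setT (fun u : R => 1 - cos (s * u)).
  apply: measurable_funB => //; apply: (measurableT_comp (f := @cos R)).
    by apply: continuous_measurable_fun; exact: continuous_cos.
  exact: measurable_funM.
have cos0 u : 0 <= 1 - cos u by rewrite subr_ge0 cos_le1.
rewrite ge0_integral_evenT; last 3 first.
- apply/measurable_EFinP; apply: measurable_funM => //.
  by apply: (measurableT_comp (measurable_powRE _)); exact: normr_measurable.
- by move=> u; rewrite lee_fin mulr_ge0 ?powR_ge0.
- by move=> u; rewrite mulrN cosN normrN.
rewrite (_ : \int[leb]_(x in `]0%R, +oo[) _ = (t `^ (2 * h))%:E *
   \int[leb]_(u in `]0%R, +oo[) ((1 - cos u) * u `^ (- (2 * h + 1)))%:E)%E.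
  by rewrite integral_oneBcos_powR// -!EFinM; congr EFin; field.
rewrite -(@ge0_integral_scale0y R t t0
   (fun u => ((1 - cos u) * u `^ (- (2 * h + 1)))%:E)); last 2 first.
- apply: measurable_funTS; apply/measurable_EFinP; apply: measurable_funM => //.
  by have := mcos 1; under eq_fun do rewrite mul1r.
- by move=> u _; rewrite lee_fin mulr_ge0 ?powR_ge0.
rewrite muleA -EFinM -ge0_integralZl; last 4 first.
- exact: measurable_itv.
- apply: measurable_funTS; apply/measurable_EFinP; apply: measurable_funM; first exact: mcos.
  by apply: (measurableT_comp (measurable_powRE _)); exact: measurable_funM.
- by move=> u _; rewrite lee_fin mulr_ge0 ?powR_ge0.
- by rewrite lee_fin mulr_ge0 ?powR_ge0 ?ltW.
apply: eq_integral => u /set_mem/=; rewrite in_itv/= andbT => u0.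
rewrite -EFinM; congr EFin; rewrite (gtr0_norm u0) powRM ?ltW//.
suff E : t `^ (2 * h) * t * t `^ (- (2 * h + 1)) = 1.
  by rewrite -[LHS]mul1r -[X in X * _ = _]E; ring.
rewrite -{2}(powRr1 (ltW t0)) -!powRD ?(gt_eqF t0) ?implybT//.
by rewrite (_ : 2 * h + 1 - (2 * h + 1) = 0) ?powRr0//; ring.
Qed.

Lemma mbm_kernel_sqE h t u :
  mbm_kernel_re h t u ^+ 2 + mbm_kernel_im h t u ^+ 2 =
  2 * ((1 - cos (t * u)) * `|u| `^ (- (2 * h + 1))).
Proof.
rewrite /mbm_kernel_re /mbm_kernel_im !expr_div_n -mulrDl.
have -> : (cos (t * u) - 1) ^+ 2 + sin (t * u) ^+ 2 = 2 * (1 - cos (t * u)).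
  by rewrite sin2cos2; ring.
rewrite powRN -mulrA; congr (_ * (_ * _^-1)).
by rewrite -[_ ^+ 2]powR_mulrn ?powR_ge0// -powRrM; congr (_ `^ _); field.
Qed.

Lemma measurable_mbm_kernel h t :
  measurable_fun setT (mbm_kernel_re h t) /\ measurable_fun setT (mbm_kernel_im h t).
Proof.
have mq : measurable_fun setT (fun u : R => (`|u| `^ (h + 2^-1))^-1).
  under eq_fun do rewrite -powRN.
  by apply: (measurableT_comp (measurable_powRE _)); exact: normr_measurable.
split; apply: measurable_funM => //.
  apply: measurable_funB => //; apply: (measurableT_comp (f := @cos R)).
    by apply: continuous_measurable_fun; exact: continuous_cos.
  exact: measurable_funM.
apply: (measurableT_comp (f := @sin R)).
  by apply: continuous_measurable_fun; exact: continuous_sin.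
exact: measurable_funM.
Qed.

Lemma integral_mbm_kernel_sq h t : 0 < h < 1 -> 0 < t ->
  (\int[leb]_u (mbm_kernel_re h t u ^+ 2 + mbm_kernel_im h t u ^+ 2)%:E
   = (t `^ (2 * h) * Cst h ^+ 2)%:E)%E.
Proof.
move=> h01 t0; under eq_integral do rewrite mbm_kernel_sqE EFinM.
have -> : (t `^ (2 * h) * Cst h ^+ 2)%:E = (2%:E * (2^-1 * t `^ (2 * h) * Cst h ^+ 2)%:E)%E.
  by rewrite -EFinM; congr EFin; field.
rewrite -integral_oneBcosM// ge0_integralZl//.
- apply/measurable_EFinP; apply: measurable_funM; last first.
    by apply: (measurableT_comp (measurable_powRE _)); exact: normr_measurable.
  apply: measurable_funB => //; apply: (measurableT_comp (f := @cos R)).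
    by apply: continuous_measurable_fun; exact: continuous_cos.
  exact: measurable_funM.
Qed.

End kernel_norm.

(** * Plancherel's identity *)

Section real_integrals.
Context d {T : measurableType d} {R : realType} (mu : {measure set T -> \bar R}).
Implicit Types f g : T -> R.

Lemma le_integrable_real f g : measurable_fun setT f ->
  mu.-integrable setT (fun x => (g x)%:E) -> (forall x, `|f x| <= g x) ->
  mu.-integrable setT (fun x => (f x)%:E).
Proof.
move=> mf ig fg; apply: (le_integrable measurableT _ _ ig).
  exact/measurable_EFinP.
by move=> x _ /=; rewrite lee_fin (le_trans (fg x))// ler_norm.
Qed.

Lemma integrable_realD f g :
  mu.-integrable setT (fun x => (f x)%:E) -> mu.-integrable setT (fun x => (g x)%:E) ->
  mu.-integrable setT (fun x => (f x + g x)%:E).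
Proof. by move=> fi gi; under eq_fun do rewrite EFinD; exact: integrableD. Qed.

Lemma integrable_realZ c f :
  mu.-integrable setT (fun x => (f x)%:E) -> mu.-integrable setT (fun x => (c * f x)%:E).
Proof. by move=> fi; under eq_fun do rewrite EFinM; exact: integrableZl. Qed.

Lemma integrable_realB f g :
  mu.-integrable setT (fun x => (f x)%:E) -> mu.-integrable setT (fun x => (g x)%:E) ->
  mu.-integrable setT (fun x => (f x - g x)%:E).
Proof. by move=> fi gi; under eq_fun do rewrite EFinB; exact: integrableB. Qed.

Lemma integrable_ge0_real f (c : R) : measurable_fun setT f -> (forall x, 0 <= f x) ->
  (\int[mu]_x (f x)%:E = c%:E)%E -> mu.-integrable setT (fun x => (f x)%:E).
Proof.
move=> mf f0 fc; apply/integrableP; split; first exact/measurable_EFinP.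
rewrite (_ : (\int[mu]_x `|(f x)%:E|)%E = c%:E) ?ltry// -fc.
by apply: eq_integral => x _; rewrite gee0_abs// lee_fin.
Qed.

Lemma Rintegral_integral f : mu.-integrable setT (fun x => (f x)%:E) ->
  ((\int[mu]_x f x)%:E = \int[mu]_x (f x)%:E)%E.
Proof. by move=> fi; rewrite /Rintegral fineK//; exact: integrable_fin_num. Qed.

Lemma RintegralTZ c f : mu.-integrable setT (fun x => (f x)%:E) ->
  \int[mu]_x (c * f x) = c * \int[mu]_x f x.
Proof. by move=> fi; rewrite RintegralZl. Qed.

Lemma RintegralTD f g :
  mu.-integrable setT (fun x => (f x)%:E) -> mu.-integrable setT (fun x => (g x)%:E) ->
  \int[mu]_x (f x + g x) = \int[mu]_x f x + \int[mu]_x g x.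
Proof. by move=> fi gi; rewrite RintegralD. Qed.

Lemma RintegralTB f g :
  mu.-integrable setT (fun x => (f x)%:E) -> mu.-integrable setT (fun x => (g x)%:E) ->
  \int[mu]_x (f x - g x) = \int[mu]_x f x - \int[mu]_x g x.
Proof. by move=> fi gi; rewrite RintegralB. Qed.

End real_integrals.

Section reflection.
Context {R : realType}.
Notation leb := (@lebesgue_measure R).
Implicit Types f g : R -> R.

Lemma measurable_fun_opp f : measurable_fun setT f -> measurable_fun setT (fun x : R => f (- x)).
Proof. by move=> mf; apply: (measurableT_comp mf). Qed.

Lemma measurable_fun_shift f a : measurable_fun setT f ->
  measurable_fun setT (fun x : R => f (x + a)).
Proof. by move=> mf; apply: (measurableT_comp mf); exact: measurable_funD. Qed.

Lemma integral_opp f : measurable_fun setT f ->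
  (\int[leb]_x (f (- x))%:E = \int[leb]_x (f x)%:E)%E.
Proof.
move=> mf; have mF : measurable_fun setT (EFin \o f) by exact/measurable_EFinP.
rewrite [RHS]integralE [LHS]integralE.
have P := ge0_integral_oppT (measurable_funepos mF) (fun x => funepos_ge0 _ x).
have N := ge0_integral_oppT (measurable_funeneg mF) (fun x => funeneg_ge0 _ x).
by congr (_ - _)%E; [rewrite -P|rewrite -N]; apply: eq_integral => x _;
  rewrite ?funeposE ?funenegE.
Qed.

Lemma Rintegral_opp f : measurable_fun setT f ->
  \int[leb]_x (f (- x)) = \int[leb]_x (f x).
Proof. by move=> mf; rewrite /Rintegral integral_opp. Qed.

Lemma integrable_opp f : leb.-integrable setT (fun x => (f x)%:E) ->
  leb.-integrable setT (fun x : R => (f (- x))%:E).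
Proof.
move=> /integrableP[/measurable_EFinP mf fi]; apply/integrableP; split.
  by apply/measurable_EFinP; exact: measurable_fun_opp.
have mn : measurable_fun setT (fun x : R => `|f x|) by apply: measurableT_comp.
by have := integral_opp mn => /= ->.
Qed.

Lemma Rintegral_odd f : leb.-integrable setT (fun x => (f x)%:E) ->
  (forall x, f (- x) = - f x) -> \int[leb]_x (f x) = 0.
Proof.
move=> fi fo; have mf : measurable_fun setT f by case/integrableP: fi => /measurable_EFinP.
have E : \int[leb]_x (f x) = - \int[leb]_x (f x).
  rewrite -[LHS]Rintegral_opp// -mulN1r -RintegralZl//.
  by apply: eq_Rintegral => x _; rewrite fo mulN1r.
lra.
Qed.

Lemma ge0_integral_shift (f : R -> \bar R) a : measurable_fun setT f ->
  (forall x, (0 <= f x)%E) -> (\int[leb]_x f (x + a)%R = \int[leb]_x f x)%E.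
Proof.
move=> mf f0; rewrite -(ge0_integral_affineT a ltr01 mf f0) mul1e.
by apply: eq_integral => x _; rewrite mul1r.
Qed.

End reflection.

Section fejer.
Context {R : realType}.
Notation leb := (@lebesgue_measure R).
Implicit Types a b e u x y : R.

(* At [u = 0] the division gives the junk value [0]. *)
Definition oneBcos_sq b u : R := (1 - cos (b * u)) / u ^+ 2.

Lemma measurable_cosM a : measurable_fun setT (fun u : R => cos (a * u)).
Proof.
apply: (measurableT_comp (f := @cos R)); last exact: measurable_funM.
by apply: continuous_measurable_fun; exact: continuous_cos.
Qed.

Lemma measurable_sinM a : measurable_fun setT (fun u : R => sin (a * u)).
Proof.
apply: (measurableT_comp (f := @sin R)); last exact: measurable_funM.
by apply: continuous_measurable_fun; exact: continuous_sin.
Qed.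

Lemma powRN2 u : `|u| `^ (- 2%:R) = (u ^+ 2)^-1.
Proof. by rewrite powRN powR_mulrn// real_normK// num_real. Qed.

Lemma measurable_oneBcos_sq b : measurable_fun setT (oneBcos_sq b).
Proof.
apply: measurable_funM; first by apply: measurable_funB => //; exact: measurable_cosM.
under eq_fun do rewrite -powRN2.
by apply: (measurableT_comp (measurable_powRE _)); exact: normr_measurable.
Qed.

Lemma oneBcos_sq_ge0 b u : 0 <= oneBcos_sq b u.
Proof. by rewrite divr_ge0 ?sqr_ge0// subr_ge0 cos_le1. Qed.

(** At h = 1/2 the kernel integral is that of (1 - cos u)/u^2, so the constant of the Fejer kernel
    is read off [Cst]. *)
Lemma Cst_half : Cst (2^-1 : R) ^+ 2 = pi *+ 2.
Proof.
have h2 : 2^-1 *+ 2 = 1 :> R by rewrite -[LHS]mulr_natr mulVf.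
have G1 : Gamma (1 : R) = 1.
  by apply: EFin_inj; rewrite -gamma_integralE ?gamma_integral1//; lra.
rewrite /Cst h2 G1 sin_pihalf !mulr1 sqr_sqrtr ?invrK ?mulr_natr//.
by rewrite mulrn_wge0// pi_ge0.
Qed.

Lemma integral_oneBcos_sq b : (\int[leb]_u (oneBcos_sq b u)%:E = (pi * `|b|)%:E)%E.
Proof.
have pos c : 0 < c -> (\int[leb]_u (oneBcos_sq c u)%:E = (pi * c)%:E)%E.
  move=> c0; have := @integral_oneBcosM R 2^-1 c; rewrite mulfV//.
  have -> : - (1 + 1) = - 2%:R :> R by [].
  under eq_integral do rewrite powRN2.
  rewrite Cst_half => ->//; last by apply/andP; split; lra.
  by congr EFin; rewrite powRr1 ?(ltW c0)// -mulr_natr; field.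
have [b0|b0|->] := ltgtP b 0; last first.
- rewrite normr0 mulr0 integral0_eq// => u _.
  by rewrite /oneBcos_sq mul0r cos0 subrr mul0r.
- by rewrite gtr0_norm// pos.
rewrite ltr0_norm// -pos ?oppr_gt0//; apply: eq_integral => u _.
by rewrite /oneBcos_sq mulNr cosN.
Qed.

Lemma integrable_oneBcos_sq b : leb.-integrable setT (fun u => (oneBcos_sq b u)%:E).
Proof.
apply: integrable_ge0_real (integral_oneBcos_sq b).
  exact: measurable_oneBcos_sq.
exact: oneBcos_sq_ge0.
Qed.

(** The squared cardinal sine of e u / 2, normalised to tend to 1 as e tends to 0. At u = 0 its
    value is 0 instead of 1, on a null set. *)
Definition fejer e u : R := 2 / e ^+ 2 * oneBcos_sq e u.

(** For e > 0, the hat max(0, e - |x|)/e^2, of integral 1. It is written as a second difference of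
    the absolute value, the form in which the Fourier integral of [fejer] delivers it. *)
Definition tent e x : R := (2^-1 * `|e + x| + 2^-1 * `|e - x| - `|x|) / e ^+ 2.

Lemma measurable_fejer e : measurable_fun setT (fejer e).
Proof. by apply: measurable_funM => //; exact: measurable_oneBcos_sq. Qed.

Lemma fejer_ge0 e u : 0 <= fejer e u.
Proof. by rewrite mulr_ge0 ?oneBcos_sq_ge0// divr_ge0 ?sqr_ge0. Qed.

Lemma sin_le (x : R) : 0 <= x -> sin x <= x.
Proof.
rewrite le_eqVlt => /predU1P[<-|x0]; first by rewrite sin0.
have [c] : exists2 c, c \in `]0, x[%R & sin x - sin 0 = cos c * (x - 0).
  apply: MVT => //; last by apply: continuous_subspaceT => ?; exact: continuous_sin.
by rewrite sin0 !subr0 => _ ->; rewrite ler_piMl ?cos_le1 ?ltW.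
Qed.

Lemma normr_sin_le (x : R) : `|sin x| <= `|x|.
Proof.
wlog x0 : x / 0 <= x.
  move=> H; have [/H//|/ltW x0] := leP 0 x.
  by rewrite -normrN -sinN -(normrN x) H// oppr_ge0.
rewrite (ger0_norm x0) ler_norml sin_le// andbT.
have [x1|x1] := leP x 1.
  rewrite (le_trans _ (sin_ge0_pi _))// ?oppr_le0// x0/=.
  by have := @pi_ge2 R; lra.
by rewrite (le_trans _ (sin_geN1 _))// lerN2 ltW.
Qed.

Lemma oneBcosE (x : R) : 1 - cos x = 2 * sin (x / 2) ^+ 2.
Proof.
have -> : x = (x / 2) *+ 2 by rewrite -mulr_natr; field.
rewrite cos_mulr2n sin2cos2.
have -> : x / 2 *+ 2 / 2 = x / 2 by rewrite -mulr_natr; field.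
ring.
Qed.

Lemma fejerE e u : e != 0 -> u != 0 ->
  fejer e u = (sin (e * u / 2) / (e * u / 2)) ^+ 2.
Proof.
by move=> e0 u0; rewrite /fejer /oneBcos_sq oneBcosE; field; rewrite e0 u0.
Qed.

Lemma fejer_le1 e u : fejer e u <= 1.
Proof.
have [->|e0] := eqVneq e 0; first by rewrite /fejer expr0n/= invr0 mulr0 mul0r.
have [->|u0] := eqVneq u 0; first by rewrite /fejer /oneBcos_sq expr0n/= invr0 !mulr0.
rewrite fejerE//.
rewrite -[leRHS](expr1n _ 2) -real_normK ?num_real// ler_pXn2r ?nnegrE//.
have eu0 : e * u / 2 != 0 by rewrite !mulf_neq0.
by rewrite normrM normfV ler_pdivrMr ?normr_gt0// mul1r normr_sin_le.
Qed.

Lemma integrable_fejer e : leb.-integrable setT (fun u => (fejer e u)%:E).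
Proof. by apply: integrable_realZ; exact: integrable_oneBcos_sq. Qed.

(** Product-to-sum formulas rewrite (1 - cos eu) cos xu through 1 - cos at the frequencies e + x, e
    - x and x; each of these integrates against 1/u^2 to pi times the absolute frequency. *)
Lemma Rintegral_fejer_cos e x : 
  \int[leb]_u (fejer e u * cos (x * u)) = pi *+ 2 * tent e x.
Proof.
have E b : \int[leb]_u (oneBcos_sq b u) = pi * `|b|.
  by rewrite /Rintegral integral_oneBcos_sq.
have i := integrable_oneBcos_sq.
rewrite (_ : (fun u => _) = (fun u => 2 / e ^+ 2 * ((2^-1 * oneBcos_sq (e + x) u
    + 2^-1 * oneBcos_sq (e - x) u) - oneBcos_sq x u))); last first.
  apply/funext => u; rewrite /fejer /oneBcos_sq [(e + x) * u]mulrDl [(e - x) * u]mulrBl cosD cosB.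
  by move: (u ^+ 2)^-1 (e ^+ 2)^-1 => v w; field.
have iZ b := integrable_realZ 2^-1 (i b).
have iD := integrable_realD (iZ (e + x)) (iZ (e - x)).
rewrite (RintegralTZ _ (integrable_realB iD (i x))).
rewrite (RintegralTB iD (i x)) (RintegralTD (iZ _) (iZ _)).
rewrite !(RintegralTZ _ (i _)) !E /tent -mulr_natr; ring.
Qed.

Lemma integrable_fejerM e (g : R -> R) : measurable_fun setT g -> (forall u, `|g u| <= 1) ->
  leb.-integrable setT (fun u => (fejer e u * g u)%:E).
Proof.
move=> mg g1; apply: (le_integrable_real _ (integrable_fejer e)).
  by apply: measurable_funM => //; exact: measurable_fejer.
by move=> u; rewrite normrM ger0_norm ?fejer_ge0// ler_piMr ?fejer_ge0.
Qed.

Lemma tentE e x : 0 < e -> tent e x = if `|x| < e then (e - `|x|) / e ^+ 2 else 0.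
Proof.
move=> e0; rewrite /tent; case: ltP => xe.
  move: (xe); rewrite ltr_norml => /andP[x1 x2].
  rewrite (@gtr0_norm _ (e + x)) ?(@gtr0_norm _ (e - x)); [|lra|lra].
  by congr (_ / _); field.
rewrite (_ : 2^-1 * `|e + x| + 2^-1 * `|e - x| - `|x| = 0) ?mul0r//.
have [x0|x0] := leP 0 x.
  rewrite (ger0_norm x0) in xe *.
  by rewrite (@ger0_norm _ (e + x)) ?(@ler0_norm _ (e - x)); [field|lra|lra].
rewrite (ltr0_norm x0) in xe *.
by rewrite (@ler0_norm _ (e + x)) ?(@ger0_norm _ (e - x)); [field|lra|lra].
Qed.

Lemma tent_ge0 e x : 0 < e -> 0 <= tent e x.
Proof.
move=> e0; rewrite tentE//; case: ltP => // xe.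
by rewrite divr_ge0 ?sqr_ge0// subr_ge0 ltW.
Qed.

Lemma tent_le e x : 0 < e -> tent e x <= e^-1.
Proof.
move=> e0; rewrite tentE//; case: ltP => xe; last by rewrite invr_ge0 ltW.
rewrite ler_pdivrMr ?exprn_gt0// expr2 mulrA mulVf ?gt_eqF// mul1r.
by rewrite lerBlDr lerDl.
Qed.

Lemma tentN e x : tent e (- x) = tent e x.
Proof. by rewrite /tent opprK normrN; congr (_ / _); ring. Qed.

Lemma measurable_tent e : measurable_fun setT (tent e).
Proof.
apply: continuous_measurable_fun => x.
apply: cvgMl; apply: cvgB; last by apply: cvg_norm; exact: cvg_id.
by apply: cvgD; apply: cvgMr; apply: cvg_norm; [apply: cvgD|apply: cvgB];
  do ?[exact: cvg_cst|exact: cvg_id].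
Qed.

Lemma integral_tent e : 0 < e -> (\int[leb]_x (tent e x)%:E = 1%E)%E.
Proof.
move=> e0; rewrite ge0_integral_evenT; last 3 first.
- by apply/measurable_EFinP; exact: measurable_tent.
- by move=> x; rewrite lee_fin tent_ge0.
- by move=> x; rewrite tentN.
suff -> : (\int[leb]_(x in `]0%R, +oo[) (tent e x)%:E = (2^-1)%:E)%E.
  by rewrite -EFinM mulfV.
transitivity (\int[leb]_(x in `]0%R, e]) ((e - x) / e ^+ 2)%:E)%E.
  rewrite [LHS]integral_mkcond [RHS]integral_mkcond; apply: eq_integral => x _.
  rewrite !patchE !mem_setE !in_itv/= andbT tentE//.
  case: ltP => // x0; rewrite gtr0_norm//=; case: (ltgtP x e) => // ->.
  by rewrite subrr mul0r.
rewrite integral_itv_obnd_cbnd; last first.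
  apply: measurable_funTS; apply/measurable_EFinP; apply: measurable_funM => //.
  exact: measurable_funB.
have dF (x : R) : is_derive x 1 (fun x : R => (e * x - x ^+ 2 / 2) / e ^+ 2) ((e - x) / e ^+ 2).
  apply: is_derive_eq; rewrite /GRing.scale/= ?mulr1 ?mulr0 ?add0r; field; exact: lt0r_neq0.
have cF (x : R) : {for x, continuous (fun x : R => (e * x - x ^+ 2 / 2) / e ^+ 2)}.
  by apply: differentiable_continuous; apply/derivable1_diffP; have [] := dF x.
rewrite (@continuous_FTC2 _ _ (fun x => (e * x - x ^+ 2 / 2) / e ^+ 2))//.
- by rewrite -EFinB; congr EFin; rewrite expr0n/=; field; exact: lt0r_neq0.
- apply: continuous_subspaceT => x; apply: cvgMl; apply: cvgB; [exact: cvg_cst|exact: cvg_id].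
- split; first by move=> x _; have [] := dF x.
  + by apply: cvg_at_right_filter; exact: cF.
  + by apply: cvg_at_left_filter; exact: cF.
- by move=> x _; rewrite derive1E; have [_ ->] := dF x.
Qed.

End fejer.

Section almost_everywhere.
Context d {T : measurableType d} {R : realType} (mu : {measure set T -> \bar R}).

Lemma ae_mono (A B : T -> Prop) : (forall x, A x -> B x) ->
  {ae mu, forall x, A x} -> {ae mu, forall x, B x}.
Proof.
move=> AB [N [mN N0 AN]]; exists N; split => // x nB.
by apply: AN => /= Ax; exact/nB/AB.
Qed.

(** Fatou's lemma away from the null set of divergence, where the lower limit is a limit.
    Plancherel's identity needs it because the mollified functions are only controlled almost
    everywhere and in norm. *)
Lemma fatou_ae_le (F_ : nat -> T -> R) (F : T -> R) (r_ : nat -> R) (r : R) :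
  (forall n, measurable_fun setT (F_ n)) -> measurable_fun setT F ->
  (forall n x, 0 <= F_ n x) -> (forall x, 0 <= F x) ->
  {ae mu, forall x, F_ n x @[n --> \oo] --> F x} ->
  (forall n, (\int[mu]_x (F_ n x)%:E <= (r_ n)%:E)%E) -> r_ n @[n --> \oo] --> r ->
  (\int[mu]_x (F x)%:E <= r%:E)%E.
Proof.
move=> mF_ mF F_0 F0 [Z [mZ Z0 FZ]] Fr rr.
have mD : measurable (setT `\` Z) by exact: measurableD.
rewrite (ge0_negligible_integral mZ)//; last 2 first.
- exact/measurable_EFinP.
- by move=> x _; rewrite lee_fin.
have := @fatou _ _ _ mu _ mD (fun n x => (F_ n x)%:E).
have -> : (\int[mu]_(x in setT `\` Z) limn_einf ((fun n x => (F_ n x)%:E)^~ x) =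
    \int[mu]_(x in setT `\` Z) (F x)%:E)%E.
  apply: eq_integral => x /set_mem[_ nZx].
  have cx : (F_ n x)%:E @[n --> \oo] --> (F x)%:E.
    apply: cvg_EFin; first exact: nearW.
    by apply: contrapT => nF; exact/nZx/FZ.
  rewrite is_cvg_limn_einfE; last by apply/cvg_ex; eexists; exact: cx.
  exact/cvg_lim.
move=> /(_ _ _)/le_trans; apply.
- by move=> n; apply: measurable_funTS; exact/measurable_EFinP.
- by move=> n x _; rewrite lee_fin.
have cr : (r_ n)%:E @[n --> \oo] --> r%:E by apply: cvg_EFin => //; exact: nearW.
rewrite -(cvg_lim _ cr)//.
have <- : limn_einf (fun n => (r_ n)%:E) = limn (fun n => (r_ n)%:E).
  by apply: is_cvg_limn_einfE; apply/cvg_ex; eexists; exact: cr.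
rewrite !limn_einf_lim; apply: lee_lim; [exact: is_cvg_einfs|exact: is_cvg_einfs|].
apply: nearW => n; apply: le_ereal_inf_tmp.
move=> _ [k kn <-]; apply: (@le_trans _ _ (\int[mu]_(x in setT `\` Z) (F_ k x)%:E)%E).
  by apply: ereal_inf_lbound; exists k.
apply: le_trans (Fr k); apply: ge0_subset_integral => //.
- exact/measurable_EFinP.
- by move=> x _; rewrite lee_fin.
Qed.

End almost_everywhere.

Section L2.
Context {R : realType}.
Notation leb := (@lebesgue_measure R).
Implicit Types f g m : R -> R.

Lemma L2_mul_integrable f g : L2fun f -> L2fun g ->
  leb.-integrable setT (fun x => (f x * g x)%:E).
Proof.
move=> [mf f2] [mg g2]; apply: (le_integrable_real _ (integrable_realD f2 g2)).
  exact: measurable_funM.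
move=> x; rewrite ler_norml; apply/andP; split.
  have := sqr_ge0 (f x + g x); have := sqr_ge0 (f x); have := sqr_ge0 (g x); nra.
have := sqr_ge0 (f x - g x); have := sqr_ge0 (f x); have := sqr_ge0 (g x); nra.
Qed.

Lemma L2_mul_bounded m f : measurable_fun setT m -> (forall x, `|m x| <= 1) ->
  L2fun f -> L2fun (fun x => m x * f x).
Proof.
move=> mm m1 [mf f2]; split; first exact: measurable_funM.
apply: (le_integrable_real _ f2).
  by apply: measurable_funX; exact: measurable_funM.
move=> x; rewrite ger0_norm ?sqr_ge0// exprMn ler_piMl ?sqr_ge0//.
by rewrite -real_normK ?num_real// expr_le1.
Qed.

Lemma L2_add f g : L2fun f -> L2fun g -> L2fun (fun x => f x + g x).
Proof.
move=> [mf f2] [mg g2]; split; first exact: measurable_funD.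
apply: (le_integrable_real _ (integrable_realD (integrable_realZ 2 f2) (integrable_realZ 2 g2))).
  by apply: measurable_funX; exact: measurable_funD.
move=> x; rewrite ger0_norm ?sqr_ge0//.
have := sqr_ge0 (f x - g x); nra.
Qed.

Lemma L2_scale c f : L2fun f -> L2fun (fun x => c * f x).
Proof.
move=> [mf f2]; split; first exact: measurable_funM.
by under eq_fun do rewrite exprMn; exact: integrable_realZ.
Qed.

Lemma L2_opp f : L2fun f -> L2fun (fun x : R => f (- x)).
Proof.
move=> [mf f2]; split; first exact: measurable_fun_opp.
exact: (integrable_opp f2).
Qed.

Lemma L1_bounded_L2 f c : 0 <= c -> (forall x, `|f x| <= c) -> L1fun f -> L2fun f.
Proof.
move=> c0 fc [mf fi]; split => //.
have fn : leb.-integrable setT (fun x => (`|f x|)%:E) by exact: integrable_norm.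
apply: (le_integrable_real _ (integrable_realZ c fn)); first exact: measurable_funX.
by move=> x; rewrite normrX expr2 ler_wpM2r.
Qed.

End L2.

Section mollification.
Context {R : realType}.
Notation leb := (@lebesgue_measure R).
Implicit Types (f : R -> R) (e x y : R).

Definition mollify e f y : R := \int[leb]_x (f x * tent e (x - y)).

Lemma measurable_tentB e y : measurable_fun setT (fun x : R => tent e (x - y)).
Proof. exact: measurable_fun_shift (measurable_tent e). Qed.

Lemma integral_tentB e y : 0 < e -> (\int[leb]_x (tent e (x - y))%:E = 1%E)%E.
Proof.
move=> e0; rewrite -(integral_tent e0).
rewrite -[RHS](ge0_integral_shift (f := fun x => (tent e x)%:E) (- y))//.
  by apply/measurable_EFinP; exact: measurable_tent.
by move=> x; rewrite lee_fin tent_ge0.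
Qed.

Lemma integral_tentBl e x : 0 < e -> (\int[leb]_y (tent e (x - y))%:E = 1%E)%E.
Proof.
by move=> e0; rewrite -(integral_tentB x e0); apply: eq_integral => y _; rewrite -tentN opprB.
Qed.

Lemma L1_tentB e y : 0 < e -> L1fun (fun x : R => tent e (x - y)).
Proof.
move=> e0; split; first exact: measurable_tentB.
apply: integrable_ge0_real (integral_tentB y e0).
  exact: measurable_tentB.
by move=> x; exact: tent_ge0.
Qed.

Lemma L2_tentB e y : 0 < e -> L2fun (fun x : R => tent e (x - y)).
Proof.
move=> e0; apply: (@L1_bounded_L2 _ _ e^-1); first by rewrite invr_ge0 ltW.
  by move=> x; rewrite ger0_norm ?tent_ge0 ?tent_le.
exact: L1_tentB.
Qed.

Lemma measurable_mollify e f : measurable_fun setT f -> measurable_fun setT (mollify e f).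
Proof.
move=> mf.
pose h (z : R * R) := (f z.2 * tent e (z.2 - z.1))%:E.
have mh : measurable_fun setT h.
  apply/measurable_EFinP; apply: measurable_funM.
    exact: measurableT_comp mf measurable_snd.
  apply: (measurableT_comp (measurable_tent e)).
  by apply: measurable_funB; [exact: measurable_snd|exact: measurable_fst].
have p0 z : (0 <= h^\+ z)%E by exact: funepos_ge0.
have n0 z : (0 <= h^\- z)%E by exact: funeneg_ge0.
have mp := measurable_fun_fubini_tonelli_F (m2 := leb) h^\+%E (measurable_funepos mh) p0.
have mn := measurable_fun_fubini_tonelli_F (m2 := leb) h^\-%E (measurable_funeneg mh) n0.
have := measurableT_comp (@fine_measurable R setT measurableT) (emeasurable_funB mp mn).
congr measurable_fun; apply/funext => y.
rewrite /mollify /Rintegral [in RHS]integralE /= /fubini_F; congr (fine (_ - _)%E).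
  by apply: eq_integral => x _; rewrite !funeposE.
by apply: eq_integral => x _; rewrite !funenegE.
Qed.

(** Jensen's inequality for the probability density [tent e (x - y)]: the integral of (f - c)^2
    against it, with c the mean, is nonnegative. *)
Let mollify_sq_le e f y : 0 < e -> L2fun f ->
  ((mollify e f y ^+ 2)%:E <= \int[leb]_x (f x ^+ 2 * tent e (x - y))%:E)%E.
Proof.
move=> e0 Lf; have [mf f2] := Lf; set c := mollify e f y.
have t0 x : 0 <= tent e (x - y) by exact: tent_ge0.
have [mt ti] := L1_tentB y e0.
have fti := L2_mul_integrable Lf (L2_tentB y e0).
have f2ti : leb.-integrable setT (fun x => (f x ^+ 2 * tent e (x - y))%:E).
  apply: (le_integrable_real _ (integrable_realZ e^-1 f2)).
    by apply: measurable_funM => //; exact: measurable_funX.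
  move=> x; rewrite ger0_norm; last by rewrite mulr_ge0 ?sqr_ge0.
  by rewrite mulrC ler_wpM2r ?sqr_ge0 ?tent_le.
rewrite -Rintegral_integral// lee_fin.
have : 0 <= \int[leb]_x ((f x ^+ 2 * tent e (x - y) - 2 * c * (f x * tent e (x - y)))
   + c ^+ 2 * tent e (x - y)).
  apply: Rintegral_ge0 => x _.
  have -> : f x ^+ 2 * tent e (x - y) - 2 * c * (f x * tent e (x - y)) + c ^+ 2 * tent e (x - y)
    = (f x - c) ^+ 2 * tent e (x - y) by ring.
  by rewrite mulr_ge0 ?sqr_ge0.
rewrite RintegralTD; last 2 first.
- by apply: integrable_realB => //; exact: integrable_realZ.
- exact: integrable_realZ.
rewrite RintegralTB//; last exact: integrable_realZ.
rewrite !RintegralTZ// -/(mollify e f y) -/c.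
rewrite (_ : \int[leb]_x tent e (x - y) = 1); last by rewrite /Rintegral integral_tentB.
nra.
Qed.

Lemma integral_mollify_sq_le e f : 0 < e -> L2fun f ->
  (\int[leb]_y (mollify e f y ^+ 2)%:E <= \int[leb]_x (f x ^+ 2)%:E)%E.
Proof.
move=> e0 Lf; have [mf f2] := Lf.
apply: (@le_trans _ _ (\int[leb]_y \int[leb]_x (f x ^+ 2 * tent e (x - y))%:E)%E).
  apply: ge0_le_integral => //.
  - by move=> y _; rewrite lee_fin sqr_ge0.
  - by apply/measurable_EFinP; apply: measurable_funX; exact: measurable_mollify.
  - pose h (z : R * R) := (f z.2 ^+ 2 * tent e (z.2 - z.1))%:E.
    have mh : measurable_fun setT h.
      apply/measurable_EFinP; apply: measurable_funM.
        by apply: measurable_funX; exact: measurableT_comp mf measurable_snd.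
      apply: (measurableT_comp (measurable_tent e)).
      by apply: measurable_funB; [exact: measurable_snd|exact: measurable_fst].
    have h0 z : (0 <= h z)%E by rewrite lee_fin mulr_ge0 ?sqr_ge0 ?tent_ge0.
    exact: (measurable_fun_fubini_tonelli_F (m2 := leb) h mh h0).
  - by move=> y _; exact: mollify_sq_le.
pose h (z : R * R) := (f z.2 ^+ 2 * tent e (z.2 - z.1))%:E.
have mh : measurable_fun setT h.
  apply/measurable_EFinP; apply: measurable_funM.
    by apply: measurable_funX; exact: measurableT_comp mf measurable_snd.
  apply: (measurableT_comp (measurable_tent e)).
  by apply: measurable_funB; [exact: measurable_snd|exact: measurable_fst].
have h0 z : (0 <= h z)%E by rewrite lee_fin mulr_ge0 ?sqr_ge0 ?tent_ge0.
rewrite -[leLHS]/(\int[leb]_y \int[leb]_x h (y, x))%E fubini_tonelli//.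
rewrite le_eqVlt; apply/orP; left; apply/eqP; apply: eq_integral => x _.
rewrite /h/=; under eq_integral do rewrite EFinM.
rewrite ge0_integralZl//.
- by rewrite integral_tentBl// mule1.
- apply/measurable_EFinP; apply: (measurableT_comp (measurable_tent e)).
  exact: measurable_funB.
- by move=> y _; rewrite lee_fin tent_ge0.
- by rewrite lee_fin sqr_ge0.
Qed.

Lemma L2_mollify e f : 0 < e -> L2fun f -> L2fun (mollify e f).
Proof.
move=> e0 Lf; have [mf f2] := Lf; have mm := measurable_mollify e mf; split => //.
apply/integrableP; split.
  by apply/measurable_EFinP; exact: measurable_funX.
have -> : (\int[leb]_x `|(mollify e f x ^+ 2)%:E| = \int[leb]_x (mollify e f x ^+ 2)%:E)%E.
  by apply: eq_integral => x _; rewrite gee0_abs// lee_fin sqr_ge0.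
apply: (le_lt_trans (integral_mollify_sq_le e0 Lf)).
by rewrite -Rintegral_integral// ltry.
Qed.

Lemma L2_locally_integrable f : L2fun f -> locally_integrable setT f.
Proof.
move=> [mf f2]; split => //; first exact: openT.
move=> K _ cK; have mK : measurable K by exact: compact_measurable.
apply: (@le_lt_trans _ _ (\int[leb]_(x in K) (1%:E + (f x ^+ 2)%:E))%E).
  apply: ge0_le_integral => //.
  - by apply: measurable_funTS; apply/measurable_EFinP; exact: measurableT_comp.
  - apply: emeasurable_funD => //; apply: measurable_funTS.
    by apply/measurable_EFinP; exact: measurable_funX.
  - move=> x _; rewrite -EFinD lee_fin; have := sqr_ge0 (`|f x| - 2^-1).
    by rewrite -(real_normK (num_real (f x))); nra.
rewrite ge0_integralD//; last 2 first.
- by move=> x _; rewrite lee_fin sqr_ge0.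
- by apply: measurable_funTS; apply/measurable_EFinP; exact: measurable_funX.
apply: lte_add_pinfty.
  by rewrite integral_cst// mul1e compact_finite_measure.
apply: (@le_lt_trans _ _ (\int[leb]_x (f x ^+ 2)%:E)%E).
  apply: ge0_subset_integral => //.
  - by apply/measurable_EFinP; exact: measurable_funX.
  - by move=> x _; rewrite lee_fin sqr_ge0.
by rewrite -Rintegral_integral// ltry.
Qed.

(** The tent is at most 1/e and lives on a ball of measure 2e, whence the factor 2. At Lebesgue
    points of [f] the right-hand side tends to 0. *)
Lemma mollify_near e f y : 0 < e -> L2fun f ->
  ((`|mollify e f y - f y|)%:E <= 2%:E * davg f y e)%E.
Proof.
move=> e0 Lf; have [mf f2] := Lf.
have [mt ti] := L1_tentB y e0.
have fti := L2_mul_integrable Lf (L2_tentB y e0).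
have E : mollify e f y - f y = \int[leb]_x ((f x - f y) * tent e (x - y)).
  rewrite (_ : (fun x => (f x - f y) * tent e (x - y)) =
    (fun x => f x * tent e (x - y) - f y * tent e (x - y))); last first.
    by apply/funext => x; rewrite mulrBl.
  rewrite RintegralTB//; last exact: integrable_realZ.
  rewrite RintegralTZ// (_ : \int[leb]_x tent e (x - y) = 1) ?mulr1//.
  by rewrite /Rintegral integral_tentB.
have ii : leb.-integrable setT (fun x => ((f x - f y) * tent e (x - y))%:E).
  by under eq_fun do rewrite mulrBl; apply: integrable_realB => //; exact: integrable_realZ.
rewrite E EFin_normr_Rintegral//.
apply: (le_trans (le_abse_integral _ _ _)) => //.
  exact: measurable_int ii.
rewrite /davg /iavg (lebesgue_measure_ball _ (ltW e0)).
have K : (2%:E * ((e *+ 2)%:E)^-1 = (e^-1)%:E)%E.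
  rewrite inver mulrn_eq0 (gt_eqF e0)/= -[LHS]EFinM; congr EFin.
  by rewrite -(mulr_natr e); field; exact: lt0r_neq0.
rewrite muleA K.
have mfy : measurable_fun setT (fun x : R => `|f x - f y|).
  by apply: measurableT_comp => //; exact: measurable_funB.
rewrite -ge0_integralZl; last 4 first.
- exact: measurable_ball.
- by apply: measurable_funTS; apply/measurable_EFinP.
- by move=> x _; rewrite abse_ge0.
- by rewrite lee_fin invr_ge0 ltW.
rewrite [leRHS]integral_mkcond; apply: ge0_le_integral => //.
- by apply: measurableT_comp => //; exact: measurable_int ii.
- apply/(measurable_restrictT _ _).1; first exact: measurable_ball.
  by apply: measurable_funTS; apply/measurable_EFinP; exact: measurable_funM.
move=> x _; rewrite patchE; case: ifPn => xb.
  rewrite -EFinM/= lee_fin normrM mulrC (ger0_norm (tent_ge0 _ e0)).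
  by rewrite ler_wpM2r ?tent_le.
rewrite tentE// ifF ?mulr0 ?abse0//.
apply/negbTE; rewrite -leNgt leNgt; apply/negP => xe; move/negP: xb; apply.
by rewrite inE/= /ball/= distrC.
Qed.

Lemma cvg_mollify f : L2fun f ->
  {ae leb, forall y, mollify n.+1%:R^-1 f y @[n --> \oo] --> f y}.
Proof.
move=> Lf; apply: (ae_mono _ (lebesgue_differentiation (L2_locally_integrable Lf))) => y ly.
have inv0 n : 0 < n.+1%:R^-1 :> R by rewrite invr_gt0.
have H : (2%:E * davg f y n.+1%:R^-1)%E @[n --> \oo] --> 0%E.
  rewrite -(mule0 2%:E); apply: cvgeMl => //.
  move/cvge_at_rightP : ly => /(_ (fun n => n.+1%:R^-1)); apply; split => //.
  exact: cvg_harmonic.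
apply/subr_cvg0; apply/norm_cvg0P.
have : (`|mollify n.+1%:R^-1 f y - f y|)%:E @[n --> \oo] --> 0%E.
  apply: (squeeze_cvge _ (cvg_cst 0%E) H).
  by apply: nearW => n; rewrite lee_fin normr_ge0/= mollify_near.
by move/fine_cvgP => [_].
Qed.

End mollification.

Section plancherel.
Context {R : realType}.
Notation leb := (@lebesgue_measure R).
Implicit Types (f gr gi : R -> R) (e x y u : R).

(* The multiplication formula restricted to the test functions whose Fourier
   transform is known to be in L^2: all the integrands are then integrable, so
   that this weaker condition is linear in the triple. *)
Definition plancherel_pair f gr gi : Prop :=
  L2fun gr /\ L2fun gi /\
  forall phi, L1fun phi -> L2fun phi ->
    (L2fun (FT_re phi) ->
      \int[leb]_u (gr u * phi u) = \int[leb]_x (f x * FT_re phi x)) /\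
    (L2fun (FT_im phi) ->
      \int[leb]_u (gi u * phi u) = \int[leb]_x (f x * FT_im phi x)).

Lemma plancherel_FT_pair f gr gi : plancherel_FT f gr gi -> plancherel_pair f gr gi.
Proof.
by move=> [Lr [Li H]]; do 2!split=> //; move=> phi L1 L2; have [] := H phi L1 L2.
Qed.

Lemma L2_sub f g : L2fun f -> L2fun g -> L2fun (fun x => f x - g x).
Proof.
move=> Lf Lg; have := L2_add Lf (L2_scale (-1) Lg).
by under eq_fun do rewrite mulN1r.
Qed.

Lemma plancherel_pairB f gr gi f' gr' gi' : L2fun f -> L2fun f' ->
  plancherel_pair f gr gi -> plancherel_pair f' gr' gi' ->
  plancherel_pair (fun x => f x - f' x) (fun u => gr u - gr' u) (fun u => gi u - gi' u).
Proof.
move=> Lf Lf' [Lr [Li H]] [Lr' [Li' H']]; split; first exact: L2_sub.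
split; first exact: L2_sub.
move=> phi L1 L2; have [Hr Hi] := H phi L1 L2; have [Hr' Hi'] := H' phi L1 L2.
have B g g' h : L2fun g -> L2fun g' -> L2fun h ->
    \int[leb]_x ((g x - g' x) * h x) = \int[leb]_x (g x * h x) - \int[leb]_x (g' x * h x).
  move=> Lg Lg' Lh; under eq_Rintegral do rewrite mulrBl.
  by rewrite RintegralTB//; exact: L2_mul_integrable.
by split=> L; rewrite !B// ?Hr ?Hr' ?Hi ?Hi'.
Qed.

Let normc : R := (Num.sqrt (pi *+ 2))^-1.

Let normc_sq : normc ^+ 2 * pi = 2^-1.
Proof.
have p0 := @pi_gt0 R; have p2 : 0 <= pi *+ 2 :> R by rewrite mulrn_wge0 ?(ltW p0).
by rewrite exprVn (sqr_sqrtr p2) -(mulr_natr pi) invfM mulrAC mulVf ?gt_eqF// mul1r.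
Qed.

Let L12_fejer e (g : R -> R) : measurable_fun setT g -> (forall u, `|g u| <= 1) ->
  L1fun (fun u => fejer e u * g u) /\ L2fun (fun u => fejer e u * g u).
Proof.
move=> mg g1; have L1 : L1fun (fun u => fejer e u * g u).
  split; last exact: integrable_fejerM.
  by apply: measurable_funM => //; exact: measurable_fejer.
split => //; apply: (@L1_bounded_L2 _ _ 1) => // u.
by rewrite normrM mulr_ile1// ger0_norm ?fejer_ge0 ?fejer_le1.
Qed.

Let Rint_fejer_coscos e x y :
  \int[leb]_u (fejer e u * cos (y * u) * cos (u * x)) = pi * (tent e (x - y) + tent e (x + y)).
Proof.
have ic a : leb.-integrable setT (fun u => (fejer e u * cos (a * u))%:E).
  by apply: integrable_fejerM; [exact: measurable_cosM|move=> u; exact: cos_max].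
rewrite (_ : (fun u => _) = (fun u => 2^-1 * (fejer e u * cos ((x - y) * u))
   + 2^-1 * (fejer e u * cos ((x + y) * u)))); last first.
  apply/funext => u; rewrite [(x - y) * u]mulrBl [(x + y) * u]mulrDl cosB cosD (mulrC u).
  by field.
rewrite RintegralTD; [|exact: integrable_realZ|exact: integrable_realZ].
by rewrite !RintegralTZ// !Rintegral_fejer_cos -(mulr_natr pi 2); field.
Qed.

Let Rint_fejer_sinsin e x y :
  \int[leb]_u (fejer e u * sin (y * u) * sin (u * x)) = pi * (tent e (x - y) - tent e (x + y)).
Proof.
have ic a : leb.-integrable setT (fun u => (fejer e u * cos (a * u))%:E).
  by apply: integrable_fejerM; [exact: measurable_cosM|move=> u; exact: cos_max].
rewrite (_ : (fun u => _) = (fun u => 2^-1 * (fejer e u * cos ((x - y) * u))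
   - 2^-1 * (fejer e u * cos ((x + y) * u)))); last first.
  apply/funext => u; rewrite [(x - y) * u]mulrBl [(x + y) * u]mulrDl cosB cosD (mulrC u).
  by field.
rewrite RintegralTB; [|exact: integrable_realZ|exact: integrable_realZ].
by rewrite !RintegralTZ// !Rintegral_fejer_cos -(mulr_natr pi 2); field.
Qed.

Let tent_mul_integrable e y f : 0 < e -> L2fun f ->
  leb.-integrable setT (fun x => (f x * tent e (x - y))%:E).
Proof. by move=> e0 Lf; apply: L2_mul_integrable => //; exact: L2_tentB. Qed.

(** The multiplication formula is tested on [fejer e u * cos (y * u)], whose transform is a pair of
    tents centred at y and -y: pairing it with [f] yields averages of [f] near these two points. The
    constants combine through [normc_sq]. *)
Let FT_re_fejer e f gr gi y : 0 < e -> L2fun f -> plancherel_pair f gr gi ->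
  FT_re (fun u => fejer e u * gr u) y = 2^-1 * (mollify e f y + mollify e f (- y)).
Proof.
move=> e0 Lf [Lr [Li H]].
have [L1 L2] := @L12_fejer e _ (measurable_cosM y) (fun u => cos_max (y * u)).
have FE : FT_re (fun u => fejer e u * cos (y * u)) =
    (fun x => normc * pi * (tent e (x - y) + tent e (x - - y))).
  by apply/funext => x; rewrite /FT_re -/normc Rint_fejer_coscos opprK mulrA.
have [E _] := H _ L1 L2; rewrite /FT_re -/normc.
have {}E := E ltac:(by rewrite FE; apply/L2_scale/L2_add; exact: L2_tentB).
rewrite (_ : \int[leb]_u (fejer e u * gr u * cos (u * y)) =
   \int[leb]_u (gr u * (fejer e u * cos (y * u)))); last first.
  by apply: eq_Rintegral => u _; rewrite (_ : u * y = y * u :> R); [ring|exact: mulrC].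
rewrite E (_ : (fun x => f x * FT_re _ x) = (fun x => normc * pi * (f x * tent e (x - y))
   + normc * pi * (f x * tent e (x - - y)))); last first.
  by rewrite FE; apply/funext => x; ring.
rewrite RintegralTD; last 2 first.
- by apply: integrable_realZ; exact: tent_mul_integrable.
- by apply: integrable_realZ; exact: tent_mul_integrable.
rewrite !RintegralTZ; last 2 first.
- exact: tent_mul_integrable.
- exact: tent_mul_integrable.
by rewrite -mulrDr 2!mulrA -expr2 normc_sq.
Qed.

Let FT_im_fejer e f gr gi y : 0 < e -> L2fun f -> plancherel_pair f gr gi ->
  FT_im (fun u => fejer e u * gi u) y = 2^-1 * (mollify e f y - mollify e f (- y)).
Proof.
move=> e0 Lf [Lr [Li H]].
have [L1 L2] := @L12_fejer e _ (measurable_sinM y) (fun u => sin_max (y * u)).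
have FE : FT_im (fun u => fejer e u * sin (y * u)) =
    (fun x => - (normc * pi) * (tent e (x - y) - tent e (x - - y))).
  by apply/funext => x; rewrite /FT_im -/normc Rint_fejer_sinsin opprK mulrA mulNr.
have [_ E] := H _ L1 L2; rewrite /FT_im -/normc.
have {}E := E ltac:(by rewrite FE; apply/L2_scale/L2_sub; exact: L2_tentB).
rewrite (_ : \int[leb]_u (fejer e u * gi u * sin (u * y)) =
   \int[leb]_u (gi u * (fejer e u * sin (y * u)))); last first.
  by apply: eq_Rintegral => u _; rewrite (_ : u * y = y * u :> R); [ring|exact: mulrC].
rewrite E (_ : (fun x => f x * FT_im _ x) = (fun x => - (normc * pi) * (f x * tent e (x - y))
   - - (normc * pi) * (f x * tent e (x - - y)))); last first.
  by rewrite FE; apply/funext => x; ring.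
rewrite RintegralTB; last 2 first.
- by apply: integrable_realZ; exact: tent_mul_integrable.
- by apply: integrable_realZ; exact: tent_mul_integrable.
rewrite !RintegralTZ; last 2 first.
- exact: tent_mul_integrable.
- exact: tent_mul_integrable.
rewrite -/(mollify e f y) -/(mollify e f (- y)) -normc_sq; ring.
Qed.

(* The multiplication formula is applied to [fejer e * gr] and [fejer e * gi]: the real
   part of the transform of the former is the even part of [mollify e f], the imaginary
   part of the transform of the latter is its odd part. *)
Lemma mollify_energy e f gr gi : 0 < e -> L2fun f -> plancherel_pair f gr gi ->
  \int[leb]_x (f x * mollify e f x) =
  \int[leb]_u (fejer e u * (gr u ^+ 2 + gi u ^+ 2)).
Proof.
move=> e0 Lf PF; have [Lr [Li H]] := PF.
have Lm := L2_mollify e0 Lf; have Lm' := L2_opp Lm.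
have f1 u : `|fejer e u| <= 1 by rewrite ger0_norm ?fejer_ge0 ?fejer_le1.
have L12 g : L2fun g -> L1fun (fun u => fejer e u * g u) /\ L2fun (fun u => fejer e u * g u).
  move=> Lg; split; last exact: L2_mul_bounded (measurable_fejer e) f1 Lg.
  have [_ L2f] := @L12_fejer e (cst 1) (measurable_cst _) (fun u => ltac:(by rewrite normr1)).
  have {}L2f : L2fun (fejer e) by move: L2f; under eq_fun do rewrite mulr1.
  split; last exact: L2_mul_integrable.
  by apply: measurable_funM; [exact: measurable_fejer|case: Lg].
have [[L1r L2r] [L1i L2i]] := (L12 _ Lr, L12 _ Li).
(* The side condition of [plancherel_pair] holds because the transform has just been identified with
   half the sum of a mollified function and its reflection, which is in L^2; the odd part is treated
   in the same way. *)
have [/(_ ltac:(rewrite (funext (fun y => FT_re_fejer y e0 Lf PF));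
  by apply/L2_scale/L2_add)) Er _] := H _ L1r L2r.
have [_ /(_ ltac:(rewrite (funext (fun y => FT_im_fejer y e0 Lf PF));
  by apply/L2_scale/L2_sub)) Ei] := H _ L1i L2i.
have ifm := L2_mul_integrable Lf Lm; have ifm' := L2_mul_integrable Lf Lm'.
have {}Er : \int[leb]_u (fejer e u * gr u ^+ 2) =
   \int[leb]_x (2^-1 * (f x * mollify e f x) + 2^-1 * (f x * mollify e f (- x))).
  transitivity (\int[leb]_u (gr u * (fejer e u * gr u))).
    by apply: eq_Rintegral => u _; rewrite mulrCA.
  rewrite Er; apply: eq_Rintegral => x _.
  by rewrite (FT_re_fejer _ e0 Lf PF); ring.
have {}Ei : \int[leb]_u (fejer e u * gi u ^+ 2) =
   \int[leb]_x (2^-1 * (f x * mollify e f x) - 2^-1 * (f x * mollify e f (- x))).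
  transitivity (\int[leb]_u (gi u * (fejer e u * gi u))).
    by apply: eq_Rintegral => u _; rewrite mulrCA.
  rewrite Ei; apply: eq_Rintegral => x _.
  by rewrite (FT_im_fejer _ e0 Lf PF); ring.
have ir := L2_mul_integrable L2r Lr; have ii := L2_mul_integrable L2i Li.
rewrite (_ : (fun u => fejer e u * (gr u ^+ 2 + gi u ^+ 2)) =
   (fun u => fejer e u * gr u ^+ 2 + fejer e u * gi u ^+ 2)); last first.
  by apply/funext => u; rewrite mulrDr.
rewrite RintegralTD; last 2 first.
- by under eq_fun do rewrite expr2 mulrA.
- by under eq_fun do rewrite expr2 mulrA.
(* The terms in [mollify e f (- x)] cancel between the even and the odd part. *)
rewrite Er Ei RintegralTD ?RintegralTB ?RintegralTZ//; try exact: integrable_realZ.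
by field.
Qed.

(** The quotients sin x / x are the difference quotients of sin at 0, taken along a sequence of
    nonzero points. *)
Let cvg_fejer1 u : u != 0 -> fejer n.+1%:R^-1 u @[n --> \oo] --> (1 : R).
Proof.
move=> u0.
have E n : fejer n.+1%:R^-1 u = (sin (n.+1%:R^-1 * (u / 2)) / (n.+1%:R^-1 * (u / 2))) ^+ 2.
  by rewrite fejerE ?mulrA// invr_eq0 pnatr_eq0.
under eq_fun do rewrite E.
apply: (@cvg_to_eq _ _ _ _ (1 ^+ 2 : R)); first by rewrite expr1n.
apply: (@cvg_comp _ _ _ _ (fun x : R => x ^+ 2) _ (nbhs (1:R))); last exact: sqr_continuous.
have [/cvg_ex[/= l dl] dE] := @is_derive_sin R 0.
have l1 : l = 1 by rewrite -(@cos0 R) -dE; apply/esym/cvg_lim => //; exact: dl.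
have z0 : (forall n : nat, n.+1%:R^-1 * (u / 2) != 0 :> R) /\
    n.+1%:R^-1 * (u / 2) @[n --> \oo] --> (0 : R).
  split => [n|]; first by rewrite !mulf_neq0 ?invr_eq0 ?pnatr_eq0.
  apply: (@cvg_to_eq _ _ _ _ (0 * (u / 2))); first by rewrite mul0r.
  by apply: cvgMl; exact: cvg_harmonic.
move/cvgr_dnbhsP : dl => /(_ _ z0); rewrite l1; apply: cvg_trans.
apply: near_eq_cvg; apply: nearW => n /=.
by rewrite sin0 subr0 addr0 /GRing.scale/= mulr1 mulrC.
Qed.

Let add_le2 (a b c : R) : b <= a -> a + b + 2 * c <= 2 * a + 2 * c.
Proof. lra. Qed.

Let half_le (a b c : R) : b <= a -> 0 <= a + b - 2 * c -> c <= a.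
Proof. lra. Qed.

(** By [mollify_energy] and dominated convergence, the inner product [J n] of [f] with its
    mollification tends to the right-hand side [G]. Mollification contracts the norm and converges
    almost everywhere; these two facts identify the limit through one inequality in each
    direction. *)
Theorem plancherel_norm f gr gi : L2fun f -> plancherel_pair f gr gi ->
  \int[leb]_x (f x ^+ 2) = \int[leb]_u (gr u ^+ 2 + gi u ^+ 2).
Proof.
move=> Lf PF; have [Lr [Li _]] := PF; have [mf f2] := Lf.
have [mr r2] := Lr; have [mi i2] := Li.
pose e_ n : R := n.+1%:R^-1; have e0 n : 0 < e_ n by rewrite invr_gt0.
pose J n := \int[leb]_x (f x * mollify (e_ n) f x).
pose G := \int[leb]_u (gr u ^+ 2 + gi u ^+ 2).
pose S n := \int[leb]_x (mollify (e_ n) f x ^+ 2).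
have g2 := integrable_realD r2 i2.
have Lm n := L2_mollify (e0 n) Lf.
have fm n := L2_mul_integrable Lf (Lm n).
have S_le n : S n <= \int[leb]_x (f x ^+ 2).
  rewrite -lee_fin !Rintegral_integral//; last by case: (Lm n).
  exact: integral_mollify_sq_le.
have JG : J n @[n --> \oo] --> G.
  have [] := @dominated_convergence _ _ _ leb setT measurableT
    (fun n u => (fejer (e_ n) u * (gr u ^+ 2 + gi u ^+ 2))%:E)
    (fun u => (gr u ^+ 2 + gi u ^+ 2)%:E) (fun u => (gr u ^+ 2 + gi u ^+ 2)%:E).
  - move=> n; apply/measurable_EFinP; apply: measurable_funM.
      exact: measurable_fejer.
    by apply: measurable_funD; exact: measurable_funX.
  - by apply/measurable_EFinP; apply: measurable_funD; exact: measurable_funX.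
  - exists [set 0]; split => //; first exact: lebesgue_measure_set1.
    move=> u /= nu; apply: contrapT => u0; apply: nu => _.
    apply: cvg_EFin; first exact: nearW.
    apply: (@cvg_to_eq _ _ _ _ (1 * (gr u ^+ 2 + gi u ^+ 2))); first by rewrite mul1r.
    by apply: cvgMl; apply: cvg_fejer1; apply/eqP.
  - exact: g2.
  - apply: aeW => u n _; rewrite lee_fin ger0_norm.
      by rewrite ler_piMl ?fejer_le1// addr_ge0 ?sqr_ge0.
    by rewrite mulr_ge0 ?fejer_ge0// addr_ge0 ?sqr_ge0.
  move=> _ _ H; rewrite (_ : J = (fun n => \int[leb]_u (fejer (e_ n) u * (gr u ^+ 2 + gi u ^+ 2)))).
    by apply: fine_cvg; rewrite Rintegral_integral.
  by apply/funext => n; rewrite /J (mollify_energy (e0 n) Lf PF).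
apply/eqP; rewrite eq_le; apply/andP; split.
(* Fatou for the squares of f + m_n, where m_n is the mollification: 4 |f|^2 is at most the limit of
   2 |f|^2 + 2 J n, hence |f|^2 <= G. *)
- have : (\int[leb]_x (4 * f x ^+ 2)%:E <= (2 * \int[leb]_x (f x ^+ 2) + 2 * G)%:E)%E; last first.
    rewrite -Rintegral_integral; last exact: integrable_realZ.
    by rewrite RintegralTZ// lee_fin /G; lra.
  rewrite (_ : (fun x => (4 * f x ^+ 2)%:E) = (fun x => ((f x + f x) ^+ 2)%:E)); last first.
    by apply/funext => x; congr EFin; ring.
  apply: (@fatou_ae_le _ _ _ leb (fun n x => (f x + mollify (e_ n) f x) ^+ 2)
    (fun x => (f x + f x) ^+ 2) (fun n => 2 * \int[leb]_x (f x ^+ 2) + 2 * J n)).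
  + by move=> n; apply: measurable_funX; apply: measurable_funD => //; exact: measurable_mollify.
  + by apply: measurable_funX; exact: measurable_funD.
  + by move=> n x; exact: sqr_ge0.
  + by move=> x; exact: sqr_ge0.
  + apply: (ae_mono _ (cvg_mollify Lf)) => x cx.
    apply: (@cvg_comp _ _ _ _ (fun y : R => y ^+ 2) _ (nbhs (f x + f x))).
      by apply: cvgD => //; exact: cvg_cst.
    exact: sqr_continuous.
  + move=> n.
    rewrite (_ : (fun x => ((f x + mollify (e_ n) f x) ^+ 2)%:E) = (fun x =>
       (f x ^+ 2 + mollify (e_ n) f x ^+ 2 + 2 * (f x * mollify (e_ n) f x))%:E)); last first.
      by apply/funext => x; congr EFin; ring.
    have [_ m2] := Lm n; have i1 := integrable_realD f2 m2.
    have i3 := integrable_realZ 2 (fm n).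
    rewrite -Rintegral_integral; last exact: integrable_realD.
    rewrite lee_fin RintegralTD// RintegralTD// RintegralTZ// -/(J n) -/(S n).
    exact: add_le2 (S_le n).
  + by apply: cvgD; [exact: cvg_cst|exact: cvgMr].
rewrite -/G -(cvg_lim _ JG)//; apply: limr_le; first by apply/cvg_ex; exists G.
apply: nearW => n; have [_ m2] := Lm n.
(* Conversely 2 J n <= |f|^2 + S n <= 2 |f|^2 for every n, hence G <= |f|^2. *)
have : 0 <= \int[leb]_x (f x ^+ 2 + mollify (e_ n) f x ^+ 2 - 2 * (f x * mollify (e_ n) f x)).
  apply: Rintegral_ge0 => x _; have := sqr_ge0 (f x - mollify (e_ n) f x); nra.
rewrite RintegralTB; [|exact: integrable_realD|exact: integrable_realZ].
rewrite RintegralTD// RintegralTZ// -/(J n) -/(S n).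
exact: half_le (S_le n).
Qed.

End plancherel.

(** * Uniqueness of characteristic functions and the normal law *)

Section expectation.
Context {R : realType} d {T : measurableType d} (P : probability T R).

Lemma bounded_integrable_prob (g : T -> R) (c : R) : measurable_fun setT g ->
  (forall w, `|g w| <= c) -> P.-integrable setT (fun w => (g w)%:E).
Proof.
move=> mg gc; apply: (@le_integrable_real _ _ _ P g (cst c)) => //.
exact: finite_measure_integrable_cst.
Qed.

End expectation.

Section trapezoid.
Context {R : realType}.

(* Equal to [1] on [-e, e] and to [0] outside [-(e + 1/(n+1)), e + 1/(n+1)]. *)
Definition trapezoid (e : R) n x : R := n.+1%:R * ((e + n.+1%:R^-1) ^+ 2 * tent (e + n.+1%:R^-1) x - e ^+ 2 * tent e x).

Lemma trapezoidE e n x : 0 < e ->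
  trapezoid e n x = if `|x| <= e then 1 else Num.max 0 (1 - n.+1%:R * (`|x| - e)).
Proof.
move=> e0; have n0 : 0 < n.+1%:R^-1 :> R by rewrite invr_gt0.
have E f : 0 < f -> f ^+ 2 * tent f x = if `|x| < f then f - `|x| else 0.
  move=> f0; rewrite tentE//; case: ltP => _; last by rewrite mulr0.
  by rewrite mulrC divfK// expf_neq0// gt_eqF.
have nn : n.+1%:R * n.+1%:R^-1 = 1 :> R by rewrite mulfV// pnatr_eq0.
rewrite /trapezoid !E//; last exact: addr_gt0.
case: (leP `|x| e) => xe.
  rewrite (_ : `|x| < e + n.+1%:R^-1); last by rewrite (le_lt_trans xe)// ltrDl.
  case: ltgtP xe => // [xe _|-> _].
    by rewrite (_ : e + n.+1%:R^-1 - `|x| - (e - `|x|) = n.+1%:R^-1)//; ring.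
  by rewrite subr0 addrC addKr.
rewrite (_ : `|x| < e = false); last by apply/negbTE; rewrite -leNgt ltW.
have -> : 1 - n.+1%:R * (`|x| - e) = n.+1%:R * (e + n.+1%:R^-1 - `|x|).
  by rewrite [in RHS]addrAC [in RHS]mulrDr nn; ring.
rewrite subr0; case: ltP => xn.
  by rewrite max_r// mulr_ge0// subr_ge0 ltW.
by rewrite mulr0 max_l// mulr_ge0_le0// subr_le0.
Qed.

End trapezoid.

Section characteristic_function.
Context {R : realType} d {T : measurableType d} (P : probability T R) (Z : T -> R).
Hypothesis mZ : measurable_fun setT Z.
Notation leb := (@lebesgue_measure R).

Let mcos u : measurable_fun setT (fun w => cos (u * Z w)).
Proof. by apply: (measurableT_comp (measurable_cosM u)). Qed.

Let msin u : measurable_fun setT (fun w => sin (u * Z w)).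
Proof. by apply: (measurableT_comp (measurable_sinM u)). Qed.

Let icos u : P.-integrable setT (fun w => (cos (u * Z w))%:E).
Proof. by apply: (@bounded_integrable_prob _ _ _ _ _ 1) => // w; exact: cos_max. Qed.

Let isin u : P.-integrable setT (fun w => (sin (u * Z w))%:E).
Proof. by apply: (@bounded_integrable_prob _ _ _ _ _ 1) => // w; exact: sin_max. Qed.

(** The bound comes from the representation of the tent as a cosine integral of the integrable
    [fejer e], which holds for all e alike. *)
Lemma integrable_tent_comp e y : P.-integrable setT (fun w => (tent e (Z w - y))%:E).
Proof.
have mt : measurable_fun setT (fun w => tent e (Z w - y)).
  by apply: (measurableT_comp (measurable_tent e)); exact: measurable_funB.
have tb w : `|tent e (Z w - y)| <= (pi *+ 2)^-1 * \int[leb]_u fejer e u.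
  have p2 : 0 < pi *+ 2 :> R by rewrite mulrn_wgt0// pi_gt0.
  have -> : tent e (Z w - y) = (pi *+ 2)^-1 * \int[leb]_u (fejer e u * cos ((Z w - y) * u)).
    by rewrite Rintegral_fejer_cos mulrA mulVf ?mul1r ?gt_eqF.
  rewrite normrM gtr0_norm ?invr_gt0// ler_wpM2l ?invr_ge0 ?(ltW p2)//.
  have ic : leb.-integrable setT (fun u => (fejer e u * cos ((Z w - y) * u))%:E).
    by apply: integrable_fejerM; [exact: measurable_cosM|move=> u; exact: cos_max].
  apply: (le_trans (le_normr_Rintegral measurableT ic)).
  apply: le_Rintegral => //.
  - exact: (integrable_norm ic).
  - exact: integrable_fejer.
  - by move=> u _; rewrite normrM ger0_norm ?fejer_ge0// ler_piMr ?fejer_ge0 ?cos_max.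
exact: bounded_integrable_prob mt tb.
Qed.

(** Fubini in the cosine representation of the tent; the subtraction formula for cos separates Z
    from y. Thus the characteristic function determines the expectation of every translated tent. *)
Lemma expectation_tent e y :
  pi *+ 2 * \int[P]_w tent e (Z w - y) =
  \int[leb]_u (fejer e u * (cos (u * y) * \int[P]_w cos (u * Z w)
                            + sin (u * y) * \int[P]_w sin (u * Z w))).
Proof.
rewrite -RintegralTZ; last exact: integrable_tent_comp.
pose k (z : T * R) := (fejer e z.2 * cos ((Z z.1 - y) * z.2))%:E.
have mk : measurable_fun setT k.
  apply/measurable_EFinP; apply: measurable_funM.
    exact: measurableT_comp (measurable_fejer e) measurable_snd.
  apply: (measurableT_comp (f := @cos R)).
    by apply: continuous_measurable_fun; exact: continuous_cos.
  apply: measurable_funM; last exact: measurable_snd.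
  by apply: measurable_funB => //; exact: measurableT_comp mZ measurable_fst.
have ik : (P \x leb)%E.-integrable setT k.
  apply/(integrable12ltyP P leb mk).
  apply: (@le_lt_trans _ _ (\int[P]_w \int[leb]_u (fejer e u)%:E)%E).
    apply: ge0_le_integral => //.
    - by move=> w _; apply: integral_ge0.
    - have mn : measurable_fun setT (abse \o k) by exact: measurableT_comp.
      exact: (measurable_fun_fubini_tonelli_F (m2 := leb) (abse \o k) mn (fun z => abse_ge0 _)).
    - move=> w _; apply: ge0_le_integral => //.
      + apply: measurableT_comp => //; exact: (measurableT_comp mk (pair1_measurable w)).
      + by apply/measurable_EFinP; exact: measurable_fejer.
      + move=> u _; rewrite /k/= lee_fin normrM ger0_norm ?fejer_ge0//.
        by rewrite ler_piMr ?fejer_ge0 ?cos_max.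
  rewrite -Rintegral_integral; last exact: integrable_fejer.
  set c := Rintegral _ _ _.
  have := integral_cst P measurableT c%:E; rewrite /cst => ->.
  by rewrite [X in (_ * X)%E](@probability_setT _ _ _ P) mule1 ltry.
have E1 w : pi *+ 2 * tent e (Z w - y) = fine (\int[leb]_u k (w, u)).
  by rewrite -Rintegral_fejer_cos.
have F := Fubini ik.
transitivity (fine (\int[P]_w \int[leb]_u k (w, u))).
  congr fine; apply: eq_integral => w _; rewrite E1 fineK//.
  apply: integrable_fin_num => //.
  have i (x : R) : leb.-integrable setT (fun u => (fejer e u * cos (x * u))%:E).
    by apply: integrable_fejerM; [exact: measurable_cosM|move=> u; exact: cos_max].
  exact: (i (Z w - y)).
rewrite F; congr fine; apply: eq_integral => u _.
rewrite -/(\int[P]_w cos (u * Z w)) -/(\int[P]_w sin (u * Z w)).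
have -> : (fun w => k (w, u)) = (fun w => (fejer e u * (cos (u * y) * cos (u * Z w)
   + sin (u * y) * sin (u * Z w)))%:E).
  apply/funext => w; rewrite /k/=; congr EFin; congr (_ * _).
  by rewrite mulrBl cosB (mulrC _ u) (mulrC y); ring.
have ia := integrable_realZ (cos (u * y)) (icos u).
have ib := integrable_realZ (sin (u * y)) (isin u).
rewrite -Rintegral_integral; last by apply: integrable_realZ; exact: integrable_realD.
by rewrite RintegralTZ ?RintegralTD ?RintegralTZ//; exact: integrable_realD.
Qed.

Lemma cvg_expectation_trapezoid e y : 0 < e ->
  (\int[P]_w trapezoid e n (Z w - y)) @[n --> \oo] --> fine (P (Z @^-1` `[y - e, y + e])).
Proof.
move=> e0.
have mA : measurable (Z @^-1` `[y - e, y + e]) by rewrite -[X in measurable X]setTI; exact: mZ.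
have mtrapezoid n : measurable_fun setT (fun w => trapezoid e n (Z w - y)).
  have ms f : measurable_fun setT (fun w => tent f (Z w - y)).
    by apply: (measurableT_comp (measurable_tent f)); exact: measurable_funB.
  by apply: measurable_funM => //; apply: measurable_funB; apply: measurable_funM.
have inA w : (Z @^-1` `[y - e, y + e]) w <-> `|Z w - y| <= e.
  by rewrite /= in_itv/= ler_distl.
have [] := @dominated_convergence _ _ _ P setT measurableT
   (fun n w => (trapezoid e n (Z w - y))%:E) (fun w => (\1_(Z @^-1` `[y - e, y + e]) w)%:E) (cst 1%E).
- by move=> n; exact/measurable_EFinP.
- exact/measurable_EFinP/measurable_indic.
- apply: aeW => w _; apply: cvg_EFin; first exact: nearW.
  under eq_fun do rewrite trapezoidE//.
  rewrite indicE; case: leP => xe.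
    by rewrite mem_set; [exact: cvg_cst|exact/inA].
  rewrite memNset; last by move/inA; rewrite leNgt xe.
  apply: cvg_near_cst; near=> n.
  rewrite /= max_l// subr_le0 -ler_pdivrMr ?subr_gt0// mul1r; apply: ltW.
  rewrite (@lt_le_trans _ _ n%:R) ?ler_nat//.
  by near: n; exact: nbhs_infty_gtr.
- exact: finite_measure_integrable_cst.
- apply: aeW => w n _ /=; rewrite lee_fin trapezoidE//; case: ifPn => [_|]; first by rewrite normr1.
  rewrite -ltNge => xe; rewrite ger0_norm ?le_max ?lexx// ge_max ler01/=.
  by rewrite lerBlDr lerDl mulr_ge0// subr_ge0 ltW.
move=> _ _; rewrite integral_indic// setIT => H.
by apply: fine_cvg; rewrite fineK// fin_num_measure.
Unshelve. all: end_near. Qed.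

End characteristic_function.

Section characteristic_function_unique.
Context {R : realType} d1 {T1 : measurableType d1} (P1 : probability T1 R) (Z1 : T1 -> R)
  d2 {T2 : measurableType d2} (P2 : probability T2 R) (Z2 : T2 -> R).
Hypothesis mZ1 : measurable_fun setT Z1.
Hypothesis mZ2 : measurable_fun setT Z2.
Hypothesis Ecos : forall u, \int[P1]_w cos (u * Z1 w) = \int[P2]_w cos (u * Z2 w).
Hypothesis Esin : forall u, \int[P1]_w sin (u * Z1 w) = \int[P2]_w sin (u * Z2 w).

Let tent_eq e y : \int[P1]_w tent e (Z1 w - y) = \int[P2]_w tent e (Z2 w - y).
Proof.
have p2 : pi *+ 2 != 0 :> R by rewrite gt_eqF// mulrn_wgt0// pi_gt0.
apply: (mulfI p2); rewrite !expectation_tent//; apply: eq_Rintegral => u _.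
by rewrite Ecos Esin.
Qed.

Let trapezoid_eq e n y :
  \int[P1]_w trapezoid e n (Z1 w - y) = \int[P2]_w trapezoid e n (Z2 w - y).
Proof.
have i1 f := integrable_tent_comp P1 mZ1 f y.
have i2 f := integrable_tent_comp P2 mZ2 f y.
have z1 c f := integrable_realZ c (i1 f).
have z2 c f := integrable_realZ c (i2 f).
rewrite !RintegralTZ; [|exact: integrable_realB..].
by rewrite !RintegralTB// !RintegralTZ// !tent_eq.
Qed.

Let itvcc_eq a b : a < b -> P1 (Z1 @^-1` `[a, b]) = P2 (Z2 @^-1` `[a, b]).
Proof.
move=> ab; pose e := (b - a) / 2; pose y := (a + b) / 2.
have e0 : 0 < e by rewrite divr_gt0// subr_gt0.
have -> : a = y - e by rewrite /y /e; field.
have -> : b = y + e by rewrite /y /e; field.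
have m1 : measurable (Z1 @^-1` `[y - e, y + e]) by rewrite -[X in measurable X]setTI; exact: mZ1.
have m2 : measurable (Z2 @^-1` `[y - e, y + e]) by rewrite -[X in measurable X]setTI; exact: mZ2.
have c1 := cvg_expectation_trapezoid (P := P1) mZ1 (y := y) e0.
have := cvg_expectation_trapezoid mZ2 (y := y) e0 (P := P2).
under eq_fun do rewrite -trapezoid_eq.
move=> /(cvg_unique (@Rhausdorff R) c1) H.
by rewrite -[LHS]fineK ?fin_num_measure// H// fineK ?fin_num_measure.
Qed.

Let itvoc_eq a b : P1 (Z1 @^-1` `]a, b]) = P2 (Z2 @^-1` `]a, b]).
Proof.
have [ba|ab] := leP b a; first by rewrite set_itv_ge ?bnd_simp -?leNgt// !preimage_set0 !measure0.
(* Closed intervals increasing to []a, b]]; [n.+2] keeps each of them nondegenerate, as [itvcc_eq]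
   requires. *)
pose A n := `[a + (b - a) / n.+2%:R, b]%classic : set R.
have ba0 : 0 < b - a by rewrite subr_gt0.
have an n : a + (b - a) / n.+2%:R < b.
  by rewrite -ltrBrDl gtr_pMr// invf_lt1// ltr1n.
have -> : `]a, b]%classic = \bigcup_n A n.
  apply/seteqP; split=> x /=; rewrite ?in_itv/=.
    move=> /andP[ax xb]; have xa0 : 0 < x - a by rewrite subr_gt0.
    have [n _ nn] := nbhs_infty_gtr ((b - a) / (x - a)).
    exists n => //=; rewrite /A/= in_itv/= xb andbT -lerBrDl ler_pdivrMr// mulrC.
    rewrite -ler_pdivrMr// ltW// (lt_le_trans (nn n _))//= ler_nat.
    by rewrite -addn2 leq_addr.
  move=> [n _]; rewrite /A/= in_itv/= => /andP[ax ->]; rewrite andbT.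
  by rewrite (lt_le_trans _ ax)// ltrDl divr_gt0.
have ndA : nondecreasing_seq A.
  apply/nondecreasing_seqP => n; apply/subsetPset => x.
  rewrite /A/= !in_itv/= => /andP[ax ->]; rewrite andbT (le_trans _ ax)//.
  by rewrite lerD2l ler_pM2l// lef_pV2 ?posrE// ler_nat.
have C d (T : measurableType d) (P : probability T R) (Z : T -> R) :
    measurable_fun setT Z ->
    P (Z @^-1` A n) @[n --> \oo] --> P (Z @^-1` \bigcup_n A n).
  move=> mZ; rewrite preimage_bigcup.
  have mA n : measurable (Z @^-1` A n).
    by rewrite -[X in measurable X]setTI; apply: mZ => //; exact: measurable_itv.
  apply: (nondecreasing_cvg_mu (F := fun n => Z @^-1` A n)) => //.
    exact: bigcup_measurable.
  move=> m n /ndA/subsetPset mn; apply/subsetPset.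
  by move=> w; exact: mn.
have := C _ _ P1 _ mZ1; under eq_fun do rewrite itvcc_eq//.
by move/cvg_unique => /(_ (@ereal_hausdorff R) _ (C _ _ P2 _ mZ2)).
Qed.

(** Equality passes from tents to trapezoids, in the limit to closed intervals, then to half-open
    ones; these are stable under intersection and generate the Borel sets. *)
Lemma characteristic_function_unique A : measurable A -> P1 (Z1 @^-1` A) = P2 (Z2 @^-1` A).
Proof.
move=> mA.
pose m1 := measure_function_pushforward__canonical__measure_function_Measure P1 mZ1.
pose m2 := measure_function_pushforward__canonical__measure_function_Measure P2 mZ2.
rewrite -[LHS]/(m1 A) -[RHS]/(m2 A).
apply: (measure_unique (@ocitv R) (fun k => `](- k%:R), k%:R]%classic)) => //.
- exact: ocitvI.
- by move=> k; exact: is_ocitv.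
- apply/seteqP; split=> // x _; have [n _ nn] := nbhs_infty_gtr `|x|.
  exists n => //=; rewrite in_itv/=; have := nn n (leqnn n).
  by rewrite ltr_norml => /andP[-> /ltW].
- by move=> _ [[a b] _ <-]; have := itvoc_eq a b.
- move=> k; rewrite (@le_lt_trans _ _ 1%E) ?ltry//; apply: probability_le1.
  by rewrite -[X in measurable X]setTI; apply: mZ1 => //; exact: measurable_itv.
Qed.

End characteristic_function_unique.

Section integral_normal_prob.
Context {R : realType}.
Notation leb := (@lebesgue_measure R).

(** The Radon-Nikodym derivative of [normal_prob] is almost everywhere its density, as both have the
    same integral over every measurable set. *)
Lemma integral_normal_prob (g : R -> R) (c : R) : measurable_fun setT g ->
  (forall x, `|g x| <= c) ->
  \int[normal_prob 0 1]_x g x = \int[leb]_x (normal_pdf 0 1 x * g x).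
Proof.
move=> mg gc; congr fine.
rewrite -(Radon_Nikodym_change_of_variables (@normal_prob_dominates R 0 1))//=; last first.
  exact: (@bounded_integrable_prob _ _ _ (normal_prob 0 1) g c mg gc).
under [RHS]eq_integral do rewrite mulrC EFinM.
have dom := @normal_prob_dominates R 0 1.
apply: ae_eq_integral => //.
- apply: emeasurable_funM; first exact/measurable_EFinP.
  by apply: (measurable_int leb); apply: Radon_Nikodym_integrable; exact: dom.
- by apply: emeasurable_funM; apply/measurable_EFinP => //; exact: measurable_normal_pdf.
- apply: ae_eqe_mul2l; rewrite Radon_NikodymE /=.
  case: cid => /= h [h1 h2 h3].
  apply: integral_ae_eq => //=.
  + by apply/measurable_EFinP; exact: measurable_normal_pdf.
  + by move=> A _ mA; rewrite -h3.
Qed.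

End integral_normal_prob.

Section integral_derivative.
Context {R : realType}.
Notation leb := (@lebesgue_measure R).

Lemma Rintegral_derive_eq0 (F f : R -> R) : (forall x : R, is_derive x 1 F (f x)) ->
  continuous f -> leb.-integrable setT (fun x => (f x)%:E) ->
  F n%:R @[n --> \oo] --> (0 : R) -> F (- n%:R) @[n --> \oo] --> (0 : R) ->
  \int[leb]_x f x = 0.
Proof.
move=> dF cf fi Fp Fn.
have cF : continuous F.
  move=> x; apply: differentiable_continuous; apply/derivable1_diffP.
  by have [] := dF x.
have mf : measurable_fun setT f by exact: continuous_measurable_fun.
pose A (n : nat) := `[- n.+1%:R, n.+1%:R]%classic : set R.
have E n : (\int[leb]_(x in A n) (f x)%:E = (F n.+1%:R - F (- n.+1%:R))%:E)%E.
  rewrite EFinB; apply: continuous_FTC2.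
  - by rewrite (@lt_trans _ _ 0)// oppr_lt0.
  - exact: continuous_subspaceT.
  - split.
    + by move=> x _; have [] := dF x.
    + by apply: cvg_at_right_filter; exact: cF.
    + by apply: cvg_at_left_filter; exact: cF.
  - by move=> x _; rewrite derive1E; have [_ ->] := dF x.
have [] := @dominated_convergence _ _ _ leb setT measurableT
   (fun n x => ((f x)%:E * (\1_(A n) x)%:E)%E) (fun x => (f x)%:E) (fun x => `|(f x)%:E|%E).
- move=> n; apply: emeasurable_funM; apply/measurable_EFinP => //.
  by apply: measurable_indic; exact: measurable_itv.
- exact/measurable_EFinP.
- apply: aeW => x _; apply: cvg_near_cst; near=> n.
  rewrite indicE mem_set ?mule1//= /A/= in_itv/= -ler_norml.
  rewrite (@le_trans _ _ n%:R) ?ler_nat//.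
  by near: n; exact: nbhs_infty_ger.
- exact: integrable_abse.
- apply: aeW => x n _; rewrite /= lee_fin normrM ler_piMr// indicE.
  by case: (_ \in _); rewrite /= ?normr1 ?normr0.
move=> _ _ H.
have {}H : (F n.+1%:R - F (- n.+1%:R))%:E @[n --> \oo] --> (\int[leb]_x (f x)%:E)%E.
  apply: cvg_trans H; apply: near_eq_cvg; apply: nearW => n.
  by rewrite -E [RHS]integral_mkcond; apply: eq_integral => x _;
     rewrite epatch_indic.
have F0 : (F n.+1%:R - F (- n.+1%:R))%:E @[n --> \oo] --> (0%:E : \bar R).
  apply: cvg_EFin; first exact: nearW.
  apply: (@cvg_to_eq _ _ _ _ (0 - 0 : R)); first by rewrite subr0.
  by apply: cvgB; rewrite (cvg_shiftS (fun n => F _)).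
by rewrite /Rintegral (cvg_unique (@ereal_hausdorff R) H F0).
Unshelve. all: end_near. Qed.

End integral_derivative.

Section normal_characteristic_function.
Context {R : realType}.
Notation leb := (@lebesgue_measure R).

Let gk (x : R) := expR (- (x ^+ 2 / 2)).

Let gkE x : normal_pdf 0 1 x = normal_peak 1 * gk x.
Proof.
rewrite normal_pdfE ?oner_neq0// /normal_fun /gk subr0 expr1n; congr (_ * expR _).
by rewrite mulNr.
Qed.

Let gkN x : gk (- x) = gk x. Proof. by rewrite /gk sqrrN. Qed.

Let is_derive_gk x : is_derive x (1 : R) gk (- x * gk x).
Proof.
have H : is_derive x (1 : R) (fun y : R => - (y ^+ 2 / 2)) (- x).
  by apply: is_derive_eq; rewrite /GRing.scale/=; field.
by have := @is_derive1_comp _ expR (fun y : R => - (y ^+ 2 / 2)) x _ _ (is_derive_expR _) H; rewrite mulrC.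
Qed.

Let continuous_gk : continuous gk.
Proof.
move=> x; apply: differentiable_continuous; apply/derivable1_diffP.
by have [] := is_derive_gk x.
Qed.

Let measurable_gk : measurable_fun setT gk.
Proof. exact: continuous_measurable_fun. Qed.

(** A common integrable majorant of [gk] and of [x * gk x]: half of the exponent is spent on |x| <=
    exp (x^2/4). *)
Let gk4 (x : R) := expR (- (x ^+ 2 / 4)).

(** Up to a constant this is the normal density of standard deviation sqrt 2. *)
Lemma integrable_expN_sqr4 : leb.-integrable setT (fun x => (expR (- (x ^+ 2 / 4)))%:E).
Proof.
have s0 : Num.sqrt 2 != 0 :> R by rewrite gt_eqF// sqrtr_gt0.
have := integrable_realZ (normal_peak (Num.sqrt 2))^-1 (@integrable_normal_pdf R 0 (Num.sqrt 2)).
rewrite normal_pdfE// /normal_fun sqr_sqrtr//.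
under eq_fun => x do rewrite mulKf ?(gt_eqF (normal_peak_gt0 s0))// subr0 mulNr.
by rewrite (_ : 2 *+ 2 = 4 :> R)// -mulr_natr; lra.
Qed.

Let norm_le (x : R) : `|x * gk x| <= gk4 x.
Proof.
rewrite normrM (ger0_norm (expR_ge0 _)).
have xe : `|x| <= expR (x ^+ 2 / 4).
  apply: le_trans (expR_ge1Dx _).
  by have := real_normK (num_real x); have := sqr_ge0 (`|x| - 2); lra.
rewrite (le_trans (ler_wpM2r (expR_ge0 _) xe))// -expRD ler_expR.
by lra.
Qed.

Let gk_le (x : R) : `|gk x| <= gk4 x.
Proof.
rewrite (ger0_norm (expR_ge0 _)) ler_expR; have := sqr_ge0 x; lra.
Qed.

Let igkM (g : R -> R) : measurable_fun setT g -> (forall x, `|g x| <= 1) ->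
  leb.-integrable setT (fun x => (gk x * g x)%:E).
Proof.
move=> mg g1; apply: (le_integrable_real _ integrable_expN_sqr4); first exact: measurable_funM.
by move=> x; rewrite normrM (le_trans _ (gk_le x))// ler_piMr.
Qed.

Let ixgkM (g : R -> R) : measurable_fun setT g -> (forall x, `|g x| <= 1) ->
  leb.-integrable setT (fun x => (- x * gk x * g x)%:E).
Proof.
move=> mg g1; apply: (le_integrable_real _ integrable_expN_sqr4).
  by apply: measurable_funM => //; exact: measurable_funM.
by move=> x; rewrite normrM (le_trans _ (norm_le x))// mulNr normrN ler_piMr.
Qed.

Let igkcos s : leb.-integrable setT (fun x => (gk x * cos (s * x))%:E).
Proof. by apply: igkM; [exact: measurable_cosM|move=> x; exact: cos_max]. Qed.

Let cvg_gk : gk n%:R @[n --> \oo] --> (0 : R).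
Proof.
apply: (@squeeze_cvgr _ _ _ _ (cst 0) (fun n => expR (- (2^-1 * n%:R)))).
- apply: nearW => n; rewrite expR_ge0/= ler_expR lerN2 mulrC ler_wpM2r ?invr_ge0//.
  by rewrite -natrX ler_nat -{1}(expn1 n); case: n => // n; rewrite leq_pexp2l.
- exact: cvg_cst.
- apply: (@cvg_comp _ _ _ (fun n => n%:R : R) (fun y => expR (- (2^-1 * y))) _ +oo).
    exact: cvgr_idn.
  by apply: expNM_cvgy; rewrite invr_gt0.
Qed.

Let psi s := \int[leb]_x (gk x * cos (s * x)).

(* [psi' s = - s * psi s], by differentiation under the integral and this integration
   by parts. *)
Let parts s : \int[leb]_x (- x * gk x * sin (s * x)) = - s * psi s.
Proof.
have mc : measurable_fun setT (fun x : R => cos (s * x)) by exact: measurable_cosM.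
have ms : measurable_fun setT (fun x : R => sin (s * x)) by exact: measurable_sinM.
have is1 : leb.-integrable setT (fun x => (- x * gk x * sin (s * x))%:E).
  by apply: ixgkM => // x; exact: sin_max.
have is2 : leb.-integrable setT (fun x => (s * (gk x * cos (s * x)))%:E).
  exact: integrable_realZ.
have : \int[leb]_x (- x * gk x * sin (s * x) + s * (gk x * cos (s * x))) = 0.
  apply: (@Rintegral_derive_eq0 _ (fun x => gk x * sin (s * x))).
  - move=> x; have := is_derive_gk x => ?.
    have H : is_derive x (1 : R) (fun y : R => s * y) s.
      by apply: is_derive_eq; rewrite /GRing.scale/= mulr1.
    have ? := @is_derive1_comp _ (@sin R) (fun y : R => s * y) x _ _ (is_derive_sin _) H.
    by apply: is_derive_eq; rewrite /GRing.scale/=; ring.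
  - have c1 : continuous (fun x : R => s * x) by move=> x; apply: cvgMr.
    have c2 : continuous (fun x : R => sin (s * x)).
      by move=> x; apply: (continuous_comp (c1 x)); exact: continuous_sin.
    have c3 : continuous (fun x : R => cos (s * x)).
      by move=> x; apply: (continuous_comp (c1 x)); exact: continuous_cos.
    move=> x; apply: cvgD; apply: cvgM => //.
    + by apply: cvgM; [apply: (@cvgN _ R^o); exact: cvg_id|exact: continuous_gk].
    + exact: c2.
    + exact: cvg_cst.
    + by apply: cvgM => //; [exact: continuous_gk|exact: c3].
  - exact: integrable_realD.
  - apply: (@squeeze_cvgr _ _ _ _ (fun n => - gk n%:R) (fun n => gk n%:R)) => //.
      apply: nearW => n; rewrite -ler_norml normrM (ger0_norm (expR_ge0 _)).
      by rewrite ler_piMr ?expR_ge0// sin_max.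
    by apply: (@cvg_to_eq _ _ _ _ (- 0 : R)); [exact: oppr0|exact: (@cvgN _ R^o)].
  - apply: (@squeeze_cvgr _ _ _ _ (fun n => - gk n%:R) (fun n => gk n%:R)) => //.
      apply: nearW => n; rewrite -ler_norml gkN normrM (ger0_norm (expR_ge0 _)).
      by rewrite ler_piMr ?expR_ge0// sin_max.
    by apply: (@cvg_to_eq _ _ _ _ (- 0 : R)); [exact: oppr0|exact: (@cvgN _ R^o)].
rewrite RintegralTD// RintegralTZ// -/(psi s) => /eqP.
by rewrite addr_eq0 mulNr => /eqP.
Qed.

Let is_derive_psi s : is_derive s (1 : R) psi (- s * psi s).
Proof.
pose f (s x : R) := gk x * cos (s * x).
have D s' x : is_derive s' (1 : R) (fun y => f y x) (- x * gk x * sin (s' * x)).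
  have H : is_derive s' (1 : R) (fun y : R => y * x) x.
    by apply: is_derive_eq; rewrite /GRing.scale/= ?mulr1 ?mul1r ?mulr0 ?add0r ?addr0.
  have ? := @is_derive1_comp _ (@cos R) (fun y : R => y * x) s' _ _ (is_derive_cos _) H.
  by apply: is_derive_eq; rewrite /GRing.scale/=; ring.
have P1 s' x : partial1of2 f s' x = - x * gk x * sin (s' * x).
  by rewrite partial1of2E; have [_ ->] := D s' x.
have Is : (`]s - 1, s + 1[%classic : set R) s by rewrite /= in_itv/= ltrBlDr ltrDl ltr01.
have intf x : (`]s - 1, s + 1[%classic : set R) x -> leb.-integrable setT (EFin \o f x).
  by move=> _; exact: igkcos.
have derf (x y : R) : (`]s - 1, s + 1[%classic : set R) x -> setT y -> derivable (f ^~ y) x 1.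
  by move=> _ _; have [] := D x y.
have ub (x y : R) : (`]s - 1, s + 1[%classic : set R) x -> setT y ->
    `|partial1of2 f x y| <= gk4 y.
  move=> _ _; rewrite P1 normrM (le_trans _ (norm_le y))// mulNr normrN.
  by rewrite ler_piMr// sin_max.
have g0 y : 0 <= gk4 y by exact: expR_ge0.
have dv := derivable_under_integral measurableT Is intf derf g0 integrable_expN_sqr4 ub.
have de := differentiation_under_integral measurableT Is intf derf g0 integrable_expN_sqr4 ub.
apply: DeriveDef; first exact: dv.
rewrite -derive1E [LHS]de -parts; apply: eq_Rintegral => x _; exact: P1.
Qed.

Let psiE s : psi s = psi 0 * expR (- (s ^+ 2 / 2)).
Proof.
(* The integrating factor of psi' = - s psi: the derivative of [F] is 0. *)
pose F (s : R) := psi s * expR (s ^+ 2 / 2).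
have FE : F s = F 0.
  apply: is_derive_0_is_cst => x; have ? := is_derive_psi x.
  have H : is_derive x (1 : R) (fun y : R => y ^+ 2 / 2) x.
    by apply: is_derive_eq; rewrite /GRing.scale/=; field.
  have ? := @is_derive1_comp _ expR (fun y : R => y ^+ 2 / 2) x _ _ (is_derive_expR _) H.
  by apply: is_derive_eq; rewrite /GRing.scale/=; ring.
move: FE; rewrite /F expr0n mul0r expR0 mulr1 => <-.
by rewrite -mulrA -expRD subrr expR0 mulr1.
Qed.

Lemma normal_prob_cos (s : R) :
  \int[normal_prob (0:R) 1]_x cos (s * x) = expR (- (s ^+ 2 / 2)).
Proof.
have E t : \int[normal_prob (0:R) 1]_x cos (t * x) = normal_peak 1 * psi t.
  rewrite (@integral_normal_prob _ _ 1); last 2 first.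
  - exact: measurable_cosM.
  - by move=> x; exact: cos_max.
  rewrite -RintegralTZ//; apply: eq_Rintegral => x _.
  by rewrite gkE mulrA.
(* The total mass 1 of the normal law fixes the constant of integration. *)
have E0 : normal_peak 1 * psi 0 = 1.
  rewrite /psi -RintegralTZ// /Rintegral.
  under eq_integral do rewrite mul0r cos0 mulr1 -gkE.
  by rewrite integral_normal_pdf.
by rewrite E psiE mulrA E0 mul1r.
Qed.

Lemma normal_prob_sin (s : R) : \int[normal_prob (0:R) 1]_x sin (s * x) = 0.
Proof.
rewrite (@integral_normal_prob _ _ 1); last 2 first.
- exact: measurable_sinM.
- by move=> x; exact: sin_max.
under eq_Rintegral do rewrite gkE -mulrA.
apply: Rintegral_odd.
  by apply/integrable_realZ/igkM; [exact: measurable_sinM|move=> x; exact: sin_max].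
by move=> x; rewrite gkN mulrN sinN !mulrN.
Qed.

(** Where |y| > x, half of the exponent gives exp (- x^2/4), and the other half remains integrable
    in y. *)
Lemma normal_prob_tail (x : R) : 0 <= x ->
  (normal_prob 0 1 [set y : R | (x < `|y|)%R]
   <= (expR (- (x ^+ 2 / 4)) * (normal_peak 1 * \int[leb]_y expR (- (y ^+ 2 / 4))))%:E)%E.
Proof.
move=> x0; set A := [set y | _].
have mA : measurable A.
  rewrite (_ : A = ((fun y : R => `|y|) @^-1` `]x, +oo[)); last first.
    by apply/seteqP; split=> y /=; rewrite in_itv/= andbT.
  by rewrite -[X in measurable X]setTI; exact: normr_measurable.
rewrite /normal_prob mulrA EFinM Rintegral_integral; last exact: integrable_expN_sqr4.
rewrite -integralZl//; last exact: integrable_expN_sqr4.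
apply: (@le_trans _ _ (\int[leb]_(y in A)
   ((expR (- (x ^+ 2 / 4)) * normal_peak 1)%:E * (expR (- (y ^+ 2 / 4)))%:E)))%E.
  apply: ge0_le_integral => //.
  - by move=> y _; rewrite lee_fin normal_pdf_ge0.
  - by apply/measurable_EFinP; apply: measurable_funTS; exact: measurable_normal_pdf.
  - apply: measurable_funTS; apply/measurable_EFinP; apply: measurable_funM => //.
    by have /integrableP[/measurable_EFinP] := integrable_expN_sqr4.
  - move=> y /= xy; rewrite -EFinM lee_fin gkE mulrC -mulrA [leRHS]mulrCA mulrC.
    rewrite ler_wpM2l ?normal_peak_ge0// -expRD ler_expR.
    have : x ^+ 2 <= `|y| ^+ 2 by rewrite ler_pXn2r// ?nnegrE// ltW.
    rewrite real_normK ?num_real//; lra.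
apply: ge0_subset_integral => //.
  apply/measurable_EFinP; apply: measurable_funM => //.
  by have /integrableP[/measurable_EFinP] := integrable_expN_sqr4.
by move=> y _; rewrite -EFinM lee_fin !mulr_ge0 ?expR_ge0 ?normal_peak_ge0.
Qed.

End normal_characteristic_function.

(** * Gaussian white noise and variances of increments *)

Section gaussian_law.
Context {R : realType} d {T : measurableType d} (P : probability T R) (Z : T -> R) (v : R).
Notation leb := (@lebesgue_measure R).
Hypothesis mZ : measurable_fun setT Z.
Hypothesis v0 : 0 <= v.
Hypothesis Ecos : forall s : R, ('E_P[fun w => cos (s * Z w)] = (expR (- (s ^+ 2 * v / 2)))%:E)%E.
Hypothesis Esin : forall s : R, ('E_P[fun w => sin (s * Z w)] = 0)%E.

Let mscale (c : R) : measurable_fun setT (fun x : R => c * x).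
Proof. exact: measurable_funM. Qed.

(** The law is the image of the standard normal law under multiplication by [Num.sqrt v], a form
    that includes the degenerate case v = 0. *)
Lemma gaussian_law (A : set R) : measurable A ->
  P (Z @^-1` A) = normal_prob 0 1 ((fun x => Num.sqrt v * x) @^-1` A).
Proof.
apply: (characteristic_function_unique (P1 := P) (P2 := normal_prob 0 1) mZ (mscale _)) => u.
- have := Ecos u; rewrite unlock => H; rewrite /Rintegral H/=.
  rewrite -[in LHS](sqr_sqrtr v0) -exprMn -normal_prob_cos.
  by congr fine; apply: eq_integral => x _; rewrite mulrA.
- have := Esin u; rewrite unlock => H; rewrite /Rintegral H/=.
  rewrite -[LHS](normal_prob_sin (u * Num.sqrt v)).
  by congr fine; apply: eq_integral => x _; rewrite mulrA.
Qed.

Definition tail_cst : R := normal_peak 1 * \int[leb]_y expR (- (y ^+ 2 / 4)).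

(** Stated for a positive upper bound [V] because the variances of the increments are only estimated
    and might vanish. *)
Lemma gaussian_tail (V x : R) : v <= V -> 0 < V -> 0 <= x ->
  (P [set w | (x < `|Z w|)%R] <= (expR (- (x ^+ 2 / (4 * V))) * tail_cst)%:E)%E.
Proof.
move=> vV V0 x0.
have mA (y : R) : measurable [set z : R | y < `|z|].
  rewrite (_ : [set z | _] = ((fun z : R => `|z|) @^-1` `]y, +oo[)); last first.
    by apply/seteqP; split=> z /=; rewrite in_itv/= andbT.
  by rewrite -[X in measurable X]setTI; exact: normr_measurable.
rewrite (gaussian_law (mA x)).
have sV : 0 < Num.sqrt V by rewrite sqrtr_gt0.
apply: (@le_trans _ _ (normal_prob 0 1 [set y : R | x / Num.sqrt V < `|y|])).
  apply: le_measure; rewrite ?inE; [|exact: mA|].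
    by rewrite -[X in measurable X]setTI; apply: mscale => //; exact: mA.
  move=> y /= xy; rewrite ltr_pdivrMr// (lt_le_trans xy)// normrM mulrC.
  by rewrite ler_wpM2l// ger0_norm ?sqrtr_ge0// ler_sqrt// ltW.
apply: le_trans (normal_prob_tail _) _; first by rewrite divr_ge0// ltW.
rewrite -/tail_cst; rewrite (_ : (x / Num.sqrt V) ^+ 2 / 4 = x ^+ 2 / (4 * V))//.
by rewrite exprMn exprVn (sqr_sqrtr (ltW V0)) invfM mulrA mulrAC.
Qed.

End gaussian_law.

Section white_noise.
Context {R : realType} d {T : measurableType d} (P : probability T R)
  (W : (R -> R) -> T -> R).
Notation leb := (@lebesgue_measure R).
Hypothesis wW : gaussian_white_noise P W.

Lemma white_noise1 f : L2fun f -> forall s : R,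
  ('E_P[fun w => cos (s * W f w)] = (expR (- (s ^+ 2 * \int[leb]_x (f x ^+ 2) / 2)))%:E)%E /\
  ('E_P[fun w => sin (s * W f w)] = 0)%E.
Proof.
move=> Lf s; have [_ H] := wW.
have := H 1 (fun=> f) (fun=> 1) (fun=> Lf) s => /=.
rewrite (_ : (fun w => cos _) = (fun w => cos (s * W f w))); last first.
  by apply/funext => w; rewrite big_ord1 mul1r.
rewrite (_ : (fun w => sin _) = (fun w => sin (s * W f w))); last first.
  by apply/funext => w; rewrite big_ord1 mul1r.
by under eq_Rintegral do rewrite big_ord1 mul1r.
Qed.

Lemma white_noise2 f g : L2fun f -> L2fun g -> forall s : R,
  ('E_P[fun w => cos (s * (W f w - W g w))]
    = (expR (- (s ^+ 2 * \int[leb]_x ((f x - g x) ^+ 2) / 2)))%:E)%E /\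
  ('E_P[fun w => sin (s * (W f w - W g w))] = 0)%E.
Proof.
move=> Lf Lg s; have [_ H] := wW.
pose fs (i : 'I_2) := if i == ord0 then f else g.
pose a (i : 'I_2) : R := if i == ord0 then 1 else -1.
have Lfs i : L2fun (fs i) by rewrite /fs; case: ifP.
have E (F : 'I_2 -> R) : \sum_(i < 2) F i = F ord0 + F ord_max.
  by rewrite big_ord_recl big_ord1; congr (_ + F _); exact/val_inj.
have := H 2 fs a Lfs s => /=.
rewrite (_ : (fun w => cos _) = (fun w => cos (s * (W f w - W g w)))); last first.
  by apply/funext => w; rewrite E /a /fs/= mul1r mulN1r.
rewrite (_ : (fun w => sin _) = (fun w => sin (s * (W f w - W g w)))); last first.
  by apply/funext => w; rewrite E /a /fs/= mul1r mulN1r.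
by under eq_Rintegral do rewrite E /a /fs/= mul1r mulN1r.
Qed.

End white_noise.

Section kernel_increments.
Context {R : realType}.
Notation leb := (@lebesgue_measure R).
Implicit Types (a b h t s u : R).

(** To be read with l = ln x. For l >= 0 the difference is at most e^(-pl) (q - p) l, and the margin
    pays for the logarithm: l <= e^(el)/e and e^(-pl+el) <= e^(-al). For l < 0 the exponent b plays
    the part of a. *)
Let expR_diff_le_aux (p q a b e l : R) : 0 < e -> p <= q ->
  a + e <= p -> q <= b - e ->
  `|expR (- p * l) - expR (- q * l)| <= (q - p) / e * (expR (- a * l) + expR (- b * l)).
Proof.
move=> e0 pq ap qb.
have one (x : R) : 1 - expR (- x) <= x by have := expR_ge1Dx (- x); lra.
have dom (x : R) : x <= e^-1 * expR (e * x).
  by rewrite ler_pdivlMl//; have := expR_ge1Dx (e * x); lra.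
have qp : 0 <= q - p by rewrite subr_ge0.
have qpe : 0 <= (q - p) / e by rewrite divr_ge0// ltW.
have [l0|l0] := leP 0 l.
  rewrite ger0_norm; last first.
    by rewrite subr_ge0 ler_expR ler_wpM2r// lerN2.
  rewrite mulrDr (@le_trans _ _ ((q - p) / e * expR (- a * l)))//; last first.
    by rewrite lerDl mulr_ge0 ?expR_ge0.
  have -> : expR (- p * l) - expR (- q * l) = expR (- p * l) * (1 - expR (- ((q - p) * l))).
    by rewrite mulrBr mulr1 -expRD; congr (_ - expR _); ring.
  apply: (@le_trans _ _ (expR (- p * l) * ((q - p) * (e^-1 * expR (e * l))))).
    rewrite ler_wpM2l ?expR_ge0// (le_trans (one _))//.
    by rewrite ler_wpM2l.
  rewrite [leLHS](_ : _ = (q - p) / e * (expR (- p * l) * expR (e * l))); last by ring.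
  rewrite -expRD ler_wpM2l// ler_expR -mulrDl ler_wpM2r//; lra.
rewrite distrC ger0_norm; last first.
  by rewrite subr_ge0 ler_expR ler_nM2r// lerN2.
rewrite mulrDr (@le_trans _ _ ((q - p) / e * expR (- b * l)))//; last first.
  by rewrite lerDr mulr_ge0 ?expR_ge0.
have -> : expR (- q * l) - expR (- p * l) = expR (- q * l) * (1 - expR (- ((q - p) * - l))).
  by rewrite mulrBr mulr1 -expRD; congr (_ - expR _); ring.
apply: (@le_trans _ _ (expR (- q * l) * ((q - p) * (e^-1 * expR (e * - l))))).
  rewrite ler_wpM2l ?expR_ge0// (le_trans (one _))//.
  by rewrite ler_wpM2l.
rewrite [leLHS](_ : _ = (q - p) / e * (expR (- q * l) * expR (e * - l))); last by ring.
rewrite -expRD ler_wpM2l// ler_expR mulrN -mulNr -mulrDl ler_nM2r//; lra.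
Qed.

Lemma powR_diff_le (p q a b e x : R) : 0 < e -> 0 < x ->
  a + e <= p <= b - e -> a + e <= q <= b - e ->
  `|x `^ (- p) - x `^ (- q)| <= `|p - q| / e * (x `^ (- a) + x `^ (- b)).
Proof.
move=> e0 x0 /andP[ap pb] /andP[aq qb].
rewrite /powR !(gt_eqF x0).
have [pq|/ltW qp] := leP p q.
  by rewrite (distrC p) (ger0_norm (_ : 0 <= q - p)) ?subr_ge0//; exact: expR_diff_le_aux.
by rewrite distrC (ger0_norm (_ : 0 <= p - q)) ?subr_ge0//; exact: expR_diff_le_aux.
Qed.

(** Half the squared modulus of the kernel, by [mbm_kernel_sqE]. *)
Let osc h t u : R := (1 - cos (t * u)) * `|u| `^ (- (2 * h + 1)).

Let osc_ge0 h t u : 0 <= osc h t u.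
Proof. by rewrite mulr_ge0 ?powR_ge0// subr_ge0 cos_le1. Qed.

Let measurable_osc h t : measurable_fun setT (osc h t).
Proof.
apply: measurable_funM; first by apply: measurable_funB => //; exact: measurable_cosM.
by apply: (measurableT_comp (measurable_powRE _)); exact: normr_measurable.
Qed.

Let integrable_osc h t : 0 < h < 1 -> 0 < t -> leb.-integrable setT (fun u => (osc h t u)%:E).
Proof.
move=> h01 t0; apply: integrable_ge0_real (integral_oneBcosM h01 t0).
  exact: measurable_osc.
exact: osc_ge0.
Qed.

Let Rintegral_osc h t : 0 < h < 1 -> 0 < t ->
  \int[leb]_u osc h t u = 2^-1 * t `^ (2 * h) * Cst h ^+ 2.
Proof.
move=> h01 t0; apply: EFin_inj; rewrite Rintegral_integral; last exact: integrable_osc.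
exact: integral_oneBcosM.
Qed.

(** The end a dominates for x >= 1 and the end b for x <= 1; their sum serves on the whole
    half-line. *)
Let powR_le_add (x a b h : R) : 0 < x -> a <= h <= b ->
  x `^ (- (2 * h + 1)) <= x `^ (- (2 * a + 1)) + x `^ (- (2 * b + 1)).
Proof.
move=> x0 /andP[ah hb]; have [x1|/ltW x1] := leP 1 x.
  apply: (@le_trans _ _ (x `^ (- (2 * a + 1)))); last by rewrite lerDl powR_ge0.
  by rewrite ler_powR//; lra.
apply: (@le_trans _ _ (x `^ (- (2 * b + 1)))); last by rewrite lerDr powR_ge0.
by rewrite /powR !(gt_eqF x0) ler_expR ler_wnM2r ?ln_le0//; lra.
Qed.

Let osc_le a b h t u : a <= h <= b -> osc h t u <= osc a t u + osc b t u.
Proof.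
move=> ahb; have [->|u0] := eqVneq u 0.
  by rewrite /osc !mulr0 !cos0 !subrr !mul0r addr0.
rewrite /osc -mulrDr ler_wpM2l ?subr_ge0 ?cos_le1//.
by rewrite powR_le_add// normr_gt0.
Qed.

Let powR_sqr (x h : R) : (x `^ (- (h + 2^-1))) ^+ 2 = x `^ (- (2 * h + 1)).
Proof.
by rewrite -[_ ^+ 2]powR_mulrn ?powR_ge0// -powRrM; congr (_ `^ _); field.
Qed.

(** For unit complex numbers z = A + iB and z' = C + iE, (z-1)x - (z'-1)y = (z-z')x + (z'-1)(x-y):
    the first term is a change of time at fixed index, the second a change of index at fixed time.
    Then |z-z'|^2 = 2(1 - (AC+BE)) and |z'-1|^2 = 2(1-C). *)
Let increment_sq_aux (A B C E x y : R) : A ^+ 2 + B ^+ 2 = 1 -> C ^+ 2 + E ^+ 2 = 1 ->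
  ((A - 1) * x - (C - 1) * y) ^+ 2 + (B * x - E * y) ^+ 2 <=
  4 * ((1 - (A * C + B * E)) * x ^+ 2) + 4 * ((1 - C) * (x - y) ^+ 2).
Proof.
move=> AB CE.
have sq2 (m n : R) : (m + n) ^+ 2 <= 2 * m ^+ 2 + 2 * n ^+ 2.
  by have := sqr_ge0 (m - n); lra.
have -> : (A - 1) * x - (C - 1) * y = (A - C) * x + (C - 1) * (x - y) by ring.
have -> : B * x - E * y = (B - E) * x + E * (x - y) by ring.
apply: (le_trans (lerD (sq2 _ _) (sq2 _ _))).
rewrite [leLHS](_ : _ = 2 * ((A ^+ 2 + B ^+ 2 + (C ^+ 2 + E ^+ 2) - 2 * (A * C + B * E)) * x ^+ 2)
  + 2 * ((C ^+ 2 + E ^+ 2 + 1 - 2 * C) * (x - y) ^+ 2)); last by ring.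
by rewrite AB CE le_eqVlt; apply/orP; left; apply/eqP; ring.
Qed.

Lemma mbm_kernel_increment_le a b e h k t s u : 0 < e ->
  a + e <= h <= b - e -> a + e <= k <= b - e ->
  (mbm_kernel_re h t u - mbm_kernel_re k s u) ^+ 2
    + (mbm_kernel_im h t u - mbm_kernel_im k s u) ^+ 2 <=
  4 * ((1 - cos ((t - s) * u)) * `|u| `^ (- (2 * a + 1)))
  + 4 * ((1 - cos ((t - s) * u)) * `|u| `^ (- (2 * b + 1)))
  + (8 * ((h - k) / e) ^+ 2 * ((1 - cos (s * u)) * `|u| `^ (- (2 * a + 1)))
  + 8 * ((h - k) / e) ^+ 2 * ((1 - cos (s * u)) * `|u| `^ (- (2 * b + 1)))).
Proof.
move=> e0 he ke; have [->|u0] := eqVneq u 0.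
  rewrite /mbm_kernel_re /mbm_kernel_im !mulr0 !cos0 !sin0 !subrr !mul0r !subrr.
  by rewrite !mulr0 !expr0n !addr0.
have un0 : 0 < `|u| by rewrite normr_gt0.
set x := `|u| `^ (- (h + 2^-1)); set y := `|u| `^ (- (k + 2^-1)).
have -> : mbm_kernel_re h t u - mbm_kernel_re k s u = (cos (t * u) - 1) * x - (cos (s * u) - 1) * y.
  by rewrite /mbm_kernel_re /x /y !powRN.
have -> : mbm_kernel_im h t u - mbm_kernel_im k s u = sin (t * u) * x - sin (s * u) * y.
  by rewrite /mbm_kernel_im /x /y !powRN.
apply: (le_trans (increment_sq_aux _ _ (cos2Dsin2 _) (cos2Dsin2 _))).
rewrite -cosB -mulrBl; apply: lerD.
  rewrite /x powR_sqr -mulrDr ler_wpM2l//; apply: osc_le.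
  by move: he => /andP[? ?]; apply/andP; split; lra.
rewrite -mulrDr -mulrDr /osc.
rewrite [leRHS](_ : _ = 4 * ((1 - cos (s * u)) * (2 * ((h - k) / e) ^+ 2 *
  (`|u| `^ (- (2 * a + 1)) + `|u| `^ (- (2 * b + 1)))))); last by ring.
rewrite ler_wpM2l// ler_wpM2l ?subr_ge0 ?cos_le1//.
have xy : `|x - y| <= `|h - k| / e * (`|u| `^ (- (a + 2^-1)) + `|u| `^ (- (b + 2^-1))).
  have := @powR_diff_le (h + 2^-1) (k + 2^-1) (a + 2^-1) (b + 2^-1) e `|u| e0 un0.
  rewrite (_ : h + 2^-1 - (k + 2^-1) = h - k); last by ring.
  by apply; [move: he|move: ke] => /andP[? ?]; apply/andP; split; lra.
have : `|x - y| ^+ 2 <= (`|h - k| / e * (`|u| `^ (- (a + 2^-1)) + `|u| `^ (- (b + 2^-1)))) ^+ 2.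
  by rewrite ler_pXn2r// nnegrE (le_trans _ xy).
rewrite real_normK ?num_real// => /le_trans; apply.
rewrite exprMn 2!expr_div_n real_normK ?num_real// -!powR_sqr.
rewrite [leRHS]mulrAC [leRHS]mulrC ler_wpM2l ?divr_ge0 ?sqr_ge0//.
set m := _ `^ _; set n := _ `^ _; have := sqr_ge0 (m - n); lra.
Qed.

(** The first bracket stems from the change of time, the second from the change of index. The
    constants 2 and 4 are the pointwise 4 and 8 times the [2^-1] of [Rintegral_osc]. *)
Lemma integral_mbm_kernel_increment_le a b e h k t s : 0 < a -> b < 1 -> 0 < e ->
  a + e <= h <= b - e -> a + e <= k <= b - e -> 0 < s -> s < t ->
  (\int[leb]_u ((mbm_kernel_re h t u - mbm_kernel_re k s u) ^+ 2
    + (mbm_kernel_im h t u - mbm_kernel_im k s u) ^+ 2)%:E <=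
  (2 * ((t - s) `^ (2 * a) * Cst a ^+ 2 + (t - s) `^ (2 * b) * Cst b ^+ 2)
  + 4 * ((h - k) / e) ^+ 2 * (s `^ (2 * a) * Cst a ^+ 2 + s `^ (2 * b) * Cst b ^+ 2))%:E)%E.
Proof.
move=> a0 b1 e0 he ke s0 st; have ts0 : 0 < t - s by rewrite subr_gt0.
have [a01 b01] : 0 < a < 1 /\ 0 < b < 1.
  by move: he => /andP[? ?]; split; apply/andP; split; lra.
have ic c h' t' : 0 < h' < 1 -> 0 < t' -> leb.-integrable setT (fun u => (c * osc h' t' u)%:E).
  by move=> ? ?; apply: integrable_realZ; exact: integrable_osc.
set c := 8 * ((h - k) / e) ^+ 2.
have i1 : leb.-integrable setT (fun u => (4 * osc a (t - s) u + 4 * osc b (t - s) u)%:E).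
  by apply: integrable_realD; exact: ic.
have i2 : leb.-integrable setT (fun u => (c * osc a s u + c * osc b s u)%:E).
  by apply: integrable_realD; exact: ic.
have := Rintegral_integral (integrable_realD i1 i2).
rewrite RintegralTD// RintegralTD; [|exact: ic|exact: ic].
rewrite RintegralTD; [|exact: ic|exact: ic].
rewrite !RintegralTZ; [|exact: integrable_osc..].
rewrite !Rintegral_osc// => RE.
rewrite [leRHS](_ : _ = (4 * (2^-1 * (t - s) `^ (2 * a) * Cst a ^+ 2) +
         4 * (2^-1 * (t - s) `^ (2 * b) * Cst b ^+ 2) +
         (c * (2^-1 * s `^ (2 * a) * Cst a ^+ 2) + c * (2^-1 * s `^ (2 * b) * Cst b ^+ 2)))%:E); last first.
  by congr EFin; rewrite /c; field; rewrite gt_eqF.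
rewrite RE; apply: ge0_le_integral => //.
- by move=> u _; rewrite lee_fin addr_ge0 ?sqr_ge0.
- have [mr mi] := measurable_mbm_kernel h t; have [mr' mi'] := measurable_mbm_kernel k s.
  by apply/measurable_EFinP; apply: measurable_funD; apply: measurable_funX; exact: measurable_funB.
- by have /integrableP[] := integrable_realD i1 i2.
- by move=> u _; rewrite lee_fin; exact: mbm_kernel_increment_le.
Qed.

(** Up to the same factor 2, each term is the integral of [osc] at its index, so [osc_le] is
    integrated instead of estimating the Gamma function inside [Cst]. *)
Lemma powR_Cst_le a b h t : 0 < a -> b < 1 -> a <= h <= b -> 0 < t ->
  t `^ (2 * h) * Cst h ^+ 2 <= t `^ (2 * a) * Cst a ^+ 2 + t `^ (2 * b) * Cst b ^+ 2.
Proof.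
move=> a0 b1 ahb t0.
have [[a01 b01] h01] : (0 < a < 1 /\ 0 < b < 1) /\ 0 < h < 1.
  by move: ahb => /andP[? ?]; split; [split|]; apply/andP; split; lra.
have iab := integrable_realD (integrable_osc a01 t0) (integrable_osc b01 t0).
have : \int[leb]_u osc h t u <= \int[leb]_u (osc a t u + osc b t u).
  by apply: le_Rintegral => //; [exact: integrable_osc|move=> u _; exact: osc_le].
rewrite RintegralTD ?Rintegral_osc//; try exact: integrable_osc.
lra.
Qed.

End kernel_increments.

(** * Sublinear growth of the paths *)

Section dyadic_chaining.
Context {R : realType}.
Implicit Types (f : R -> R) (x c r : R).

(** Induction on the level: an even j is a point of the level before, an odd j is one increment of
    its own level to the right of such a point. So each level is charged at most once. *)
Lemma dyadic_increments_le f x c r : 0 <= r -> 0 <= c ->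
  (forall k j, (j < 2 ^ k)%N ->
    `|f (x + j%:R / 2 ^+ k + (2 ^+ k)^-1) - f (x + j%:R / 2 ^+ k)| <= r ^+ k * c) ->
  forall k j, (j <= 2 ^ k)%N ->
    `|f (x + j%:R / 2 ^+ k) - f x| <= (\sum_(i < k.+1) r ^+ i) * c.
Proof.
move=> r0 c0 H; elim=> [|k IH] j.
  rewrite expn0 big_ord1 expr0 divr1 mul1r.
  case: j => [_|[_|//]]; first by rewrite addr0 subrr normr0.
  by have := H 0%N 0%N isT; rewrite !expr0 mul0r addr0 invr1 mul1r.
have half (i : nat) : (i.*2)%:R / 2 ^+ k.+1 = i%:R / 2 ^+ k :> R.
  by rewrite -muln2 natrM exprS invfM mulrA mulfK.
rewrite expnS mul2n big_ord_recr/= mulrDl => jk.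
rewrite -(odd_double_half j); case oj : (odd j); last first.
  rewrite add0n half (le_trans (IH _ _))//; last by rewrite lerDl mulr_ge0 ?exprn_ge0.
  by rewrite -leq_double (leq_trans _ jk)// -[leqRHS]odd_double_half oj.
have jk' : (j./2 < 2 ^ k)%N.
  by rewrite -ltn_double -addn1 addnC (leq_trans _ jk)// -[leqRHS]odd_double_half oj ltnS.
have -> : (true + j./2.*2)%:R / 2 ^+ k.+1 = j./2.*2%:R / 2 ^+ k.+1 + (2 ^+ k.+1)^-1 :> R.
  by rewrite natrD mulrDl addrC mul1r.
rewrite addrA.
have h2 : (j./2.*2 < 2 ^ k.+1)%N by rewrite expnS mul2n ltn_double.
have := H k.+1 _ h2; rewrite half.
set u := f _; set v := f (_ + _) => uv.
have -> : u - f x = (v - f x) + (u - v) by ring.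
by rewrite (le_trans (ler_normD _ _))// lerD// IH// ltnW.
Qed.

Lemma geometric_sum_le r n : 0 <= r < 1 -> \sum_(i < n) r ^+ i <= (1 - r)^-1.
Proof.
move=> /andP[r0 r1]; have s0 : 0 < 1 - r by rewrite subr_gt0.
rewrite -[leRHS]mul1r ler_pdivlMr// mulrC -opprB mulNr -subrX1 opprB.
by rewrite lerBlDr lerDl exprn_ge0.
Qed.

Lemma dyadic_chaining f x c r : 0 <= r < 1 -> 0 <= c ->
  (forall k j, (j < 2 ^ k)%N ->
    `|f (x + j%:R / 2 ^+ k + (2 ^+ k)^-1) - f (x + j%:R / 2 ^+ k)| <= r ^+ k * c) ->
  forall t, x <= t <= x + 1 -> {for t, continuous f} -> `|f t - f x| <= (1 - r)^-1 * c.
Proof.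
move=> r01 c0 H t /andP[xt tx] ct; have /andP[r0 r1] := r01.
have tx0 : 0 <= t - x by rewrite subr_ge0.
(* The dyadic point of level k just below [t]; j may equal 2^k when t = x + 1. *)
pose j k := Num.truncn ((t - x) * 2 ^+ k).
have p2 k : 0 < 2 ^+ k :> R by rewrite exprn_gt0.
have jP k : (j k)%:R / 2 ^+ k <= t - x < (j k)%:R / 2 ^+ k + (2 ^+ k)^-1.
  have := @truncn_itv _ ((t - x) * 2 ^+ k) (mulr_ge0 tx0 (ltW (p2 k))).
  rewrite -/(j k) -ler_pdivrMr// -[(j k).+1%:R]natr1 -ltr_pdivlMr// mulrDl mul1r.
  by [].
have jk k : (j k <= 2 ^ k)%N.
  have /andP[jt _] := jP k; rewrite -(@ler_nat R) natrX -[leRHS]mul1r -ler_pdivrMr//.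
  by rewrite (le_trans jt)// lerBlDl.
have xj : x + (j k)%:R / 2 ^+ k @[k --> \oo] --> t.
  apply: (@squeeze_cvgr _ _ _ _ (fun k => t - (2 ^+ k)^-1) (cst t)).
  - apply: nearW => k; have /andP[a b] := jP k; apply/andP; rewrite /cst; split; lra.
  - apply: (@cvg_to_eq _ _ _ _ (t - 0)); first by rewrite subr0.
    apply: cvgB; first exact: cvg_cst.
    under eq_fun do rewrite -exprVn.
    by apply: cvg_expr; rewrite ger0_norm ?invr_ge0// invf_lt1// ltr1n.
  - exact: cvg_cst.
have fj : `|f (x + (j k)%:R / 2 ^+ k) - f x| @[k --> \oo] --> `|f t - f x|.
  apply: cvg_norm; apply: cvgB; last exact: cvg_cst.
  by apply: (@cvg_comp _ _ _ (fun k => x + (j k)%:R / 2 ^+ k) f _ (nbhs t)).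
rewrite -(cvg_lim _ fj)//; apply: limr_le; first by apply/cvg_ex; eexists; exact: fj.
apply: nearW => k; rewrite (le_trans (dyadic_increments_le r0 c0 H (jk k)))//.
by rewrite ler_wpM2r// geometric_sum_le.
Qed.

End dyadic_chaining.

Section gaussian_tail_estimate.
Context {R : realType}.

(** The m-th power of y/m <= exp (y/m): exponential decay is traded for a power of any chosen
    order. *)
Lemma expRN_le_exp (y : R) (m : nat) : 0 < y -> (0 < m)%N -> expR (- y) <= (m%:R / y) ^+ m.
Proof.
move=> y0 m0; have m0' : 0 < m%:R :> R by rewrite ltr0n.
have -> : - y = m%:R * - (y / m%:R) by rewrite mulrN mulrCA mulfV ?mulr1// gt_eqF.
rewrite expRM_natl; apply: lerXn2r; rewrite ?nnegrE ?expR_ge0//.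
  by rewrite divr_ge0// ltW.
rewrite expRN -[m%:R / y]invrK lef_pV2 ?posrE ?expR_gt0 ?invr_gt0 ?divr_gt0// invf_div.
by rewrite (le_trans _ (expR_ge1Dx _))// lerDr.
Qed.

(** The shape of the bound is dictated by its use: [4 ^- k] still leaves 2^(-k) after the union over
    the 2^k increments of level k, and [n.+1%:R ^- 2] is summable for Borel-Cantelli. *)
Lemma dyadic_tail_estimate (K g b e : R) : 0 < K -> 0 < g -> 0 < b -> b < 1 -> 0 < e ->
  exists2 M : R, 0 <= M & forall (n k : nat) (s : R), n.+1%:R <= s <= n.+2%:R ->
    expR (- ((((2^-1) `^ (g / 2)) ^+ k * n.+1%:R `^ (b + e)) ^+ 2 /
      (4 * (K * s `^ (2 * b) * (2 ^+ k)^-1 `^ (2 * g)))))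
    <= M * (n.+1%:R ^- 2 * 4 ^- k).
Proof.
move=> K0 g0 b0 b1 e0.
(* Large enough for e m >= 1 and g m >= 2, which turn N^(-2em) into N^(-2) and 2^(-gmk) into
   4^(-k). *)
pose m := (Num.truncn (e^-1 + 2 / g)).+1.
have m0 : (0 < m)%N by [].
have mle : e^-1 + 2 / g < m%:R.
  have /truncn_itv/andP[_ //] : 0 <= e^-1 + 2 / g.
  by rewrite addr_ge0// ?invr_ge0 ?divr_ge0// ltW.
have em : 1 <= e * m%:R.
  by rewrite -ler_pdivrMl// mulr1 (le_trans _ (ltW mle))// lerDl divr_ge0// ltW.
have gm : 2 <= g * m%:R.
  by rewrite -ler_pdivrMl// mulrC (le_trans _ (ltW mle))// lerDr invr_ge0 ltW.
exists ((m%:R * (16 * K)) ^+ m) => [|n k s /andP[ns sn]].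
  by rewrite exprn_ge0// !mulr_ge0// ltW.
set q := (2^-1) `^ (g / 2); set N : R := n.+1%:R.
have q0 : 0 < q by rewrite powR_gt0.
have N0 : 0 < N by rewrite ltr0n.
have N1 : 1 <= N by rewrite ler1n.
have s0 : 0 < s by exact: lt_le_trans ns.
have q4 : (2 ^+ k)^-1 `^ (2 * g) = (q ^+ 4) ^+ k :> R.
  have half0 : 0 <= 2^-1 :> R by rewrite invr_ge0.
  rewrite -exprVn -(powR_mulrn k half0) -exprM -(powR_mulrn _ (ltW q0)).
  by rewrite /q -!powRrM natrM; congr (_ `^ _); field.
have sN : s `^ (2 * b) <= 4 * N `^ (2 * b).
  apply: (@le_trans _ _ ((2 * N) `^ (2 * b))).
    apply: ge0_ler_powR; rewrite ?nnegrE ?mulr_ge0 ?(ltW b0) ?(ltW s0)//.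
    by rewrite (le_trans sn)// /N -natrM ler_nat mul2n doubleS !ltnS -addnn leq_addr.
  rewrite powRM ?ler_wpM2r ?powR_ge0 ?(ltW N0)//.
  apply: (@le_trans _ _ (2 `^ 2)); first by rewrite ler_powR ?ler1n//; lra.
  by rewrite powR_mulrn// -natrX.
set y := (X in expR (- X)).
(* In 16, one factor 4 is that of the Gaussian exponent, the other comes from s <= 2N and b < 1. The
   threshold squared contributes q^(2k) and the variance q^(4k), so the quotient still grows like
   q^(-2k). *)
pose y0 := N `^ (2 * e) / ((q ^+ 2) ^+ k * (16 * K)).
have y00 : 0 < y0 by rewrite divr_gt0 ?powR_gt0// !mulr_gt0// !exprn_gt0.
have yy : y0 <= y.
  rewrite /y q4; have Nb : (N `^ (b + e)) ^+ 2 = N `^ (2 * b) * N `^ (2 * e).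
    by rewrite -powR_mulrn ?powR_ge0// -powRrM -powRD ?(gt_eqF N0) ?implybT//; congr (_ `^ _); ring.
  rewrite exprMn Nb ler_pdivlMr; last by rewrite !mulr_gt0 ?powR_gt0 ?exprn_gt0.
  have qk : (q ^+ 4) ^+ k = (q ^+ 2) ^+ k * (q ^+ 2) ^+ k.
    by rewrite -exprMn -exprD.
  rewrite /y0 qk (_ : (q ^+ k) ^+ 2 = (q ^+ 2) ^+ k); last by rewrite -!exprM mulnC.
  have Q0 : 0 < (q ^+ 2) ^+ k by rewrite !exprn_gt0.
  rewrite [leLHS](_ : _ = N `^ (2 * e) * (q ^+ 2) ^+ k * (s `^ (2 * b) / 4)); last first.
    by field; rewrite !(gt_eqF, K0, Q0)//.
  rewrite [leRHS](_ : _ = N `^ (2 * e) * (q ^+ 2) ^+ k * N `^ (2 * b)); last by ring.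
  apply: ler_wpM2l; first by rewrite mulr_ge0 ?powR_ge0 ?(ltW Q0).
  by rewrite ler_pdivrMr// [leRHS]mulrC.
apply: (@le_trans _ _ (expR (- y0))); first by rewrite ler_expR lerN2.
apply: (le_trans (expRN_le_exp y00 m0)).
have -> : m%:R / y0 = m%:R * (16 * K) * ((N `^ (2 * e))^-1 * (q ^+ 2) ^+ k).
  by rewrite /y0 invf_div; ring.
rewrite exprMn ler_wpM2l ?exprn_ge0 ?mulr_ge0 ?(ltW K0)// exprMn.
apply: ler_pM; rewrite ?exprn_ge0 ?invr_ge0 ?powR_ge0//.
  rewrite exprVn lef_pV2 ?posrE ?exprn_gt0 ?powR_gt0//.
  rewrite -[N ^+ 2]powR_mulrn ?(ltW N0)// -powR_mulrn ?powR_ge0// -powRrM.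
  rewrite ler_powR// -mulrA -[leLHS]mulr1 ler_wpM2l//.
rewrite [leLHS]exprAC -exprVn; apply: lerXn2r; rewrite ?nnegrE ?exprn_ge0 ?invr_ge0 ?powR_ge0//.
rewrite -!powR_mulrn ?powR_ge0//.
have -> : 4^-1 = 2^-1 `^ 2 :> R by rewrite powR_mulrn ?invr_ge0// exprVn -natrX.
rewrite /q -!powRrM /powR !(gt_eqF (_ : 0 < 2^-1 :> R)) ?invr_gt0//.
have l0 : ln (2^-1 : R) <= 0 by rewrite ln_le0// invf_le1// ler1n.
rewrite ler_expR ler_wnM2r//.
by rewrite (_ : g / 2 * _ = g * m%:R); [|field].
Qed.

End gaussian_tail_estimate.

Section nneseries_bound.
Context {R : realType}.

Lemma nneseries_le_real (u : nat -> \bar R) (v : nat -> R) (c : R) : (forall i, (0 <= u i)%E) ->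
  (forall i, (u i <= (v i)%:E)%E) -> (forall n, \sum_(i < n) v i <= c) ->
  (\sum_(i <oo) u i <= c%:E)%E.
Proof.
move=> u0 uv vc; apply: lime_le; first exact: is_cvg_nneseries.
apply: nearW => n; rewrite big_mkord (@le_trans _ _ (\sum_(i < n) (v i)%:E)%E)//.
  by apply: lee_sum => i _; exact: uv.
by rewrite sumEFin lee_fin.
Qed.

Lemma inv_sqr_sum_le n : \sum_(i < n) (i.+1%:R ^- 2) <= 2 :> R.
Proof.
(* The bound 2 - 2/(n+1) is the strengthening that is stable under induction. *)
apply: (@le_trans _ _ (2 - 2 / n.+1%:R)); last by rewrite gerBl divr_ge0.
elim: n => [|n IH]; first by rewrite big_ord0 divr1 subrr.
rewrite big_ord_recr/= (le_trans (lerD IH (lexx _)))//.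
have n0 : 0 < n%:R + 1 :> R by rewrite natr1.
have n1 : 0 < n%:R + 2 :> R by rewrite -natrD.
have -> : n.+2%:R = n%:R + 2 :> R by rewrite -natrD addn2.
rewrite -[n.+1%:R]natr1 -subr_ge0.
rewrite [leRHS](_ : _ = n%:R / ((n%:R + 1) ^+ 2 * (n%:R + 2))); last first.
  by field; rewrite !gt_eqF.
by rewrite divr_ge0// mulr_ge0 ?sqr_ge0// ltW.
Qed.

End nneseries_bound.

Section sublinear_growth.
Context {R : realType} d {T : measurableType d} (P : probability T R) (Y : R -> T -> R).
Variables K g b C : R.
Hypotheses (K0 : 0 < K) (g0 : 0 < g) (b0 : 0 < b) (b1 : b < 1) (C0 : 0 <= C).
Hypothesis mY : forall t, measurable_fun setT (Y t).
Hypothesis tail_increment : forall s e x : R, 1 <= s -> 0 < e -> e <= 1 -> 0 <= x ->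
  (P [set w | (x < `|Y (s + e)%R w - Y s w|)%R]
   <= (expR (- (x ^+ 2 / (4 * (K * s `^ (2 * b) * e `^ (2 * g))))) * C)%:E)%E.
Hypothesis tail_value : forall s x : R, 1 <= s -> 0 <= x ->
  (P [set w | (x < `|Y s w|)%R]
   <= (expR (- (x ^+ 2 / (4 * (K * s `^ (2 * b))))) * C)%:E)%E.

(** Half of the room between b and 1: the thresholds outgrow the standard deviation by n^e, and yet
    b + e < 1. *)
Let e : R := (1 - b) / 2.
(** The standard deviation of an increment decays like 2^(-gk) = q^(2k) at level k. Thresholds in
    q^k decay more slowly, so exceeding them becomes ever rarer, while they remain summable over the
    levels. *)
Let q : R := (2^-1) `^ (g / 2).
Let inc (n k j : nat) : set T :=
  [set w | q ^+ k * n.+1%:R `^ (b + e)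
     < `|Y (n.+1%:R + j%:R / 2 ^+ k + (2 ^+ k)^-1) w - Y (n.+1%:R + j%:R / 2 ^+ k) w|].
Let val (n : nat) : set T := [set w | n.+1%:R `^ (b + e) < `|Y n.+1%:R w|].
Let inck n k := \big[setU/set0]_(j < 2 ^ k) inc n k j.
(** Only countably many increments enter, which makes this an event; continuity of the path extends
    the control to all of [n+1, n+2]. *)
Let bad n := val n `|` \bigcup_k inck n k.

Let e0 : 0 < e. Proof. by rewrite divr_gt0// subr_gt0. Qed.

Let q0 : 0 <= q. Proof. exact: powR_ge0. Qed.

Let q1 : q < 1.
Proof.
rewrite /q /powR gt_eqF ?invr_gt0// -[ltRHS]expR0 ltr_expR pmulr_rlt0 ?divr_gt0//.
by rewrite ln_lt0// invr_gt0 ltr0n invf_lt1// ltr1n.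
Qed.

Let measurable_norm_gt (x : R) (f : T -> R) : measurable_fun setT f ->
  measurable [set w | x < `|f w|].
Proof.
move=> mf; rewrite (_ : [set w | _] = ((fun w => `|f w|) @^-1` `]x, +oo[)); last first.
  by apply/seteqP; split=> z /=; rewrite in_itv/= andbT.
rewrite -[X in measurable X]setTI.
by apply: (measurableT_comp (f := fun z : R => `|z|) _ mf) => //; exact: normr_measurable.
Qed.

Let minc n k j : measurable (inc n k j).
Proof. by apply: measurable_norm_gt; exact: measurable_funB. Qed.

Let minck n k : measurable (inck n k).
Proof. by apply: bigsetU_measurable. Qed.

Let mval n : measurable (val n). Proof. exact: measurable_norm_gt. Qed.

Let mbad n : measurable (bad n).
Proof. by apply: measurableU => //; exact: bigcup_measurable. Qed.

Let bad_le : exists2 M : R, 0 <= M & forall n, (P (bad n) <= (M * n.+1%:R ^- 2)%:E)%E.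
Proof.
have [M M0 HM] := dyadic_tail_estimate K0 g0 b0 b1 e0.
have N1 n : 1 <= n.+1%:R :> R by rewrite ler1n.
have p2 k : 0 < 2 ^+ k :> R by rewrite exprn_gt0.
have incle n k (j : 'I_(2 ^ k)) : (P (inc n k j) <= (M * C * n.+1%:R ^- 2 * 4 ^- k)%:E)%E.
  have j0 : 0 <= j%:R / 2 ^+ k :> R by rewrite divr_ge0// ltW.
  have j1 : j%:R / 2 ^+ k <= 1 :> R.
    by rewrite ler_pdivrMr// mul1r -natrX ler_nat ltnW.
  apply: (le_trans (tail_increment _ _ _ _)).
  - by rewrite (le_trans (N1 n))// lerDl.
  - by rewrite invr_gt0.
  - by rewrite invf_le1// exprn_ege1// ler1n.
  - by rewrite mulr_ge0 ?exprn_ge0 ?powR_ge0.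
  rewrite lee_fin [leRHS](_ : _ = M * (n.+1%:R ^- 2 * 4 ^- k) * C); last by ring.
  apply: (ler_wpM2r C0); apply: HM; rewrite lerDl j0/=.
  by rewrite -[n.+2%:R]natr1 lerD2l.
have inckle n k : (P (inck n k) <= (M * C * n.+1%:R ^- 2 * 2^-1 ^+ k)%:E)%E.
  apply: (le_trans (Boole_inequality P (A := fun j => inc n k j) _)) => //.
  apply: (@le_trans _ _ (\sum_(j < 2 ^ k) (M * C * n.+1%:R ^- 2 * 4 ^- k)%:E)%E).
    by apply: lee_sum => j _; exact: incle.
  rewrite sumEFin lee_fin sumr_const card_ord -(mulr_natr _ (2 ^ k)%N) natrX -[leLHS]mulrA.
  rewrite ler_wpM2l ?mulr_ge0 ?invr_ge0 ?exprn_ge0//.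
  have -> : 4 = 2 * 2 :> R by rewrite -natrM.
  by rewrite exprMn invfM mulfVK ?gt_eqF// exprVn.
have incle2 n : (P (\bigcup_k inck n k) <= (2 * (M * C * n.+1%:R ^- 2))%:E)%E.
  apply: (le_trans (generalized_Boole_inequality P (minck n) _)); first exact: bigcup_measurable.
  apply: (nneseries_le_real _ (inckle n)) => // m.
  rewrite -mulr_sumr mulrC ler_wpM2r ?mulr_ge0 ?invr_ge0 ?exprn_ge0//.
  apply: (le_trans (geometric_sum_le _ _)).
    by rewrite invr_ge0 ler0n invf_lt1// ltr1n.
  by rewrite (_ : 1 - 2^-1 = 2^-1) ?invrK//; field.
have valle n : (P (val n) <= (M * C * n.+1%:R ^- 2)%:E)%E.
  apply: (le_trans (tail_value (N1 n) (powR_ge0 _ _))).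
  have := HM n 0%N n.+1%:R; rewrite !expr0 invr1 powR1 mul1r !mulr1 lexx/=.
  rewrite ler_nat leqnSn => /(_ isT) h.
  by rewrite lee_fin [leRHS]mulrAC; exact: ler_wpM2r.
(* One M C for the value at n+1, and two for the sum of the 2^(-k) over all levels. *)
exists (3 * (M * C)) => [|n]; first by rewrite !mulr_ge0.
apply: (le_trans (measureU2 _ _ _)) => //; first exact: bigcup_measurable.
apply: (le_trans (leeD (valle n) (incle2 n))).
by rewrite -EFinD lee_fin le_eqVlt; apply/orP; left; apply/eqP; ring.
Qed.

Let bad_io : P (lim_sup_set bad) = 0%E.
Proof.
have [M M0 HM] := bad_le; apply: lim_sup_set_cvg0 => //.
apply: (@le_lt_trans _ _ (M * 2)%:E); last exact: ltry.
apply: (nneseries_le_real _ HM) => // n.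
by rewrite -mulr_sumr ler_wpM2l// inv_sqr_sum_le.
Qed.

Let good_cvg w : {within `[0, +oo[, continuous (Y ^~ w)} -> ~ lim_sup_set bad w ->
  Y t w / t @[t --> +oo] --> (0 : R).
Proof.
move=> /continuous_within_itvcyP[cY _] nb.
have [n0 good] : exists n0, forall n, (n0 <= n)%N -> ~ bad n w.
  move/existsNP : nb => [n0 /not_implyP[_ H]].
  by exists n0 => n n0n bn; apply: H; exists n.
(* The 1 accounts for the value at the integer part n+1 of t, the geometric sum for the chaining
   from n+1 to t. *)
pose L := 1 + (1 - q)^-1.
have L0 : 0 <= L by rewrite addr_ge0// invr_ge0 subr_ge0 ltW.
have be : 0 < 1 - (b + e) by rewrite (_ : 1 - (b + e) = e)//; rewrite /e; field.
have bound t : n0.+1%:R <= t -> `|Y t w / t| <= L * t `^ (- (1 - (b + e))).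
  move=> n0t; have t1 : 1 <= t by rewrite (le_trans _ n0t)// ler1n.
  have t0 : 0 < t by exact: lt_le_trans t1.
  have /andP[mt tm] := truncn_itv (ltW t0); set m := Num.truncn t in mt tm.
  have m0 : (n0.+1 <= m)%N by rewrite -ltnS -(ltr_nat R) (le_lt_trans n0t).
  have [n mE] : exists n, m = n.+1 by exists m.-1; rewrite prednK// (leq_ltn_trans _ m0).
  move: mt tm; rewrite mE => mt tm.
  have n0n : (n0 <= n)%N by move: m0; rewrite mE ltnS.
  have nbad := good n n0n.
  have Yn : `|Y n.+1%:R w| <= n.+1%:R `^ (b + e).
    by rewrite leNgt; apply/negP => h; apply: nbad; left.
  have Yt : `|Y t w - Y n.+1%:R w| <= (1 - q)^-1 * n.+1%:R `^ (b + e).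
    apply: (@dyadic_chaining _ (Y ^~ w)); rewrite ?q0 ?q1 ?powR_ge0//.
    - move=> k j jk; rewrite leNgt; apply/negP => h; apply: nbad; right; exists k => //.
      by rewrite /inck -bigcup_mkord; exists j.
    - by rewrite mt natr1 ltW.
    - by apply: cY; rewrite in_itv/= t0.
  have tb : `|Y t w| <= L * t `^ (b + e).
    apply: (@le_trans _ _ (L * n.+1%:R `^ (b + e))).
      have -> : Y t w = Y n.+1%:R w + (Y t w - Y n.+1%:R w) by ring.
      by rewrite mulrDl mul1r (le_trans (ler_normD _ _))// lerD.
    apply: ler_wpM2l => //; apply: ge0_ler_powR; rewrite ?nnegrE ?(ltW t0)//.
    by rewrite addr_ge0 ?ltW.
  rewrite normrM normfV (ger0_norm (ltW t0)) ler_pdivrMr//.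
  rewrite (le_trans tb)// -mulrA ler_wpM2l// -[X in _ * X]powRr1 ?(ltW t0)//.
  rewrite -powRD ?(gt_eqF t0) ?implybT//.
  by rewrite (_ : - (1 - (b + e)) + 1 = b + e)//; ring.
apply: norm_cvg0; apply: (@squeeze_cvgr _ _ _ _ (cst 0) (fun t => L * t `^ (- (1 - (b + e))))).
- by near=> t; rewrite normr_ge0/= bound.
- exact: cvg_cst.
- apply: (@cvg_to_eq _ _ _ _ (L * 0)); first by rewrite mulr0.
  by apply: cvgMr; exact: powRN_cvgy.
Unshelve. all: end_near. Qed.

Lemma ae_sublinear_growth :
  {ae P, forall w, {within `[0, +oo[, continuous (fun t => Y t w)}} ->
  {ae P, forall w, Y t w / t @[t --> +oo] --> (0 : R)}.
Proof.
move=> [N [mN N0 cN]]; exists (N `|` lim_sup_set bad); split.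
- apply: measurableU => //; apply: bigcap_measurable => // k _.
  by apply: bigcup_measurable => n _.
- apply/eqP; rewrite eq_le measure_ge0 andbT (le_trans (measureU2 _ _ _))//.
    apply: bigcap_measurable => // k _; exact: bigcup_measurable.
  rewrite [X in (X + _)%E](_ : _ = 0%E) ?add0e; last exact: N0.
  by rewrite [leLHS](_ : _ = 0%E)//; exact: bad_io.
- move=> w /= nw; apply: contrapT => /not_orP[wN wb]; apply: nw.
  by apply: good_cvg => //; apply: contrapT => h; exact/wN/cN.
Qed.

End sublinear_growth.

(** * Multifractional Brownian motion *)

Section mbm_law.
Context {R : realType} d {T : measurableType d} (P : probability T R)
  (W : (R -> R) -> T -> R) (H : R -> R) (Y : R -> T -> R).
Notation leb := (@lebesgue_measure R).
Hypothesis wW : gaussian_white_noise P W.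
Hypothesis mbmY : is_mBm P W H Y.
Hypothesis mY : forall t, measurable_fun setT (Y t).

Let mW f : L2fun f -> measurable_fun setT (W f).
Proof. by move=> Lf; have [m _] := wW; exact: m. Qed.

Let expectation_ae_eq (g : R -> R) (X X' : T -> R) : measurable_fun setT g ->
  measurable_fun setT X -> measurable_fun setT X' -> {ae P, forall w, X w = X' w} ->
  ('E_P[fun w => g (X w)] = 'E_P[fun w => g (X' w)])%E.
Proof.
move=> mg mX mX' XX'; rewrite unlock; apply: ae_eq_integral => //.
- by apply/measurable_EFinP; exact: (measurableT_comp mg mX).
- by apply/measurable_EFinP; exact: (measurableT_comp mg mX').
- by apply: (ae_mono _ XX') => w -> _.
Qed.

Lemma mbm_cos_sin t : 0 < H t < 1 -> 0 < t -> forall s : R,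
  ('E_P[fun w => cos (s * Y t w)]
    = (expR (- (s ^+ 2 * (t `^ (2 * H t) * Cst (H t) ^+ 2) / 2)))%:E)%E /\
  ('E_P[fun w => sin (s * Y t w)] = 0)%E.
Proof.
move=> Ht t0 s; have [f [Lf [Pf Yf]]] := mbmY (ltW t0).
have [Ec Es] := white_noise1 wW Lf s.
have v : \int[leb]_x (f x ^+ 2) = t `^ (2 * H t) * Cst (H t) ^+ 2.
  by rewrite (plancherel_norm Lf (plancherel_FT_pair Pf)) /Rintegral integral_mbm_kernel_sq.
rewrite -v -Ec -Es; split.
- exact: (expectation_ae_eq (measurable_cosM s) (mY t) (mW Lf) Yf).
- exact: (expectation_ae_eq (measurable_sinM s) (mY t) (mW Lf) Yf).
Qed.

(** The increment is almost surely W f - W g, and [plancherel_pairB] lets the norm identity apply to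
    f - g and the difference of the kernels. The variance v is existential, since only its bound is
    used. *)
Lemma mbm_increment_cos_sin a b e t s : 0 < a -> b < 1 -> 0 < e ->
  a + e <= H t <= b - e -> a + e <= H s <= b - e -> 0 < s -> s < t ->
  exists2 v : R, 0 <= v <=
      2 * ((t - s) `^ (2 * a) * Cst a ^+ 2 + (t - s) `^ (2 * b) * Cst b ^+ 2)
      + 4 * ((H t - H s) / e) ^+ 2 * (s `^ (2 * a) * Cst a ^+ 2 + s `^ (2 * b) * Cst b ^+ 2)
  & forall u : R,
  ('E_P[fun w => cos (u * (Y t w - Y s w))] = (expR (- (u ^+ 2 * v / 2)))%:E)%E /\
  ('E_P[fun w => sin (u * (Y t w - Y s w))] = 0)%E.
Proof.
move=> a0 b1 e0 Ht Hs s0 st.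
have t0 := lt_trans s0 st.
have [f [Lf [Pf Yf]]] := mbmY (ltW t0); have [g [Lg [Pg Yg]]] := mbmY (ltW s0).
have PB := plancherel_pairB Lf Lg (plancherel_FT_pair Pf) (plancherel_FT_pair Pg).
exists (\int[leb]_x ((f x - g x) ^+ 2)).
  rewrite Rintegral_ge0//=; last by move=> x _; exact: sqr_ge0.
  rewrite (plancherel_norm (L2_sub Lf Lg) PB) -lee_fin.
  have [[_ i1] [[_ i2] _]] := PB.
  rewrite Rintegral_integral; last exact: integrable_realD i1 i2.
  exact: integral_mbm_kernel_increment_le.
move=> u; have [<- <-] := white_noise2 wW Lf Lg u.
have YB : {ae P, forall w, Y t w - Y s w = W f w - W g w}.
  move: Yf Yg => [N [mN N0 cN]] [M [mM M0 cM]]; exists (N `|` M); split.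
  - exact: measurableU.
  - apply/eqP; rewrite eq_le measure_ge0 andbT (le_trans (measureU2 _ mN mM))//.
    by rewrite [X in (X + _)%E](_ : _ = 0%E) ?add0e; [rewrite [leLHS](_ : _ = 0%E)//; exact: M0|exact: N0].
  - move=> w /= nw; apply: contrapT => /not_orP[wN wM]; apply: nw.
    have -> : Y t w = W f w by apply: contrapT => h; exact/wN/cN.
    by have -> : Y s w = W g w by apply: contrapT => h; exact/wM/cM.
have mYB : measurable_fun setT (fun w => Y t w - Y s w) by exact: measurable_funB.
have mWB : measurable_fun setT (fun w => W f w - W g w) by apply: measurable_funB; exact: mW.
split.
- exact: (expectation_ae_eq (measurable_cosM u) mYB mWB YB).
- exact: (expectation_ae_eq (measurable_sinM u) mYB mWB YB).
Qed.

Lemma Cst_gt0 (h : R) : 0 < h < 1 -> 0 < Cst h.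
Proof.
move=> /andP[h0 h1]; rewrite sqrtr_gt0 divr_gt0 ?pi_gt0// !mulr_gt0//.
  by apply: Gamma_gt0; rewrite ?pmulrn_lgt0// -(mulr_natr h); lra.
by apply: sin_gt0_pi; rewrite ?in_itv/= ?mulr_gt0 ?pi_gt0// gtr_pMr ?pi_gt0.
Qed.

Lemma mbm_standardized_law t (A : set R) : 0 < H t < 1 -> 0 < t -> measurable A ->
  P ((fun w => Y t w / (t `^ H t * Cst (H t))) @^-1` A) = normal_prob 0 1 A.
Proof.
move=> Ht t0 mA; pose c := t `^ H t * Cst (H t).
have c0 : 0 < c by rewrite mulr_gt0 ?powR_gt0 ?Cst_gt0.
have v : t `^ (2 * H t) * Cst (H t) ^+ 2 = c ^+ 2.
  by rewrite exprMn -(powR_mulrn 2 (powR_ge0 t (H t))) -powRrM (mulrC 2).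
have Ec s : ('E_P[fun w => cos (s * Y t w)] = (expR (- (s ^+ 2 * c ^+ 2 / 2)))%:E)%E.
  by have [] := mbm_cos_sin Ht t0 s; rewrite v.
have Es s : ('E_P[fun w => sin (s * Y t w)] = 0)%E by have [] := mbm_cos_sin Ht t0 s.
have mB : measurable ((fun y : R => y / c) @^-1` A).
  rewrite -[X in measurable X]setTI.
  have mc : measurable_fun setT (fun y : R => y / c) by exact: measurable_funM.
  exact: mc.
rewrite -[LHS]/(P (Y t @^-1` ((fun y : R => y / c) @^-1` A))).
rewrite (gaussian_law (mY t) (sqr_ge0 c) Ec Es mB) sqrtr_sqr gtr0_norm//.
by congr (normal_prob 0 1 _); apply/seteqP; split=> x /=; rewrite mulrAC mulfV ?mul1r// gt_eqF.
Qed.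

End mbm_law.

Section normal_symmetry.
Context {R : realType}.

(** Reflection preserves the characteristic function: cos is even and the sine integrals vanish. *)
Lemma normal_prob_opp (A : set R) : measurable A ->
  normal_prob 0 1 ((fun x : R => - x) @^-1` A) = normal_prob 0 1 A.
Proof.
have mI : measurable_fun setT (fun x : R => x) by exact: measurable_id.
have mN : measurable_fun setT (fun x : R => - x) by exact: measurable_fun_opp mI.
move=> mA; apply: (characteristic_function_unique (P1 := normal_prob 0 1)
  (P2 := normal_prob 0 1) (Z1 := fun x : R => - x) (Z2 := fun x : R => x) mN mI) => // u.
- by apply: eq_Rintegral => x _; rewrite mulrN cosN.
- rewrite [RHS]normal_prob_sin -[RHS](normal_prob_sin (- u)).
  by apply: eq_Rintegral => x _; rewrite mulrN mulNr.
Qed.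

Lemma normal_prob_quantile_sym (alpha z : R) : 0 < alpha < 1 ->
  normal_prob 0 1 `]-oo, z] = (1 - alpha / 2)%:E ->
  normal_prob 0 1 `[- z, z] = (1 - alpha)%:E.
Proof.
move=> /andP[a0 a1] Hz.
have NC (A : set R) : measurable A -> normal_prob 0 1 (~` A) = (1 - normal_prob 0 1 A)%E.
  by move=> mA; exact: (@probability_setC _ _ _ (normal_prob (0 : R) 1)).
have NU (A B : set R) : measurable A -> measurable B -> A `&` B = set0 ->
    normal_prob 0 1 (A `|` B) = (normal_prob 0 1 A + normal_prob 0 1 B)%E.
  by move=> mA mB AB; exact: (@measureU _ _ _ (normal_prob (0 : R) 1)).
have Nle (A B : set R) : measurable A -> measurable B -> A `<=` B ->
    (normal_prob 0 1 A <= normal_prob 0 1 B)%E.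
  by move=> mA mB AB; apply: (@le_measure _ _ _ (normal_prob (0 : R) 1)); rewrite ?inE.
have up : normal_prob 0 1 (`]z, +oo[ : set R) = (alpha / 2)%:E.
  rewrite -setCitvl NC; last exact: measurable_itv.
  by rewrite Hz -EFinB; congr EFin; ring.
have low : normal_prob 0 1 (`]-oo, - z[ : set R) = (alpha / 2)%:E.
  rewrite -up -(@normal_prob_opp `]z, +oo[); last exact: measurable_itv.
  congr (normal_prob 0 1 _); apply/seteqP; split=> x /=; rewrite !in_itv/= andbT.
    by rewrite ltrNr.
  by rewrite ltrNr.
(* If z < 0, then []-oo, z]] lies in []-oo, - z[], so 1 - alpha/2 <= alpha/2, against alpha < 1.
   With z nonnegative, the interval is what remains of []-oo, z]] after removing the lower tail. *)
have z0 : 0 <= z.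
  rewrite leNgt; apply/negP => z0.
  have := Nle `]-oo, z]%classic `]-oo, - z[%classic.
  move=> /(_ (measurable_itv _) (measurable_itv _)).
  have zz : `]-oo, z]%classic `<=` (`]-oo, - z[%classic : set R).
    by move=> x /=; rewrite !in_itv/= => /le_lt_trans; apply; lra.
  by move=> /(_ zz); rewrite Hz low lee_fin; lra.
have E : `]-oo, z]%classic = `]-oo, - z[ `|` `[- z, z] :> set R.
  by rewrite -itv_bndbnd_setU ?bnd_simp//; lra.
move: Hz; rewrite E NU; [|exact: measurable_itv..|]; last first.
  by apply/seteqP; split=> // x [] /=; rewrite !in_itv/= => xz /andP[zx _]; lra.
rewrite low; case: (normal_prob 0 1 _) => // r [rE].
by congr EFin; lra.
Qed.

End normal_symmetry.

Section mbm_sublinear.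
Context {R : realType} d {T : measurableType d} (P : probability T R)
  (W : (R -> R) -> T -> R) (H : R -> R) (Y : R -> T -> R) (h1 h2 D kappa : R).
Hypotheses (h1_gt0 : 0 < h1) (h12 : h1 < h2) (h2_lt1 : h2 < 1).
Hypothesis H1 : forall t, 0 <= t -> h1 <= H t <= h2.
Hypothesis kappa0 : 0 < kappa.
Hypothesis H2 : forall t s, 0 < s -> s <= t -> `|H t - H s| <= D * (t - s) `^ kappa.
Hypothesis wW : gaussian_white_noise P W.
Hypothesis mbmY : is_mBm P W H Y.
Hypothesis mY : forall t, measurable_fun setT (Y t).

(** A margin that keeps a = h1 - e positive and b = h2 + e below 1, while every H_t stays at
    distance at least e from a and b, as the kernel comparison demands. *)
Let e : R := Num.min h1 (1 - h2) / 2.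
Let a : R := h1 - e.
Let b : R := h2 + e.
(** Over a step u <= 1, the change of time costs u^(2a) in variance and the Hoelder change of the
    Hurst index costs u^(2 kappa); the smaller exponent governs. *)
Let g : R := Num.min a kappa.
Let V : R := Cst a ^+ 2 + Cst b ^+ 2.
(** The [+ 1] ensures strict positivity. *)
Let K : R := V * (2 + 4 * (D / e) ^+ 2) + 1.

Let e0 : 0 < e. Proof. by rewrite divr_gt0// lt_min h1_gt0 subr_gt0. Qed.

Let a0 : 0 < a.
Proof.
have : Num.min h1 (1 - h2) <= h1 by rewrite ge_min lexx.
by move: h1_gt0; rewrite /a /e; lra.
Qed.

Let b1 : b < 1.
Proof.
have : Num.min h1 (1 - h2) <= 1 - h2 by rewrite ge_min lexx orbT.
by move: h2_lt1; rewrite /b /e; lra.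
Qed.

Let ab : a <= b.
Proof. by rewrite /a /b; move: e0 h12; lra. Qed.

Let b0 : 0 < b. Proof. exact: lt_le_trans ab. Qed.

Let g0 : 0 < g. Proof. by rewrite lt_min a0. Qed.

Let Hab t : 0 <= t -> a + e <= H t <= b - e.
Proof. by move=> t0; rewrite /a /b subrK addrK; exact: H1. Qed.

Let V0 : 0 <= V. Proof. by rewrite addr_ge0 ?sqr_ge0. Qed.

Let VK : V <= K.
Proof.
have : 0 <= V * (1 + 4 * (D / e) ^+ 2) by rewrite mulr_ge0// addr_ge0// mulr_ge0 ?sqr_ge0.
by rewrite /K; lra.
Qed.

Let K0 : 0 < K.
Proof. by rewrite /K ltr_wpDl// mulr_ge0// addr_ge0// mulr_ge0 ?sqr_ge0. Qed.

Let mixed_le (x p : R) : x `^ (2 * a) <= p -> x `^ (2 * b) <= p ->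
  x `^ (2 * a) * Cst a ^+ 2 + x `^ (2 * b) * Cst b ^+ 2 <= p * V.
Proof. by move=> xa xb; rewrite [p * V]mulrDr lerD// ler_wpM2r ?sqr_ge0. Qed.

Let large_le s : 1 <= s ->
  s `^ (2 * a) * Cst a ^+ 2 + s `^ (2 * b) * Cst b ^+ 2 <= s `^ (2 * b) * V.
Proof. by move=> s1; apply: mixed_le => //; rewrite ler_powR// ler_wpM2l. Qed.

Let small_powR (u p : R) : 0 < u -> u <= 1 -> g <= p -> u `^ (2 * p) <= u `^ (2 * g).
Proof.
move=> u0 u1 gp; rewrite /powR !(gt_eqF u0) ler_expR ler_wnM2r ?ln_le0//.
by rewrite ler_wpM2l.
Qed.

Let variance_le s u : 1 <= s -> 0 < u -> u <= 1 ->
  2 * (u `^ (2 * a) * Cst a ^+ 2 + u `^ (2 * b) * Cst b ^+ 2)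
  + 4 * ((H (s + u) - H s) / e) ^+ 2 * (s `^ (2 * a) * Cst a ^+ 2 + s `^ (2 * b) * Cst b ^+ 2)
  <= K * s `^ (2 * b) * u `^ (2 * g).
Proof.
move=> s1 u0 u1; have s0 : 0 < s := lt_le_trans ltr01 s1.
have ga : g <= a by rewrite ge_min lexx.
have gk : g <= kappa by rewrite ge_min lexx orbT.
have sb1 : 1 <= s `^ (2 * b) by rewrite -[leLHS](powRr0 s) ler_powR// mulr_ge0 ?(ltW b0).
set U := u `^ (2 * g); set S := s `^ (2 * b).
have U0 : 0 <= U by exact: powR_ge0.
have S0 : 0 <= S by exact: powR_ge0.
have A1 : u `^ (2 * a) * Cst a ^+ 2 + u `^ (2 * b) * Cst b ^+ 2 <= U * V.
  by apply: mixed_le; rewrite small_powR// (le_trans ga).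
have A2 := large_le s1.
have A3 : ((H (s + u) - H s) / e) ^+ 2 <= (D / e) ^+ 2 * U.
  have Hu : `|H (s + u) - H s| <= D * u `^ kappa.
    have su : s <= s + u by rewrite lerDl ltW.
    by have := H2 s0 su; rewrite (_ : s + u - s = u)//; ring.
  have Hu2 : (H (s + u) - H s) ^+ 2 <= D ^+ 2 * U.
    rewrite -(real_normK (num_real (H (s + u) - H s))).
    apply: (@le_trans _ _ ((D * u `^ kappa) ^+ 2)).
      by rewrite ler_pXn2r// nnegrE (le_trans _ Hu).
    rewrite exprMn ler_wpM2l ?sqr_ge0//.
    rewrite -(powR_mulrn 2 (powR_ge0 u kappa)) -powRrM (mulrC kappa).
    exact: small_powR.
  by rewrite [leLHS]expr_div_n [(D / e) ^+ 2]expr_div_n [leRHS]mulrAC ler_pM2r// invr_gt0 exprn_gt0.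
apply: (@le_trans _ _ (2 * (U * V) + 4 * ((D / e) ^+ 2 * U) * (S * V))).
  apply: lerD; first by rewrite ler_wpM2l.
  apply: ler_pM => //; first by rewrite mulr_ge0 ?sqr_ge0.
    by rewrite addr_ge0// mulr_ge0 ?powR_ge0 ?sqr_ge0.
  by rewrite ler_wpM2l.
(* As S >= 1, the term without growth in s is absorbed into the one that grows like s^(2b). *)
have UV : U * V <= U * V * S by rewrite ler_peMr// mulr_ge0.
have USge : 0 <= U * S by rewrite mulr_ge0.
have -> : K * S * U = 2 * (U * V * S) + 4 * ((D / e) ^+ 2 * U) * (S * V) + U * S.
  by rewrite /K; ring.
by rewrite -[leLHS]addr0 lerD// lerD2r ler_wpM2l.
Qed.

Lemma mbm_sublinear : {ae P, forall w, {within `[0, +oo[, continuous (fun t => Y t w)}} ->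
  {ae P, forall w, Y t w / t @[t --> +oo] --> (0 : R)}.
Proof.
have C0 : 0 <= @tail_cst R.
  apply: mulr_ge0; first exact: normal_peak_ge0.
  by apply: Rintegral_ge0 => y _; exact: expR_ge0.
apply: (ae_sublinear_growth K0 g0 b0 b1 C0 mY).
- move=> s u x s1 u0 u1 x0; have s0 : 0 < s := lt_le_trans ltr01 s1.
  have su : s < s + u by rewrite ltrDl.
  have [v /andP[v0 vle] cs] := mbm_increment_cos_sin wW mbmY mY a0 b1 e0
    (Hab (ltW (lt_trans s0 su))) (Hab (ltW s0)) s0 su.
  have mB : measurable_fun setT (fun w => Y (s + u) w - Y s w) by exact: measurable_funB.
  apply: (gaussian_tail mB v0 (fun z => (cs z).1) (fun z => (cs z).2)) => //.
    rewrite (le_trans vle)//.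
    have -> : s + u - s = u by ring.
    exact: variance_le.
  by rewrite !mulr_gt0 ?powR_gt0.
- move=> s x s1 x0; have s0 : 0 < s := lt_le_trans ltr01 s1.
  have Hs : 0 < H s < 1.
    have /andP[? ?] := H1 (ltW s0); apply/andP; split; first exact: lt_le_trans h1_gt0 _.
    exact: le_lt_trans h2_lt1.
  have cs := mbm_cos_sin wW mbmY mY Hs s0.
  apply: (gaussian_tail (mY s) _ (fun z => (cs z).1) (fun z => (cs z).2)) => //.
  + by rewrite mulr_ge0 ?powR_ge0 ?sqr_ge0.
  + have abH : a <= H s <= b.
      by have /andP[? ?] := Hab (ltW s0); apply/andP; split; move: e0; lra.
    rewrite (le_trans (powR_Cst_le a0 b1 abH s0))// (le_trans (large_le s1))//.
    by rewrite mulrC ler_wpM2r// powR_ge0.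
  + by rewrite mulr_gt0 ?powR_gt0.
Qed.

End mbm_sublinear.
Unset Implicit Arguments.

(** [is_mBm] fixes each Y_t only up to a null set depending on t, whereas the almost sure limit
    involves uncountably many times at once; path continuity is what ties these times together. The
    statements at a fixed T use only the law of Y_T. *)
Theorem theorem10 (R : realType) (d : measure_display) (Omega : measurableType d)
  (P : probability Omega R) (W : (R -> R) -> Omega -> R)
  (H : R -> R) (h1 h2 D kappa : R) (Y : R -> Omega -> R) (theta : R) :
  (forall t, 0 <= t -> 0 < H t < 1) ->
  {within `[0, +oo[, continuous H} ->
  0 < h1 -> h1 < h2 -> h2 < 1 ->
  (forall t, 0 <= t -> h1 <= H t <= h2) ->
  0 < D -> 0 < kappa <= 1 ->
  (forall t s, 0 < s -> s <= t -> `|H t - H s| <= D * (t - s) `^ kappa) ->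
  gaussian_white_noise P W ->
  is_mBm P W H Y ->
  (forall t, measurable_fun setT (Y t)) ->
  {ae P, forall w, {within `[0, +oo[, continuous (fun t => Y t w)}} ->
  let X := fun t w => theta * t + Y t w in
  let theta_hat := fun T w => X T w / T in
  {ae P, forall w, theta_hat T w @[T --> +oo] --> theta}
  /\
  (forall T, 0 < T ->
     forall A, measurable A ->
       P ((fun w => T `^ (1 - H T) / Cst (H T) * (theta_hat T w - theta)) @^-1` A)
       = normal_prob 0 1 A)
  /\
  (forall alpha, 0 < alpha < 1 -> forall z : R,
     normal_prob 0 1 `]-oo, z] = (1 - alpha / 2)%:E ->
     forall T, 0 < T ->
       P [set w | theta_hat T w - Cst (H T) / T `^ (1 - H T) * z <= theta
                   <= theta_hat T w + Cst (H T) / T `^ (1 - H T) * z]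
       = (1 - alpha)%:E).
Proof.
move=> H01 cH h1_gt0 h12 h2_lt1 Hh D0 /andP[kappa0 kappa1] HD wW mbmY mY cY X theta_hat.
have estimE T w : 0 < T ->
    T `^ (1 - H T) / Cst (H T) * (theta_hat T w - theta) = Y T w / (T `^ H T * Cst (H T)).
  move=> T0; have TH0 : T `^ H T != 0 by rewrite gt_eqF// powR_gt0.
  have C0 : Cst (H T) != 0 by rewrite gt_eqF// Cst_gt0// H01// ltW.
  rewrite powRB ?(gt_eqF T0) ?implybT// powRr1 ?ltW// /theta_hat /X.
  by field; rewrite TH0 C0 gt_eqF.
have law T : 0 < T -> forall A, measurable A ->
    P ((fun w => T `^ (1 - H T) / Cst (H T) * (theta_hat T w - theta)) @^-1` A)
    = normal_prob 0 1 A.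
  move=> T0 A mA; under eq_fun do rewrite estimE//.
  by apply: (mbm_standardized_law wW mbmY mY) => //; exact: H01 (ltW T0).
split; last split => //.
- have AE := mbm_sublinear h1_gt0 h12 h2_lt1 Hh kappa0 HD wW mbmY mY cY.
  apply: (ae_mono (mu := P) _ AE) => w Yw.
  apply: (@cvg_trans _ (theta + Y T w / T @[T --> +oo])).
    apply: near_eq_cvg; near=> T; rewrite /theta_hat /X mulrDl mulfK//.
    by rewrite gt_eqF//; near: T; exact: nbhs_pinfty_gt.
  apply: (@cvg_to_eq _ _ _ _ (theta + 0)); first by rewrite addr0.
  by apply: cvgD => //; exact: cvg_cst.
- move=> alpha alpha01 z Hz T T0.
  rewrite -(normal_prob_quantile_sym alpha01 Hz) -(law T T0); last exact: measurable_itv.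
  congr (P _); apply/seteqP.
  have TH0 : 0 < T `^ (1 - H T) by rewrite powR_gt0.
  have C0 : 0 < Cst (H T) by rewrite Cst_gt0// H01// ltW.
  set c := Cst (H T) / T `^ (1 - H T).
  have c0 : 0 < c by rewrite divr_gt0.
  have -> : T `^ (1 - H T) / Cst (H T) = c^-1 by rewrite invf_div.
  have E w : (theta_hat T w - c * z <= theta <= theta_hat T w + c * z) =
      (- z <= c^-1 * (theta_hat T w - theta) <= z).
    rewrite ler_pdivlMl// ler_pdivrMl// mulrN.
    by apply/andP/andP => -[? ?]; split; lra.
  by split=> w /=; rewrite in_itv/= E.
Unshelve. all: end_near. Qed.
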